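(* Let $G$ be a profinite group, let $\mathbb{F}$ be a finite field of characteristic $p$, and let $\rho: G \to \mathrm{GL}_d(\mathbb{F})$ be an absolutely irreducible continuous representation. Assume that $H^i(G,\mathrm{End}_{\mathbb{F}}(\rho))$ is finite-dimensional over $\mathbb{F}$ for all $i \geq 0$. Let $C = C^\bullet(G,\mathrm{End}_{\mathbb{F}}(\rho))$ be the dg-algebra of continuous inhomogeneous cochains (with differential $d_C$ and cup-product multiplication $m_{2,C}$) and $H = H^\bullet(G,\mathrm{End}_{\mathbb{F}}(\rho))$ its cohomology. Then there exist a minimal $A_\infty$-algebra structure $m = (m_n)_{n\ge 1}$ on $H$ (i.e. $m_1=0$), with $m_2$ equal to the cup product on cohomology, and a quasi-isomorphism of $A_\infty$-algebras $f=(f_n)_{n\ge1}: (H,m) \to (C, d_C, m_{2,C})$ with $\mathrm{pr}\circ f_1 = \mathrm{id}_H$; and any such data $(m,f)$ determine an isomorphism of complete local commutative $\mathbb{F}$-algebras \[ \frac{\hat S_{\mathbb{F}}\, (\Sigma H^1)^*}{\big(m^*((\Sigma H^2)^* )\big)} \xrightarrow{\ \sim\ } R_\rho, \] where the ideal in the denominator is generated by the image of $m^*((\Sigma H^2)^* )$ under the abelianization map $\hat T_{\mathbb{F}}(\Sigma H^1)^* \to \hat S_{\mathbb{F}}(\Sigma H^1)^*$. (The left side is the abelianization of the classical hull of the dual bar construction of $(H,m)$.)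
   Context: All cochains are continuous; $\mathrm{End}_{\mathbb{F}}(\rho)$ carries the adjoint $G$-action, and the cup product $C^i\otimes C^j\to C^{i+j}$ is the group-cochain cup product followed by composition in $\mathrm{End}_{\mathbb{F}}(\rho)$; $\mathrm{pr}$ denotes the projection from cocycles to cohomology. $R_\rho$ is the universal deformation ring of $\rho$: the complete local commutative Noetherian $\mathbb{F}$-algebra with residue field $\mathbb{F}$ pro-representing the functor sending a local Artinian commutative $\mathbb{F}$-algebra $A$ with residue field $\mathbb{F}$ to the set of lifts $\rho_A: G\to \mathrm{GL}_d(A)$ of $\rho$ modulo conjugation by $\ker(\mathrm{GL}_d(A)\to\mathrm{GL}_d(\mathbb{F}))$. An $A_\infty$-algebra over $\mathbb{F}$ is a $\mathbb{Z}$-graded vector space $A$ with maps $m_n: A^{\otimes n}\to A$ of degree $2-n$ ($n\ge1$) such that for every $n$, $\sum (-1)^{r+st} m_u(1^{\otimes r}\otimes m_s\otimes 1^{\otimes t})=0$, summing over $n=r+s+t$, $r,t\ge0$, $s\ge1$, $u=r+1+t$. A morphism $f:(A,m)\to(A',m')$ is a sequence $f_n:A^{\otimes n}\to A'$ of degree $1-n$ with $\sum (-1)^{r+st} f_u(1^{\otimes r}\otimes m_s\otimes 1^{\otimes t}) = \sum (-1)^{s} m'_r(f_{i_1}\otimes\cdots\otimes f_{i_r})$, where the first sum is as before and the second runs over $1\le r\le n$ and $n=i_1+\dots+i_r$ with $i_j\ge1$, $s=\sum_{j=1}^{r-1} j(i_j-1)$; it is a quasi-isomorphism if $f_1$ is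 a quasi-isomorphism of complexes $(A,m_1)\to(A',m'_1)$. A dg-algebra is regarded as an $A_\infty$-algebra with $m_1$ the differential, $m_2$ the product, $m_n=0$ for $n\ge3$. Koszul sign rules are in force. Suspension: $(\Sigma H)^i = H^{i+1}$; $\Sigma H^k$ denotes $H^k$ placed in degree $k-1$; $s: H\to\Sigma H$ is the identity map of degree $-1$ and $\omega=s^{-1}$; $b_n := -s\circ m_n\circ \omega^{\otimes n}: (\Sigma H)^{\otimes n}\to \Sigma H$. $(-)^*$ is $\mathbb{F}$-linear dual. $m^*: (\Sigma H^2)^*\to \prod_{n\ge2}((\Sigma H^1)^* )^{\otimes n}\subset \hat T_{\mathbb{F}}(\Sigma H^1)^*$ is the sum over $n$ of the duals of the restrictions $b_n: (\Sigma H^1)^{\otimes n}\to \Sigma H^2$. $\hat T_{\mathbb{F}}(V)=\prod_{n\ge0}V^{\otimes n}$ and $\hat S_{\mathbb{F}}(V)$ are the complete free associative and complete free commutative $\mathbb{F}$-algebras on $V$.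
   Formalization: In b_n = -s∘m_n∘ω^{⊗n}, ω^{⊗n} is taken as the inverse of s^{⊗n}, so on (ΣH^1)^{⊗n} b_n has the extra sign (-1)^{n(n-1)/2}; with the A_∞ signs (-1)^{r+st} the formula read by the Koszul rule is not a bar differential and the isomorphism fails for odd p. *)

(* Defs.v *)
From HB Require Import structures.
From mathcomp Require Import all_boot all_algebra monoid generic_quotient ring_quotient.
From mathcomp Require Import boolp classical_sets functions topology.

Set Implicit Arguments.
Unset Strict Implicit.
Unset Printing Implicit Defensive.

Import GRing.Theory.

Local Open Scope classical_set_scope.
Local Open Scope ring_scope.

HB.mixin Record isTopologicalGroup G of monoid.Group G & Topological G := {
  mulg_continuous : continuous (fun x : G * G => (x.1 * x.2)%g);
  invg_continuous : continuous (fun x : G => (x^-1)%g)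
}.

#[short(type="topGroupType")]
HB.structure Definition TopologicalGroup :=
  {G of isTopologicalGroup G & monoid.Group G & Topological G}.

Definition profinite (G : topGroupType) :=
  [/\ compact [set: G], hausdorff_space G & totally_disconnected [set: G]].

(* Continuity of a map into a discrete space. *)
Section DiscreteMaps.
Variable T : topologicalType.

Definition dcont (V : choiceType) (f : T -> V) :=
  continuous (f : T -> discrete_topology V).

Lemma dcontP (V : choiceType) (f : T -> V) :
  dcont f <-> forall x, \forall y \near x, f y = f x.
Proof.
split=> [fc x|fl x].
  have /= := fc x [set f x]; apply.
  by rewrite /nbhs /= /principal_filter/= => y ->.
move=> A /nbhs_singleton fA; rewrite nbhs_simpl /=.
by apply: filterS (fl x) => y /= ->.
Qed.

Lemma dcont_cst (V : choiceType) (a : V) : dcont (fun=> a).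
Proof. by apply/dcontP => x; near=> y. Unshelve. all: by end_near. Qed.

Lemma dcont_comp (V W : choiceType) (h : V -> W) (f : T -> V) :
  dcont f -> dcont (fun x => h (f x)).
Proof.
move=> /dcontP fl; apply/dcontP => x; near=> y.
by congr h; near: y; exact: fl.
Unshelve. all: by end_near. Qed.

Lemma dcont_comp2 (U V W : choiceType) (h : U -> V -> W) (f : T -> U) (g : T -> V) :
  dcont f -> dcont g -> dcont (fun x => h (f x) (g x)).
Proof.
move=> /dcontP fl /dcontP gl; apply/dcontP => x; near=> y.
by congr h; near: y; [exact: fl | exact: gl].
Unshelve. all: by end_near. Qed.

End DiscreteMaps.

Lemma dcont_pre (S T : topologicalType) (V : choiceType) (h : S -> T) (f : T -> V) :
  continuous h -> dcont f -> dcont (fun x => f (h x)).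
Proof.
move=> hc /dcontP fl; apply/dcontP => x.
exact: (hc x _ (fl (h x))).
Qed.

Arguments dcont_pre {S T V h f} _ _.

Lemma ptws_continuous (S T : topologicalType) (I : choiceType) (h : S -> {ptws I -> T}) :
  (forall i, continuous (fun x => h x i)) -> continuous h.
Proof.
move=> hc x; apply/cvg_sup.
move=> i A [B [[C oC CB] Bx BA]].
have hx : nbhs (h x i) C by apply: open_nbhs_nbhs; split=> //; move: Bx; rewrite -CB.
have sub : (fun y => h y i) @^-1` C `<=` h @^-1` A.
  by move=> y Cy; apply: BA; rewrite -CB.
exact: filterS sub (hc i x C hx).
Qed.
Lemma coord_continuous (T : topologicalType) (I : choiceType) (i : I) :
  continuous (fun x : {ptws I -> T} => x i).
Proof. exact: (@proj_continuous I (fun=> T) i). Qed.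

Section ContinuousMaps.
Variables (T : topologicalType) (K : fieldType) (V : lmodType K).

Definition dcont_pred : {pred T -> V} := fun f => `[< dcont f >].

Record contmap := ContMap { contmap_fun :> T -> V; _ : contmap_fun \in dcont_pred }.

HB.instance Definition _ := [isSub for contmap_fun].
HB.instance Definition _ := [Choice of contmap by <:].

Lemma dcont_pred_submod : subsemimod_closed dcont_pred.
Proof.
split=> [|a f /asboolP fc]; last by apply/asboolP; exact: dcont_comp.
split=> [|f g /asboolP fc /asboolP gc]; apply/asboolP; first exact: dcont_cst.
exact: dcont_comp2.
Qed.
HB.instance Definition _ := GRing.SubChoice_isSubLmodule.Build K (T -> V)
  dcont_pred contmap dcont_pred_submod.

Lemma contmapP (f : contmap) : dcont f.
Proof. by case: f => f /= /asboolP. Qed.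

Definition mk_contmap (f : T -> V) (fc : dcont f) : contmap := ContMap (asboolT fc).

End ContinuousMaps.

Arguments contmapP {T K V} f _ _ _.

Section Cohomology.
Variables (K : fieldType) (C : nat -> lmodType K).
Variable dC : forall i, {linear C i -> C i.+1}.

Definition cocycle_pred i : {pred C i} := fun x => dC i x == 0.

Record cocycle i := Cocycle { cocycle_val :> C i; _ : cocycle_val \in @cocycle_pred i }.

HB.instance Definition _ i := [isSub for @cocycle_val i].
HB.instance Definition _ i := [Choice of cocycle i by <:].

Lemma cocycle_submod i : subsemimod_closed (@cocycle_pred i).
Proof.
split=> [|a x]; last by rewrite !unfold_in linearZ /= => /eqP ->; rewrite scaler0.
split=> [|x y]; rewrite !unfold_in ?linear0 ?linearD //=.
by move=> /eqP -> /eqP ->; rewrite addr0.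
Qed.
HB.instance Definition _ i := GRing.SubChoice_isSubLmodule.Build K (C i)
  (@cocycle_pred i) (cocycle i) (cocycle_submod i).

Definition coboundary i : C i -> Prop :=
  match i with
  | 0 => fun x => x = 0
  | j.+1 => fun x => exists y : C j, x = dC j y
  end.

Definition coboundary_pred i : {pred cocycle i} := fun z => `[< coboundary (val z) >].

Lemma coboundary_submod i : subsemimod_closed (@coboundary_pred i).
Proof.
have vZ a (x : cocycle i) : val (a *: x) = a *: val x by rewrite linearZ.
have vD (x y : cocycle i) : val (x + y) = val x + val y by rewrite linearD.
have v0 : val (0 : cocycle i) = 0 by rewrite linear0.
case: i vZ vD v0 => [|i] vZ vD v0.
  split=> [|a x /asboolP h]; last by apply/asboolP; rewrite vZ h scaler0.
  split=> [|x y /asboolP hx /asboolP hy]; apply/asboolP => //.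
  by rewrite vD hx hy addr0.
split=> [|a x /asboolP [y h]].
  split=> [|x y /asboolP [x' hx] /asboolP [y' hy]]; apply/asboolP.
    by exists 0; rewrite v0 linear0.
  by exists (x' + y'); rewrite vD linearD hx hy.
by apply/asboolP; exists (a *: y); rewrite vZ linearZ h.
Qed.
HB.instance Definition _ i := GRing.isZmodClosed.Build (cocycle i)
  (@coboundary_pred i) (GRing.subsemimod_closedB (@coboundary_submod i)).

Definition coh i := Quotient.quot (@coboundary_pred i).
HB.instance Definition _ i := GRing.Zmodule.on (coh i).
HB.instance Definition _ i := EqQuotient.on (coh i).

Local Open Scope quotient_scope.

Definition pr i (z : cocycle i) : coh i := \pi_(coh i) z.

Definition coh_scale i (a : K) : coh i -> coh i := lift_op1 (coh i) ( *:%R a).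

Lemma pr_scale i a (z : cocycle i) : pr (a *: z) = coh_scale a (pr z).
Proof.
rewrite /pr /coh_scale; unlock; apply/eqP; rewrite eqmodE/=.
rewrite Quotient.equivE -scalerBr.
apply: (@coboundary_submod i).2.
by rewrite Quotient.idealrBE reprK.
Qed.
Lemma prD i : {morph @pr i : x y / x + y}.
Proof. exact: raddfD. Qed.
Lemma coh_scaleA i a b (v : coh i) : coh_scale a (coh_scale b v) = coh_scale (a * b) v.
Proof. by elim/quotW: v => x; rewrite -!pr_scale scalerA. Qed.
Lemma coh_scale1 i (v : coh i) : coh_scale 1 v = v.
Proof. by elim/quotW: v => x; rewrite -!pr_scale scale1r. Qed.
Lemma coh_scaleDr i a : {morph @coh_scale i a : u v / u + v}.
Proof.
move=> u v; elim/quotW: u => x; elim/quotW: v => y.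
by rewrite -prD -!pr_scale scalerDr prD.
Qed.
Lemma coh_scaleDl i (v : coh i) : {morph (@coh_scale i)^~ v : a b / a + b}.
Proof. by elim/quotW: v => x a b; rewrite -!pr_scale scalerDl prD. Qed.
HB.instance Definition _ i := GRing.Zmodule_isLmodule.Build K (coh i)
  (@coh_scaleA i) (@coh_scale1 i) (@coh_scaleDr i) (@coh_scaleDl i).
Lemma pr_is_linear i : linear (@pr i).
Proof. by move=> a x y; rewrite prD pr_scale. Qed.
HB.instance Definition _ i := GRing.isLinear.Build K (cocycle i) (coh i) _ (@pr i) (@pr_is_linear i).
End Cohomology.
Section Monomials.
Variable n : nat.
Definition mon := {ffun 'I_n -> nat}.
Implicit Types a b c : mon.
Definition mone : mon := [ffun=> 0%N].
Definition madd a b : mon := [ffun i => a i + b i]%N.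
Definition msub a b : mon := [ffun i => a i - b i]%N.
Definition mle a b := [forall i, a i <= b i]%N.
Definition mdivs a : seq mon :=
  [seq [ffun i => nat_of_ord (b i)] | b : {dffun forall i : 'I_n, 'I_(a i).+1}].

Lemma mleP a b : reflect (forall i, a i <= b i)%N (mle a b).
Proof. exact: forallP. Qed.
Lemma mem_mdivs a b : (b \in mdivs a) = mle b a.
Proof.
apply/idP/mleP => [/mapP[f _ ->] i|ba]; first by rewrite ffunE -ltnS.
apply/mapP; exists [ffun i => inord (b i) : 'I_(a i).+1]; first by rewrite mem_enum.
by apply/ffunP => i; rewrite !ffunE inordK // ltnS.
Qed.
Lemma mdivs_uniq a : uniq (mdivs a).
Proof.
rewrite map_inj_uniq ?enum_uniq // => f g /ffunP fg.
by apply/ffunP => i; apply/val_inj; have := fg i; rewrite !ffunE.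
Qed.
Lemma mle_refl a : mle a a. Proof. exact/mleP. Qed.
Lemma mle0 a : mle mone a. Proof. by apply/mleP => i; rewrite ffunE. Qed.
Lemma msub_le a b : mle (msub a b) a.
Proof. by apply/mleP => i; rewrite ffunE leq_subr. Qed.
Lemma msubK a b : mle b a -> msub a (msub a b) = b.
Proof. by move=> /mleP h; apply/ffunP => i; rewrite !ffunE subKn. Qed.
Lemma msub0 a : msub a mone = a.
Proof. by apply/ffunP => i; rewrite !ffunE subn0. Qed.
Lemma msubB a b c : msub (msub a b) c = msub a (madd b c).
Proof. by apply/ffunP => i; rewrite !ffunE subnDA. Qed.
Lemma mle_trans a b c : mle a b -> mle b c -> mle a c.
Proof. by move=> /mleP ab /mleP bc; apply/mleP => i; exact: leq_trans (bc i). Qed.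
End Monomials.

Section PowerSeries.
Variables (K : fieldType) (n : nat).
(* K[[X_0, ..., X_(n-1)]], an element being its family of coefficients. *)
Definition pseries := mon n -> K.
HB.instance Definition _ := GRing.Lmodule.copy pseries (mon n -> K^o).
Implicit Types f g h : pseries.

Definition ps_cst (c : K) : pseries := fun a => c *+ (a == mone n).
Definition ps_mul f g : pseries := fun a => \sum_(b <- mdivs a) f b * g (msub a b).

Lemma ps_mulC : commutative ps_mul.
Proof.
move=> f g; apply/funext => a; rewrite /ps_mul.
have pe : perm_eq (mdivs a) [seq msub a b | b <- mdivs a].
  have inj : {in mdivs a &, injective (msub a)}.
    by move=> x y; rewrite !mem_mdivs => xa ya e; rewrite -(msubK xa) e msubK.
  apply: uniq_perm; rewrite ?(map_inj_in_uniq inj) ?mdivs_uniq // => b.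
  rewrite mem_mdivs; apply/idP/mapP => [ba|[c _ ->]]; last exact: msub_le.
  by exists (msub a b); rewrite ?mem_mdivs ?msub_le ?msubK.
rewrite (perm_big _ pe) big_map /= big_seq [RHS]big_seq.
by apply: eq_bigr => b; rewrite mem_mdivs => /msubK ->; rewrite mulrC.
Qed.

Lemma ps_mulA : associative ps_mul.
Proof.
move=> f g h; apply/funext => a; rewrite /ps_mul; symmetry.
transitivity (\sum_(b <- mdivs a) \sum_(c <- mdivs a | mle c b)
    f c * (g (msub b c) * h (msub a b))).
  rewrite big_seq [RHS]big_seq; apply: eq_bigr => b; rewrite mem_mdivs => ba.
  rewrite mulr_suml -[RHS]big_filter.
  have pe : perm_eq (mdivs b) [seq c <- mdivs a | mle c b].
    apply: uniq_perm; rewrite ?filter_uniq ?mdivs_uniq // => c.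
    rewrite mem_filter !mem_mdivs; case cb: (mle c b) => //=.
    by rewrite (mle_trans cb ba).
  by rewrite -(perm_big _ pe); apply: eq_bigr => c _; rewrite mulrA.
rewrite (exchange_big_dep predT) //= big_seq [RHS]big_seq.
apply: eq_bigr => c; rewrite mem_mdivs => ca.
rewrite -big_filter mulr_sumr.
have pe : perm_eq [seq b <- mdivs a | mle c b] [seq madd c b | b <- mdivs (msub a c)].
  have inj : injective (madd c).
    move=> x y /ffunP xy; apply/ffunP => i; have := xy i.
    by rewrite !ffunE => /addnI.
  apply: uniq_perm; rewrite ?(map_inj_uniq inj) ?filter_uniq ?mdivs_uniq // => b.
  rewrite mem_filter mem_mdivs; apply/andP/mapP => [[/mleP cb /mleP ba]|[x]].
    exists (msub b c).
      by rewrite mem_mdivs; apply/mleP => i; rewrite !ffunE leq_sub2r.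
    by apply/ffunP => i; rewrite !ffunE subnKC.
  rewrite mem_mdivs => /mleP xa ->; split; apply/mleP => i; rewrite !ffunE ?leq_addr //.
  by have := xa i; move/mleP: ca => /(_ i) ca; rewrite ffunE leq_subRL.
rewrite (perm_big _ pe) big_map; apply: eq_bigr => b _.
rewrite msubB; congr (_ * (g _ * _)).
by apply/ffunP => i; rewrite !ffunE addKn.
Qed.

Lemma ps_cst_mul c f : ps_mul (ps_cst c) f = c *: f.
Proof.
apply/funext => a; rewrite /ps_mul (bigD1_seq (mone n)) ?mem_mdivs ?mle0 ?mdivs_uniq //=.
rewrite big1 => [|b /negbTE b0]; last by rewrite /ps_cst b0 mulr0n mul0r.
by rewrite /ps_cst eqxx msub0 addr0.
Qed.
Lemma ps_mul1 : left_id (ps_cst 1) ps_mul.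
Proof. by move=> f; rewrite ps_cst_mul scale1r. Qed.
Lemma ps_mulDl : left_distributive ps_mul +%R.
Proof.
move=> f g h; apply/funext => a.
change (ps_mul (f + g) h a = ps_mul f h a + ps_mul g h a).
rewrite /ps_mul -big_split /=.
by apply: eq_bigr => b _; rewrite mulrDl.
Qed.
Lemma ps_one_neq0 : ps_cst 1 != 0.
Proof.
apply/eqP => /(congr1 (@^~ (mone n))) /=; rewrite /ps_cst eqxx => /eqP.
by rewrite oner_eq0.
Qed.
HB.instance Definition _ := GRing.Zmodule_isComNzRing.Build pseries
  ps_mulA ps_mulC ps_mul1 ps_mulDl ps_one_neq0.
Lemma ps_scaleAl (c : K) f g : c *: (f * g) = (c *: f) * g.
Proof. by rewrite -!ps_cst_mul; exact: (ps_mulA (ps_cst c) f g). Qed.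
HB.instance Definition _ := GRing.Lmodule_isLalgebra.Build K pseries ps_scaleAl.
HB.instance Definition _ := GRing.Lalgebra_isComAlgebra.Build K pseries.
Definition psX (i : 'I_n) : pseries := fun a => (a == [ffun j => (j == i) : nat])%:R.
End PowerSeries.

Section IdealQuotient.
Local Open Scope quotient_scope.
Variables (K : fieldType) (S : comAlgType K) (I : idealr S).
Local Notation Q := {ideal_quot I}.
Definition iscale (a : K) : Q -> Q := lift_op1 Q ( *:%R a).
Lemma pi_iscale a (x : S) : \pi_Q (a *: x) = iscale a (\pi x).
Proof.
rewrite /iscale; unlock; apply/eqP; rewrite eqmodE/=.
rewrite Quotient.equivE -scalerBr -mulr_algl.
have h : x - repr (\pi_Q x) \in I by rewrite Quotient.idealrBE reprK.
exact: idealMr h.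
Qed.
Lemma iscaleA a b v : iscale a (iscale b v) = iscale (a * b) v.
Proof. by elim/quotW: v => x; rewrite -!pi_iscale scalerA. Qed.
Lemma iscale1 v : iscale 1 v = v.
Proof. by elim/quotW: v => x; rewrite -!pi_iscale scale1r. Qed.
Lemma iscaleDr a : {morph iscale a : u v / u + v}.
Proof. by move=> u v; elim/quotW: u => x; elim/quotW: v => y; rewrite -rmorphD -!pi_iscale scalerDr; exact: rmorphD. Qed.
Lemma iscaleDl v : {morph iscale^~ v : a b / a + b}.
Proof. by elim/quotW: v => x a b; rewrite -!pi_iscale scalerDl; exact: rmorphD. Qed.
HB.instance Definition _ := GRing.Zmodule_isLmodule.Build K Q iscaleA iscale1 iscaleDr iscaleDl.
Lemma iscaleAl (a : K) (u v : Q) : a *: (u * v) = (a *: u) * v.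
Proof.
elim/quotW: u => x; elim/quotW: v => y.
change (iscale a (\pi_Q x * \pi_Q y) = iscale a (\pi_Q x) * \pi_Q y).
by rewrite -rmorphM -!pi_iscale scalerAl; exact: rmorphM.
Qed.
HB.instance Definition _ := GRing.Lmodule_isLalgebra.Build K Q iscaleAl.
HB.instance Definition _ := GRing.Lalgebra_isComAlgebra.Build K Q.
End IdealQuotient.

(* Graded vector spaces concentrated in degrees >= 0, as group cochains and their
   cohomology are.  A family of multilinear maps f_n : A^(tensor n) -> B of degree
   k - n, for all n >= 1, is one function [f] on sequences of homogeneous elements:
   for l = [:: a_1; ...; a_n], [f e l] is the component in B^e of
   f_n(a_1, ..., a_n); by homogeneity only e = |a_1| + ... + |a_n| + k - n
   contributes.  The value on the empty sequence is never used. *)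
Section GradedMaps.
Variable K : fieldType.
Implicit Types A B : nat -> lmodType K.

Definition gelt A := {i : nat & A i}.
Definition gdeg A (l : seq (gelt A)) : nat := (\sum_(a <- l) tag a)%N.
Definition gmap A B := forall e : nat, seq (gelt A) -> B e.

Definition multilinear A B (f : gmap A B) :=
  forall e (l r : seq (gelt A)) i (a : K) (x y : A i),
    f e (l ++ Tagged A (a *: x + y) :: r) =
    a *: f e (l ++ Tagged A x :: r) + f e (l ++ Tagged A y :: r).

Definition of_degree k A B (f : gmap A B) :=
  forall e (l : seq (gelt A)), (e + size l)%N != (gdeg l + k)%N -> f e l = 0.

(* f_n(l) as a homogeneous element.  When gdeg l + k < size l the truncated
   subtraction gives degree 0, where [f] vanishes by [of_degree k]. *)
Definition gval k A B (f : gmap A B) (l : seq (gelt A)) : gelt B :=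
  Tagged B (f (gdeg l + k - size l)%N l).

(* sum over n = r + s + t of (-1)^(r+st) g_u(1^r (x) m_s (x) 1^t); moving m_s, of
   degree 2 - s, past a_1, ..., a_r gives the Koszul sign (-1)^(s * gdeg (take r l)). *)
Definition stasheff_sum A B (g : gmap A B) (m : gmap A A) : gmap A B :=
  fun e l => let n := size l in
    \sum_(0 <= r < n) \sum_(1 <= s < (n - r).+1)
      let t := (n - r - s)%N in
      (-1) ^+ (r + s * t + s * gdeg (take r l)) *:
        g e (take r l ++ gval 2 m (take s (drop r l)) :: drop (r + s) l).

(* sum over r and n = i_1 + ... + i_r of (-1)^s m'_r(f_(i_1) (x) ... (x) f_(i_r)), with
   s = sum_(1 <= j < r) j (i_j - 1); [koszul] accounts for each f_(i_j), of degree
   1 - i_j, passing the arguments of the previous blocks. *)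
Definition composition_sum A B (m' : gmap B B) (f : gmap A B) : gmap A B :=
  fun e l => let n := size l in
    \sum_(1 <= r < n.+1)
    \sum_(i : r.-tuple 'I_n.+1 | all (leq 1) (map val i) && (sumn (map val i) == n))
      let ii := map val i in
      let s := (\sum_(1 <= j < r) j * (nth 0 ii j.-1 - 1))%N in
      let koszul := (\sum_(j < r) (nth 0 ii j - 1) * gdeg (take (sumn (take j ii)) l))%N in
      (-1) ^+ (s + koszul) *: m' e [seq gval 1 f l' | l' <- reshape ii l].

Definition Ainf_algebra A (m : gmap A A) :=
  [/\ multilinear m, of_degree 2 m &
      forall e l, (0 < size l)%N -> stasheff_sum m m e l = 0].

Definition Ainf_morphism A B (m : gmap A A) (m' : gmap B B) (f : gmap A B) :=
  [/\ multilinear f, of_degree 1 f &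
      forall e l, (0 < size l)%N -> stasheff_sum f m e l = composition_sum m' f e l].

Definition op1 A B (f : gmap A B) i j (x : A i) : B j := f j [:: Tagged A x].

(* Only j.+1 = i matters: m_1 has degree 1. *)
Definition is_boundary A (m : gmap A A) i (x : A i) : Prop :=
  exists j, exists y : A j, x = op1 m i y.

Definition Ainf_quasi_iso A B (m : gmap A A) (m' : gmap B B) (f : gmap A B) :=
  [/\ Ainf_morphism m m' f,
      forall i (x : A i), op1 m i.+1 x = 0 -> is_boundary m' (op1 f i x) -> is_boundary m x &
      forall i (y : B i), op1 m' i.+1 y = 0 ->
        exists2 x : A i, op1 m i.+1 x = 0 & is_boundary m' (y - op1 f i x)].

(* [tagged_as] is used to project onto the component of degree e. *)
Definition dg_Ainf A (d : forall i, {linear A i -> A i.+1}) (mu : forall i j, A i -> A j -> A (i + j)%N) :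
    gmap A A :=
  fun e l => match l with
  | [:: x] => tagged_as (Tagged A (0 : A e)) (Tagged A (d _ (tagged x)))
  | [:: x; y] => tagged_as (Tagged A (0 : A e)) (Tagged A (mu _ _ (tagged x) (tagged y)))
  | _ => 0
  end.

(* b_n = - s o m_n o omega^n, as a map on underlying elements: [bar m e l] in A^e
   stands for b_n(s a_1, ..., s a_n) in (Sigma A)^(e-1).  Here omega^n is the inverse
   of s^n : A^(tensor n) -> (Sigma A)^(tensor n), and the j-th element a_j is passed by
   the n - j last copies of s, whence the sign.  With the sign (-1)^(r+st) in
   the A_infinity relations, this is the choice for which the b_n are the
   components of a square-zero coderivation of the tensor coalgebra. *)
Definition bar A (m : gmap A A) : gmap A A :=
  fun e l => let n := size l in
    - ((-1) ^+ (\sum_(1 <= j < n.+1) (n - j) * nth 0 (map tag l) j.-1)%N *: m e l).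

End GradedMaps.

Section Ideals.
Variable S : comNzRingType.

Definition is_ideal (I : set S) :=
  [/\ I 0, forall x y, I x -> I y -> I (x + y) & forall a x, I x -> I (a * x)].

Definition ideal_gen (P : set S) : set S :=
  [set x | exists s : seq (S * S),
     (forall u, u \in s -> P u.2) /\ x = \sum_(u <- s) u.1 * u.2].

Definition ideal_pow (I : set S) (k : nat) : set S :=
  ideal_gen [set x | exists2 t : k.-tuple S, (forall i, I (tnth t i)) & x = \prod_(y <- t) y].

Definition maximal_ideal (I : set S) :=
  [/\ is_ideal I, ~ I 1 &
      forall J : set S, is_ideal J -> (I `<=` J)%classic -> ~ J 1 -> J = I].

Definition artinian :=
  forall I : nat -> set S, (forall k, is_ideal (I k)) ->
    (forall k, (I k.+1 `<=` I k)%classic) ->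
    exists N, forall k, (N <= k)%N -> I k = I N.

Definition noetherian :=
  forall I : set S, is_ideal I ->
    exists s : seq S, I = ideal_gen [set` s].

Definition adically_complete (I : set S) :=
  forall u : nat -> S, (forall k, ideal_pow I k (u k.+1 - u k)) ->
    exists! x, forall k, ideal_pow I k (x - u k).
End Ideals.

(* Coordinates on the (dual) bar construction in degree 0: e is a basis of H^1 and
   the dual basis of (Sigma H^1)^* is X_0, ..., X_(n-1).  A noncommutative power series
   is given by its coefficients on words, a commutative one by its
   coefficients on exponent vectors. *)
Section AbelianHull.
Variables (K : fieldType) (n : nat).

Definition tseries := seq 'I_n -> K.

Definition abelianize (t : tseries) : pseries K n :=
  fun a => \sum_(w : (\sum_i a i)%N.-tuple 'I_n | [forall i, count_mem i w == a i]) t w.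

Variables (H : nat -> lmodType K) (m : gmap H H) (e : 'I_n -> H 1%N).

Definition mdual (phi : {linear H 2%N -> K^o}) : tseries :=
  fun w => if (1 < size w)%N then phi (bar m 2 [seq Tagged H (e i) | i <- w]) else 0.

Definition mdual_ideal : {pred pseries K n} :=
  fun x => `[< ideal_gen (range (fun phi => abelianize (mdual phi))) x >].

Lemma mdual_idealr : idealr_closed mdual_ideal.
Proof.
split; first by apply/asboolP; exists [::]; rewrite big_nil.
- apply/negP => /asboolP [s [sP s1]].
  have : (1 : pseries K n) (mone n) = 0.
    rewrite s1 big_seq; elim/big_ind: _ => [//|x y x0 y0|u us].
      by change (x (mone n) + y (mone n) = 0); rewrite x0 y0 addr0.
    have [phi _ <-] := sP _ us.
    change (ps_mul u.1 (abelianize (mdual phi)) (mone n) = 0).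
    rewrite /ps_mul big_seq big1 // => b _.
    have -> : msub (mone n) b = mone n by apply/ffunP => i; rewrite !ffunE.
    rewrite [abelianize _ _]big1 ?mulr0 // => w _; rewrite /mdual ifF //.
    by rewrite size_tuple big1 // => i _; rewrite ffunE.
  by rewrite [LHS]/(ps_cst 1 _) /ps_cst eqxx => /eqP; rewrite oner_eq0.
move=> a u v /asboolP [s [sP ->]] /asboolP [t [tP ->]]; apply/asboolP.
exists ([seq (a * x.1, x.2) | x <- s] ++ t); split=> [x|].
  by rewrite mem_cat => /orP [/mapP [y /sP yP ->] //|/tP].
rewrite big_cat big_map mulr_sumr; congr (_ + _).
by apply: eq_bigr => x _; rewrite mulrA.
Qed.
HB.instance Definition _ := isIdealr.Build _ mdual_ideal mdual_idealr.

(* S^((Sigma H^1)^* ) / (m^*((Sigma H^2)^* )) *)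
Definition abelian_hull := {ideal_quot mdual_ideal}.
HB.instance Definition _ := GRing.ComAlgebra.on abelian_hull.

Definition hull_proj (x : pseries K n) : abelian_hull :=
  (\pi_({ideal_quot mdual_ideal}) x)%qT.

End AbelianHull.

Section Representations.
Variable G : topGroupType.

(* A carries the discrete topology; the values are in GL_d(A) as G is a group. *)
Record contRep (A : comNzRingType) (d : nat) := ContRep {
  rep_fun :> G -> 'M[A]_d;
  rep1 : rep_fun 1%g = 1%:M;
  repM : forall g h, rep_fun (g * h)%g = rep_fun g *m rep_fun h;
  rep_cont : dcont rep_fun
}.

Definition irreducible_action (L : fieldType) d (r : G -> 'M[L]_d) :=
  (0 < d)%N /\
  forall W : {vspace 'cV[L]_d},
    (forall g v, v \in W -> r g *m v \in W) -> W = 0%VS \/ W = fullv.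

Definition absolutely_irreducible (F : fieldType) d (rho : contRep F d) :=
  forall (L : fieldType) (iota : {rmorphism F -> L}),
    irreducible_action (fun g => map_mx iota (rho g)).

End Representations.

Section Cochains.
Variables (G : topGroupType) (F : fieldType) (d : nat) (rho : contRep G F d).
Local Notation End := 'M[F]_d.
Local Notation "G ^^ n" := ({ptws 'I_n -> G}) (at level 30).

Definition adj (g : G) (X : End) : End := rho g *m X *m rho (g^-1)%g.

Definition cochain n : lmodType F := contmap (G ^^ n) End.

Definition tup_tail n (g : G ^^ n.+1) : G ^^ n := fun j => g (lift ord0 j).
Definition tup_init n (g : G ^^ n.+1) : G ^^ n := fun j => g (widen_ord (leqnSn n) j).
(* (g_0, ..., g_i g_(i+1), ..., g_n) *)
Definition tup_contract n (i : 'I_n) (g : G ^^ n.+1) : G ^^ n := fun j =>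
  if (j < i)%N then tup_init g j
  else if j == i then (tup_init g j * tup_tail g j)%g
  else tup_tail g j.

Definition dfun n (c : G ^^ n -> End) (g : G ^^ n.+1) : End :=
  adj (g ord0) (c (tup_tail g))
  + \sum_(i < n) (-1) ^+ i.+1 *: c (tup_contract i g)
  + (-1) ^+ n.+1 *: c (tup_init g).

Definition cupfun i j (b : G ^^ i -> End) (c : G ^^ j -> End) (g : G ^^ (i + j)) : End :=
  b (fun k => g (lshift j k)) *m
  adj (\prod_(k < i) g (lshift j k))%g (c (fun k => g (rshift i k))).

Lemma tup_tail_cont n : continuous (@tup_tail n).
Proof. by apply: ptws_continuous => j; exact: coord_continuous. Qed.
Lemma tup_init_cont n : continuous (@tup_init n).
Proof. by apply: ptws_continuous => j; exact: coord_continuous. Qed.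

Lemma mulg_cont (T : topologicalType) (a b : T -> G) :
  continuous a -> continuous b -> continuous (fun x => (a x * b x)%g).
Proof.
move=> ac bc x.
apply: (@continuous2_cvg _ G G G _ _ a b (fun x y => (x * y)%g)); last 2 first.
- exact: ac.
- exact: bc.
exact: (mulg_continuous (a x, b x)).
Qed.

Lemma tup_contract_cont n (i : 'I_n) : continuous (tup_contract i).
Proof.
apply: ptws_continuous => j; rewrite /tup_contract.
case: ltnP => _; first exact: coord_continuous.
case: eqP => _; last exact: coord_continuous.
by apply: mulg_cont; exact: coord_continuous.
Qed.

Lemma adj_cont (T : topologicalType) (a : T -> G) (c : T -> End) :
  continuous a -> dcont c -> dcont (fun x => adj (a x) (c x)).
Proof.
move=> ac cc; rewrite /adj.
apply: (@dcont_comp2 _ End End End (fun X Y => X *m Y)); last first.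
  apply: (@dcont_pre T G _ (fun x => (a x)^-1%g) rho); last exact: rep_cont.
  by move=> x; apply: continuous_comp; [exact: ac | exact: invg_continuous].
apply: (@dcont_comp2 _ End End End (fun X Y => X *m Y)) => //.
exact: (dcont_pre ac (rep_cont (c := rho))).
Qed.

Lemma dcont_sum (T : topologicalType) (V : zmodType) I (r : seq I) (c : I -> T -> V) :
  (forall i, dcont (c i)) -> dcont (fun x => \sum_(i <- r) c i x).
Proof.
move=> cc; elim: r => [|i r IH].
  rewrite (_ : (fun _ => _) = (fun=> 0)); first exact: dcont_cst.
  by apply/funext => x; rewrite big_nil.
rewrite (_ : (fun _ => _) = (fun x => c i x + \sum_(j <- r) c j x)).
  exact: (dcont_comp2 (h := +%R)).
by apply/funext => x; rewrite big_cons.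
Qed.

Lemma prod_cont (T : topologicalType) I (r : seq I) (a : I -> T -> G) :
  (forall i, continuous (a i)) -> continuous (fun x => \prod_(i <- r) a i x)%g.
Proof.
move=> ac; elim: r => [|i r IH].
  rewrite (_ : (fun _ => _) = (fun=> 1%g)); first by move=> x; exact: cvg_cst.
  by apply/funext => x; rewrite big_nil.
rewrite (_ : (fun _ => _) = (fun x => a i x * \prod_(j <- r) a j x)%g).
  exact: mulg_cont.
by apply/funext => x; rewrite big_cons.
Qed.

Lemma dfun_cont n (c : cochain n) : dcont (dfun c).
Proof.
rewrite /dfun; apply: (dcont_comp2 (h := +%R)); last first.
  apply: (dcont_comp (h := *:%R _)); exact: (dcont_pre (@tup_init_cont n) (contmapP c)).
apply: (dcont_comp2 (h := +%R)).
  apply: adj_cont; first exact: coord_continuous.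
  exact: (dcont_pre (@tup_tail_cont n) (contmapP c)).
apply: dcont_sum => i.
apply: (dcont_comp (h := *:%R _)); exact: (dcont_pre (@tup_contract_cont n i) (contmapP c)).
Qed.

Arguments dfun_cont [n] c _ _ _.

Definition cochain_diff n (c : cochain n) : cochain n.+1 := mk_contmap (dfun_cont c).

Lemma cochain_diff_linear n : linear (@cochain_diff n).
Proof.
move=> a b c; apply/val_inj/funext => g.
change (dfun (fun x => a *: b x + c x) g = a *: dfun b g + dfun c g).
rewrite /dfun !scalerDr scaler_sumr [RHS]addrACA [X in _ = X + _]addrACA -big_split /=.
congr (_ + _ + _).
- by rewrite /adj mulmxDr mulmxDl -scalemxAr -scalemxAl.
- by apply: eq_bigr => i _; rewrite scalerDr !scalerA mulrC.
- by rewrite !scalerA mulrC.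
Qed.
HB.instance Definition _ n :=
  GRing.isLinear.Build F (cochain n) (cochain n.+1) _ (@cochain_diff n) (@cochain_diff_linear n).

Definition dC n : {linear cochain n -> cochain n.+1} := @cochain_diff n.

Lemma cup_cont i j (b : cochain i) (c : cochain j) : dcont (cupfun b c).
Proof.
rewrite /cupfun; apply: (@dcont_comp2 _ End End End (fun X Y => X *m Y)).
  apply: (dcont_pre _ (contmapP b)) => //.
  by apply: ptws_continuous => k; exact: coord_continuous.
apply: adj_cont.
  by apply: prod_cont => k; exact: coord_continuous.
apply: (dcont_pre _ (contmapP c)) => //.
by apply: ptws_continuous => k; exact: coord_continuous.
Qed.

Arguments cup_cont [i j] b c _ _ _.

Definition cup i j (b : cochain i) (c : cochain j) : cochain (i + j)%N :=
  mk_contmap (cup_cont b c).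

End Cochains.

Section Model.
Variables (G : topGroupType) (F : fieldType) (d : nat) (rho : contRep G F d).
Local Notation C := (cochain G F d).
Local Notation Z := (cocycle (dC rho)).
Local Notation H := (coh (dC rho)).

Definition Ainf_model (m : gmap H H) (f : gmap H C) :=
  [/\ Ainf_algebra m,
      forall i (x : H i) j, op1 m j x = 0,
      forall i j (z : Z i) (w : Z j),
        exists2 u : Z (i + j)%N, val u = cup rho (val z) (val w) &
          m (i + j)%N [:: Tagged H (pr z); Tagged H (pr w)] = pr u,
      Ainf_quasi_iso m (dg_Ainf (dC rho) (cup rho)) f &
      forall i (x : H i), exists2 z : Z i, val z = op1 f i x & pr z = x].

End Model.

Section LinearAlgebra.
Variables (K : fieldType) (V : lmodType K).

Definition is_basis n (e : 'I_n -> V) :=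
  forall x, exists! c : {ffun 'I_n -> K}, x = \sum_i c i *: e i.

Definition finite_dimensional := exists n (e : 'I_n -> V), is_basis e.

End LinearAlgebra.

Section Deformations.
Variables (G : topGroupType) (F : fieldType) (d : nat) (rho : contRep G F d).

(* A is local with residue field F, through the algebra morphism [res] whose kernel
   is the maximal ideal. *)
Definition local_alg (A : comAlgType F) (res : {lrmorphism A -> F^o}) :=
  forall I : set A, maximal_ideal I <-> I = [set x | res x = 0].

Definition local_artinian (A : comAlgType F) (res : {lrmorphism A -> F^o}) :=
  local_alg res /\ artinian A.

Definition complete_local_noetherian (R : comAlgType F) (res : {lrmorphism R -> F^o}) :=
  [/\ local_alg res, noetherian R & adically_complete [set x | res x = 0]].

Definition is_lift (A : comAlgType F) (res : {lrmorphism A -> F^o}) (r : contRep G A d) :=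
  forall g, map_mx res (r g) = rho g.

Definition strictly_equivalent (A : comAlgType F) (res : {lrmorphism A -> F^o})
    (r r' : G -> 'M[A]_d) :=
  exists P Q : 'M[A]_d,
    [/\ P *m Q = 1%:M, Q *m P = 1%:M, map_mx res P = 1%:M &
        forall g, r' g = P *m r g *m Q].

(* A map Hom(R, A) -> Def(A) for each A, given by lifts representing the classes.
   F-algebra morphisms between local F-algebras with residue field F are local, so
   that Hom(R, A) is the set of all algebra morphisms. *)
Definition prorepresentation (R : comAlgType F) :=
  forall (A : comAlgType F) (res : {lrmorphism A -> F^o}), {lrmorphism R -> A} -> contRep G A d.

Definition prorepresents (R : comAlgType F) (eta : prorepresentation R) :=
  (forall (A : comAlgType F) (res : {lrmorphism A -> F^o}), local_artinian res ->
    [/\ forall phi, is_lift res (eta A res phi),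
        forall phi phi', strictly_equivalent res (eta A res phi) (eta A res phi') ->
          phi =1 phi' &
        forall r : contRep G A d, is_lift res r ->
          exists phi, strictly_equivalent res (eta A res phi) r])
  /\
  (forall (A B : comAlgType F) (resA : {lrmorphism A -> F^o}) (resB : {lrmorphism B -> F^o}),
    local_artinian resA -> local_artinian resB ->
    forall (psi : {lrmorphism A -> B}) (phi : {lrmorphism R -> A}) (phi' : {lrmorphism R -> B}),
      phi' =1 psi \o phi ->
      strictly_equivalent resB (fun g => map_mx psi (eta A resA phi g)) (eta B resB phi')).

Local Notation H := (coh (dC rho)).
Local Notation C := (cochain G F d).

(* The lift (1 - sum_k (-1)^(k(k-1)/2) f_k(xi, ..., xi)) rho attached to the point
   xi = sum_i x_i e_i of H^1 (x) m_A; the sum is cut at an N with m_A^N = 0.  The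
   signed f_k are the components of the bar morphism of f.  If xi satisfies the
   relations of the hull, the first factor is 1 + c with dc + c c = 0 in
   C (x) m_A, which says that (1 + c) rho is a homomorphism. *)
Definition mc_lift (f : gmap H C) n (e : 'I_n -> H 1%N) (A : comAlgType F)
    (x : 'I_n -> A) (N : nat) (g : G) : 'M[A]_d :=
  (1%:M - \sum_(1 <= k < N) \sum_(w : k.-tuple 'I_n)
     ((-1) ^+ 'C(k, 2) * \prod_(i <- w) x i) *:
     map_mx (in_alg A) (f 1%N [seq Tagged H (e i) | i <- w] (fun=> g)))
  *m map_mx (in_alg A) (rho g).

(* phi is the isomorphism determined by (m, f): the deformation attached to a point
   psi of R is the image under f of the point psi o phi of the hull. *)
Definition classified_by (m : gmap H H) (f : gmap H C) n (e : 'I_n -> H 1%N)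
    (R : comAlgType F) (eta : prorepresentation R)
    (phi : {lrmorphism abelian_hull m e -> R}) :=
  forall (A : comAlgType F) (res : {lrmorphism A -> F^o}), local_artinian res ->
  forall N, ideal_pow [set x | res x = 0] N = [set 0] ->
  forall psi : {lrmorphism R -> A},
    strictly_equivalent res (eta A res psi)
      (mc_lift f e (fun i => psi (phi (hull_proj m e (psX F i)))) N).
End Deformations.

(* Main.v *)
(* Existence of (m, f): Kadeishvili's recursion.  After the bar sign twist, the A_infinity
   relations say that a coderivation b of the tensor coalgebra squares to 0 and that f
   intertwines it with d and the cup product; b_n and f_n are built by induction on n
   from a section of the cocycles over H and a contraction of the coboundaries.

   Isomorphism: for a finite local A with maximal ideal m_A, the bar morphism of f turns a
   point x in H^1 (x) m_A into R_x = rho - sum_w x_w f(e_w) rho, whose defect of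
   multiplicativity R_x(gh) - R_x(g) R_x(h) is a combination of the values at x of the
   relations of the hull.  Induction along small extensions shows that every lift of rho
   over A is strictly equivalent to some R_x with x a zero of the relations, and that x
   is unique (Schur's lemma).  Over the finite quotients R/m^n this gives compatible
   points, hence x in H^1 (x) m_R and a map phi from the hull to R.  Conversely the
   universal points of the finite quotients of the hull are lifts, hence come from maps
   out of R, which are inverse to phi at each finite level.  As F is finite, the finite
   levels are glued together by compactness. *)

From HB Require Import structures.
Require Import Defs.
From mathcomp Require Import all_boot all_algebra monoid generic_quotient ring_quotient all_field.
From mathcomp Require Import boolp classical_sets functions topology zify.

Set Implicit Arguments.
Unset Strict Implicit.
Unset Printing Implicit Defensive.

Import GRing.Theory.
Local Open Scope classical_set_scope.
Local Open Scope ring_scope.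

(** * Identities in abelian groups *)

(** The cochain groups of different degrees are different types, so the obstruction calculus takes
    place in one associative dg algebra, the functions on lists of group elements, into which they
    all embed. There the differential of the defect of F is sigma of the relation for b; since q
    kills coboundaries and q sigma = 1, the relation for b comes for free with the construction of
    F.

    Small extensions are taken with a one-dimensional kernel J / J' killed by m_A: modulo J' every
    product of J with m_A disappears and only the terms linear in the correction survive.
    Irreducibility enters at one point: the conjugating matrix is determined only up to the
    commutant of rho, which has to be scalar for the induction to continue.

    The functor sees Artinian algebras only, whereas neither R nor the hull need be Artinian. So two
    closedness statements are required: the ideal of relations is closed in the power series ring,
    and the image of the power series in R is closed. Both are limits along an ultrafilter; for the
    ideal, it is the coefficients of finitely many generating relations that converge, the number of
    generators being dim H^2. *)

Inductive zexpr := ZVar of nat | ZZero | ZAdd of zexpr & zexpr | ZOpp of zexpr.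

Section ZmodReflection.
Variable V : zmodType.

Fixpoint zeval (env : seq V) (t : zexpr) : V :=
  match t with
  | ZVar n => nth 0 env n
  | ZZero => 0
  | ZAdd t u => zeval env t + zeval env u
  | ZOpp t => - zeval env t
  end.

Fixpoint zcoef (t : zexpr) (n : nat) : int :=
  match t with
  | ZVar k => if k == n then 1 else 0
  | ZZero => 0
  | ZAdd t u => zcoef t n + zcoef u n
  | ZOpp t => - zcoef t n
  end.

Lemma zevalE env t : zeval env t = \sum_(i < size env) env`_i *~ zcoef t i.
Proof.
elim: t => [k||t IHt u IHu|t IHt] /=.
- case: (ltnP k (size env)) => [lt_k|le_k]; last first.
    rewrite nth_default // big1 // => i _.
    by rewrite ifN ?mulr0z // gtn_eqF // (leq_trans (ltn_ord i)).
  rewrite (bigD1 (Ordinal lt_k)) //= eqxx mulr1z big1 ?addr0 // => i ik.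
  by rewrite ifN ?mulr0z // eq_sym.
- by rewrite big1 // => i _; rewrite mulr0z.
- by rewrite IHt IHu -big_split; apply: eq_bigr => i _; rewrite mulrzDr.
- by rewrite IHt -sumrN; apply: eq_bigr => i _; rewrite mulrNz.
Qed.

Lemma zmod_eq env n t u : size env = n ->
  all (fun i => zcoef t i == zcoef u i) (iota 0 n) -> zeval env t = zeval env u.
Proof.
move=> <- /allP eq_tu; rewrite !zevalE; apply: eq_bigr => i _.
by rewrite (eqP (eq_tu _ _)) // mem_iota /= add0n.
Qed.
End ZmodReflection.

(* [abel] proves the identities valid in every abelian group, by reflection. *)
Ltac zmod_index x env :=
  lazymatch env with
  | cons ?y ?env' =>
    match goal with
    | _ => let _ := match goal with _ => unify x y end in constr:(0%N)
    | _ => let n := zmod_index x env' in constr:(S n)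
    end
  end.
Ltac zmod_atoms x env :=
  lazymatch x with
  | (?a + ?b)%R => let env := zmod_atoms a env in zmod_atoms b env
  | (- ?a)%R => zmod_atoms a env
  | (0)%R => env
  | _ => match goal with
         | _ => let _ := zmod_index x env in env
         | _ => constr:(cons x env)
         end
  end.
Ltac zmod_quote x env :=
  lazymatch x with
  | (?a + ?b)%R => let a := zmod_quote a env in let b := zmod_quote b env in constr:(ZAdd a b)
  | (- ?a)%R => let a := zmod_quote a env in constr:(ZOpp a)
  | (0)%R => constr:(ZZero)
  | _ => let n := zmod_index x env in constr:(ZVar n)
  end.
Ltac zmod_size env :=
  lazymatch env with
  | nil => constr:(O)
  | cons _ ?env' => let n := zmod_size env' in constr:(S n)
  end.
Ltac abel :=
  lazymatch goal with
  | |- @eq ?V ?x ?y =>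
    let env := zmod_atoms x (@nil V) in
    let env := zmod_atoms y env in
    let t := zmod_quote x env in
    let u := zmod_quote y env in
    let n := zmod_size env in
    apply: (@zmod_eq V env n t u (erefl n)); vm_compute; reflexivity
  end.

(** * Words and coderivations *)

Section Splits.
Variables (T : Type) (M : zmodType).
Implicit Types (psi : seq T -> seq T -> M) (l : seq T).

(** Deconcatenation, the coproduct of the tensor coalgebra, paired with [psi]. Recursion on the word
    lets the identities below go by induction on words, without index arithmetic. *)
Fixpoint splits psi l : M :=
  if l is a :: l' then psi [::] l + splits (fun l1 l2 => psi (a :: l1) l2) l'
  else psi [::] [::].

Lemma splits_nil psi : splits psi [::] = psi [::] [::].
Proof. by []. Qed.

Lemma splits_cons psi a l :
  splits psi (a :: l) = psi [::] (a :: l) + splits (fun l1 l2 => psi (a :: l1) l2) l.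
Proof. by []. Qed.

Lemma splitsE psi l :
  splits psi l = \sum_(0 <= k < (size l).+1) psi (take k l) (drop k l).
Proof.
elim: l psi => [|a l IH] psi /=; first by rewrite big_nat1.
by rewrite IH [RHS]big_nat_recl.
Qed.

Lemma eq_splits psi psi' l :
  (forall l1 l2, l = l1 ++ l2 -> psi l1 l2 = psi' l1 l2) -> splits psi l = splits psi' l.
Proof.
elim: l psi psi' => [|a l IH] psi psi' eqp /=; first exact: eqp.
by rewrite eqp //; congr (_ + _); apply: IH => l1 l2 e; apply: eqp; rewrite e.
Qed.

Lemma splitsD psi psi' l :
  splits (fun l1 l2 => psi l1 l2 + psi' l1 l2) l = splits psi l + splits psi' l.
Proof. by rewrite !splitsE big_split. Qed.

Lemma splitsN psi l : splits (fun l1 l2 => - psi l1 l2) l = - splits psi l.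
Proof. by rewrite !splitsE sumrN. Qed.

Lemma splits0 psi l : (forall l1 l2, l = l1 ++ l2 -> psi l1 l2 = 0) -> splits psi l = 0.
Proof.
move=> p0; rewrite splitsE big1 // => k _.
by rewrite p0 ?cat_take_drop.
Qed.

Lemma splits_first psi l :
  (forall a l1 l2, l = a :: l1 ++ l2 -> psi (a :: l1) l2 = 0) -> splits psi l = psi [::] l.
Proof.
case: l => // a l p0; rewrite splits_cons splits0 ?addr0 // => l1 l2 e.
by apply: p0; rewrite e.
Qed.

Lemma splits_last psi l :
  (forall l1 a l2, l = l1 ++ a :: l2 -> psi l1 (a :: l2) = 0) -> splits psi l = psi l [::].
Proof.
elim: l psi => // a l IH psi p0.
rewrite splits_cons p0 // add0r IH // => l1 b l2 e.
by apply: p0; rewrite e.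
Qed.

(** Coassociativity of deconcatenation. *)
Lemma splits_coassoc (phi : seq T -> seq T -> seq T -> M) l :
  splits (fun l1 l23 => splits (phi l1) l23) l =
  splits (fun l12 l3 => splits (fun l1 l2 => phi l1 l2 l3) l12) l.
Proof.
elim: l phi => //= a l IH phi.
rewrite IH -addrA; congr (_ + _).
by rewrite -splitsD; apply: eq_splits.
Qed.

End Splits.

Arguments splits : simpl never.

Lemma splitsZ (K : pzRingType) (T : Type) (M : lmodType K) (c : K) (psi : seq T -> seq T -> M) l :
  splits (fun l1 l2 => c *: psi l1 l2) l = c *: splits psi l.
Proof. by rewrite !splitsE scaler_sumr. Qed.

Lemma raddf_splits (T : Type) (M N : zmodType) (f : {additive M -> N}) (psi : seq T -> seq T -> M) l :
  f (splits psi l) = splits (fun l1 l2 => f (psi l1 l2)) l.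
Proof. by rewrite !splitsE raddf_sum. Qed.

Section Coderivation.
Variables (K : comPzRingType) (T : Type) (beta : seq T -> T) (sgn : T -> K).
Hypothesis sgn2 : forall a, sgn a * sgn a = 1.

Definition sgw (l : seq T) : K := \prod_(a <- l) sgn a.

Lemma sgw_nil : sgw [::] = 1.
Proof. exact: big_nil. Qed.

Lemma sgw_cons a l : sgw (a :: l) = sgn a * sgw l.
Proof. exact: big_cons. Qed.

Lemma sgw_cat l1 l2 : sgw (l1 ++ l2) = sgw l1 * sgw l2.
Proof. exact: big_cat. Qed.

Lemma sgw2 l : sgw l * sgw l = 1.
Proof.
elim: l => [|a l IH]; first by rewrite sgw_nil mulr1.
by rewrite sgw_cons mulrACA sgn2 IH mulr1.
Qed.

Section OneModule.
Variable M : lmodType K.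
Implicit Types (g : seq T -> M) (l : seq T).

(** The function [g] composed with the coderivation of the tensor coalgebra whose components are
    [beta]; working after [g] avoids formal sums of words. Empty factors [l2] are allowed, and in
    the applications [beta [::]] is a zero letter. *)
Definition coder g l : M :=
  splits (fun l1 l23 => sgw l1 *: splits (fun l2 l3 => g (l1 ++ beta l2 :: l3)) l23) l.

Lemma coder_nil g : coder g [::] = g [:: beta [::]].
Proof. by rewrite /coder !splits_nil sgw_nil scale1r. Qed.

Lemma coder_cons g a l :
  coder g (a :: l) = splits (fun l2 l3 => g (beta l2 :: l3)) (a :: l) +
                     sgn a *: coder (fun w => g (a :: w)) l.
Proof.
rewrite {1}/coder splits_cons sgw_nil scale1r; congr (_ + _).
rewrite /coder -splitsZ; apply: eq_splits => l1 l2 _.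
by rewrite sgw_cons scalerA.
Qed.

Lemma eq_coder g g' l :
  (forall l1 l2 l3, l = l1 ++ l2 ++ l3 -> g (l1 ++ beta l2 :: l3) = g' (l1 ++ beta l2 :: l3)) ->
  coder g l = coder g' l.
Proof.
move=> eqg; apply: eq_splits => l1 l23 e; congr (_ *: _).
by apply: eq_splits => l2 l3 e'; apply: eqg; rewrite e e'.
Qed.

Lemma coderD g g' l : coder (fun w => g w + g' w) l = coder g l + coder g' l.
Proof.
rewrite /coder -splitsD; apply: eq_splits => l1 l2 _.
by rewrite -scalerDr -splitsD.
Qed.

Lemma coderZ c g l : coder (fun w => c *: g w) l = c *: coder g l.
Proof.
rewrite /coder -splitsZ; apply: eq_splits => l1 l2 _.
by rewrite splitsZ !scalerA mulrC.
Qed.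

Lemma coderN g l : coder (fun w => - g w) l = - coder g l.
Proof.
by rewrite -scaleN1r -coderZ; apply: eq_coder => *; rewrite scaleN1r.
Qed.

(** The co-Leibniz rule: a contracted factor lies wholly to the left or wholly to the right of a
    cut. *)
Lemma coder_splits (psi : seq T -> seq T -> M) l :
  coder (splits psi) l =
  splits (fun l1 l2 => coder (psi^~ l2) l1 + sgw l1 *: coder (psi l1) l2) l.
Proof.
elim: l psi => [|a l IH] psi.
  by rewrite coder_nil splits_nil !coder_nil splits_cons !splits_nil sgw_nil scale1r addrC.
rewrite coder_cons [RHS]splits_cons coder_nil coder_cons sgw_nil scale1r.
have -> : coder (fun w => splits psi (a :: w)) l =
   coder (fun w => psi [::] (a :: w)) l + splits (fun l1 l2 =>
      coder (fun w => psi (a :: w) l2) l1 + sgw l1 *: coder (psi (a :: l1)) l2) l.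
  by rewrite -IH -coderD; apply: eq_coder.
have -> : splits (fun l2 l3 => splits psi (beta l2 :: l3)) (a :: l) =
   splits (fun l2 l3 => psi [::] (beta l2 :: l3)) (a :: l) +
   splits (fun l1 l2 => splits (fun u v => psi (beta u :: v) l2) l1) (a :: l).
  by rewrite -splits_coassoc -splitsD; apply: eq_splits.
rewrite scalerDr addrACA [RHS]addrAC [RHS]addrC; congr (_ + _).
rewrite splits_cons splits_nil -addrA; congr (_ + _).
rewrite -splitsZ -splitsD; apply: eq_splits => l1 l2 _.
by rewrite coder_cons sgw_cons scalerDr !scalerA addrA.
Qed.

(** In the square of an odd coderivation the contractions of two disjoint factors cancel in pairs,
    and the nested ones remain. Oddness of [beta] is assumed only as seen through [g], because a
    zero letter may carry a meaningless degree. *)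
Lemma coder_coder g l :
  (forall l1 w l3, sgn (beta w) *: g (l1 ++ beta w :: l3) = - (sgw w *: g (l1 ++ beta w :: l3))) ->
  coder (coder g) l = splits (fun l1 l23 => splits (fun l2 l3 =>
    coder (fun w => g (l1 ++ beta w :: l3)) l2) l23) l.
Proof.
elim: l g => [|a l IH] g hg.
  rewrite coder_nil coder_cons coder_nil !splits_nil coder_nil splits_cons splits_nil.
  by rewrite (hg [::] [::] [:: beta [::]]) sgw_nil scale1r addrAC subrr add0r.
rewrite coder_cons.
have -> : coder (fun w => coder g (a :: w)) l =
   coder (fun w => splits (fun l2 l3 => g (beta l2 :: l3)) (a :: w)) l +
   sgn a *: coder (coder (fun w => g (a :: w))) l.
  by rewrite -coderZ -coderD; apply: eq_coder => *; rewrite coder_cons.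
rewrite scalerDr scalerA sgn2 scale1r IH; last by move=> l1 w l3; exact: (hg (a :: l1)).
rewrite addrA [RHS]splits_cons; congr (_ + _).
(* The second contraction inserts an empty one before the letter [beta l2], swallows that letter, or
   acts to its right; the last case has the sign that makes it cancel. *)
have -> : splits (fun l2 l3 => coder g (beta l2 :: l3)) (a :: l) =
   splits (fun l2 l3 => g (beta [::] :: beta l2 :: l3)) (a :: l) +
   (splits (fun l1 l2 => splits (fun u v => g (beta (beta u :: v) :: l2)) l1) (a :: l)
   - splits (fun l1 l2 => sgw l1 *: coder (fun w => g (beta l1 :: w)) l2) (a :: l)).
  rewrite -splits_coassoc -splitsN -!splitsD; apply: eq_splits => l1 l2 _.
  rewrite coder_cons splits_cons -addrA; congr (_ + (_ + _)).
  rewrite -!coderZ -coderN; apply: eq_coder => m1 m2 m3 _.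
  exact: (hg [::] l1 (m1 ++ beta m2 :: m3)).
have -> : coder (fun w => splits (fun l2 l3 => g (beta l2 :: l3)) (a :: w)) l =
   coder (fun w => g (beta [::] :: a :: w)) l +
   splits (fun l1 l2 => coder (fun w => g (beta (a :: w) :: l2)) l1
      + sgw l1 *: coder (fun w => g (beta (a :: l1) :: w)) l2) l.
  by rewrite -(coder_splits (fun l1 l2 => g (beta (a :: l1) :: l2))) -coderD; apply: eq_coder.
rewrite [X in _ + (_ - X)]splits_cons sgw_nil scale1r coder_cons.
rewrite [RHS]splits_cons coder_nil !cat0s.
set A := splits (fun l2 l3 => g (beta [::] :: beta l2 :: l3)) (a :: l).
rewrite [X in _ + (X - _)]splits_cons splits_nil.
set B := splits _ l; set D := splits _ l; set E := sgn a *: _.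
have -> : splits (fun l1 l2 => coder (fun w => g (beta w :: l2)) (a :: l1)) l =
    B + sgn a *: splits (fun l1 l2 => coder (fun w => g (beta (a :: w) :: l2)) l1) l.
  by rewrite -splitsZ -splitsD; apply: eq_splits => l1 l2 _; rewrite coder_cons.
rewrite splitsD !scalerDr.
have -> : sgn a *: splits (fun l1 l2 => sgw l1 *: coder (fun w => g (beta (a :: l1) :: w)) l2) l = D.
  by rewrite -splitsZ; apply: eq_splits => l1 l2 _; rewrite sgw_cons scalerA.
abel.
Qed.

End OneModule.

(** * The defect of a morphism into a dg algebra *)

Section Defect.
Variables (X : lmodType K) (D : {linear X -> X}) (cup : X -> X -> X) (Phi : seq T -> X).
Hypothesis DD : forall x, D (D x) = 0.
Hypothesis cupP : forall y, linear (cup^~ y).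
Hypothesis cuPP : forall x, linear (cup x).
Hypothesis cupA : associative cup.
Hypothesis Phi_nil : Phi [::] = 0.
Hypothesis Leibniz : forall l y,
  D (cup (Phi l) y) = cup (D (Phi l)) y - sgw l *: cup (Phi l) (D y).
Hypothesis Phi_sgn : forall l1 w l3,
  sgn (beta w) *: Phi (l1 ++ beta w :: l3) = - (sgw w *: Phi (l1 ++ beta w :: l3)).

Let cupl y : {linear X -> X} := HB.pack (cup^~ y) (GRing.isLinear.Build K X X _ (cup^~ y) (cupP y)).
Let cupr x : {linear X -> X} := HB.pack (cup x) (GRing.isLinear.Build K X X _ (cup x) (cuPP x)).

Definition conv l := splits (fun l1 l2 => sgw l1 *: cup (Phi l1) (Phi l2)) l.

(* [Phi] is a morphism on the word [l] iff its defect vanishes there. *)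
Definition defect l := coder Phi l - D (Phi l) + conv l.

Lemma linear_coder (M N : lmodType K) (f : {linear M -> N}) g l :
  f (coder g l) = coder (fun w => f (g w)) l.
Proof.
rewrite /coder raddf_splits; apply: eq_splits => l1 l2 _.
by rewrite /= linearZ /= raddf_splits.
Qed.

Lemma coder_sgw (N : lmodType K) (f : {linear X -> N}) l :
  coder (fun w => sgw w *: f (Phi w)) l = - (sgw l *: f (coder Phi l)).
Proof.
rewrite linear_coder -coderZ -coderN; apply: eq_coder => l1 l2 l3 ->.
rewrite !sgw_cat sgw_cons -!linearZ -linearN; congr (f _).
by rewrite !mulrA ![_ * sgw l3]mulrAC -scalerA Phi_sgn scalerN scalerA.
Qed.

Lemma cup0l y : cup 0 y = 0. Proof. exact: (linear0 (cupl y)). Qed.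
Lemma cup0r x : cup x 0 = 0. Proof. exact: (linear0 (cupr x)). Qed.
Lemma cupZl a x y : cup (a *: x) y = a *: cup x y. Proof. exact: (linearZ_LR (cupl y)). Qed.
Lemma cupZr a x y : cup x (a *: y) = a *: cup x y. Proof. exact: (linearZ_LR (cupr x)). Qed.
Lemma cup_splitsl (psi : seq T -> seq T -> X) l y : cup (splits psi l) y = splits (fun l1 l2 => cup (psi l1 l2) y) l.
Proof. exact: (raddf_splits (cupl y)). Qed.
Lemma cup_splitsr x (psi : seq T -> seq T -> X) l : cup x (splits psi l) = splits (fun l1 l2 => cup x (psi l1 l2)) l.
Proof. exact: (raddf_splits (cupr x)). Qed.
Lemma cupDl x x' y : cup (x + x') y = cup x y + cup x' y. Proof. exact: (linearD (cupl y)). Qed.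
Lemma cupBl x x' y : cup (x - x') y = cup x y - cup x' y. Proof. exact: (linearB (cupl y)). Qed.
Lemma cupBr x y y' : cup x (y - y') = cup x y - cup x y'. Proof. exact: (linearB (cupr x)). Qed.

Lemma coder_conv l : coder conv l = splits (fun l1 l2 =>
  cup (Phi l1) (coder Phi l2) - sgw l1 *: cup (coder Phi l1) (Phi l2)) l.
Proof.
rewrite (coder_splits (fun l1 l2 => sgw l1 *: cup (Phi l1) (Phi l2))).
apply: eq_splits => l1 l2 _.
rewrite (coder_sgw (cupl (Phi l2))) coderZ scalerA sgw2 scale1r.
by rewrite -(linear_coder (cupr (Phi l1))) addrC.
Qed.

Lemma D_conv l : D (conv l) = splits (fun l1 l2 =>
  sgw l1 *: cup (D (Phi l1)) (Phi l2) - cup (Phi l1) (D (Phi l2))) l.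
Proof.
rewrite raddf_splits; apply: eq_splits => l1 l2 _.
by rewrite /= linearZ /= Leibniz scalerBr scalerA sgw2 scale1r.
Qed.

(** [D] moves inside [coder Phi], where the vanishing defect replaces [D (Phi w)] by
    [coder Phi w + conv w]. The terms [coder conv] and [D conv] then cancel by the Leibniz rule and
    associativity, leaving the square of the coderivation. *)
Lemma D_defect l :
  (forall l1 l2 l3, l = l1 ++ l2 ++ l3 -> defect (l1 ++ beta l2 :: l3) = 0) ->
  (forall l', (size l' < size l)%N -> defect l' = 0) ->
  D (defect l) = coder (coder Phi) l.
Proof.
move=> def_l def_lt.
have E l' : D (Phi l') = coder Phi l' + conv l' - defect l' by rewrite /defect; abel.
rewrite /defect linearD linearB DD subr0 linear_coder.
have -> : coder (fun w => D (Phi w)) l = coder (coder Phi) l + coder conv l.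
  rewrite -coderD; apply: eq_coder => l1 l2 l3 e.
  by rewrite E def_l // subr0.
rewrite -addrA -[RHS]addr0; congr (_ + _).
rewrite coder_conv D_conv -splitsD.
have conv_assoc : splits (fun l1 l2 => sgw l1 *: cup (conv l1) (Phi l2)) l =
    splits (fun l1 l2 => cup (Phi l1) (conv l2)) l.
  transitivity (splits (fun l12 l3 => splits (fun l1 l2 =>
     sgw l2 *: cup (cup (Phi l1) (Phi l2)) (Phi l3)) l12) l).
    apply: eq_splits => l1 l2 _; rewrite /conv cup_splitsl -splitsZ.
    apply: eq_splits => u v ->.
    by rewrite /= cupZl scalerA sgw_cat mulrAC sgw2 mul1r.
  rewrite -splits_coassoc; apply: eq_splits => l1 l2 _.
  rewrite /conv cup_splitsr; apply: eq_splits => u v _.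
  by rewrite /= cupZr cupA.
rewrite -(subrr (splits (fun l1 l2 => cup (Phi l1) (conv l2)) l)) -{1}conv_assoc.
rewrite -splitsN -splitsD; apply: eq_splits => l1 l2 e.
(* When [l2] is empty, [l1] is the whole word and its defect is unknown, but then [Phi l2] is 0. *)
have c1 : cup (defect l1) (Phi l2) = 0.
  case: l2 e => [|a l2] e; first by rewrite Phi_nil cup0r.
  by rewrite def_lt ?cup0l // e size_cat /= -addSnnS ltn_addr.
have c2 : cup (Phi l1) (defect l2) = 0.
  case: l1 e {c1} => [|a l1] e; first by rewrite Phi_nil cup0l.
  by rewrite def_lt ?cup0r // e size_cat /= addSn ltnS leq_addl.
have -> : conv l1 = defect l1 - coder Phi l1 + D (Phi l1) by rewrite /defect; abel.
have -> : conv l2 = defect l2 - (coder Phi l2 - D (Phi l2)) by rewrite /defect; abel.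
rewrite cupDl !cupBr cupBl c1 c2 sub0r scalerDr scalerN.
abel.
Qed.

End Defect.
End Coderivation.

(** * Graded words *)

Section GradedWords.
Variables (K : fieldType) (A : nat -> lmodType K).
Local Notation word := (seq (gelt A)).

(* the sign of the suspended element *)
Definition ssgn (a : gelt A) : K := (-1) ^+ (tag a).+1.
Local Notation sg := (sgw ssgn).

Lemma ssgn2 a : ssgn a * ssgn a = 1.
Proof. by rewrite -exprMn mulrNN mulr1 expr1n. Qed.

Lemma gdeg_nil : gdeg ([::] : word) = 0%N. Proof. exact: big_nil. Qed.
Lemma gdeg_cons a (l : word) : gdeg (a :: l) = (tag a + gdeg l)%N.
Proof. exact: big_cons. Qed.
Lemma gdeg_cat (l1 l2 : word) : gdeg (l1 ++ l2) = (gdeg l1 + gdeg l2)%N.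
Proof. exact: big_cat. Qed.

Lemma sgE (l : word) : sg l = (-1) ^+ (size l + gdeg l).
Proof.
elim: l => [|a l IH]; first by rewrite sgw_nil gdeg_nil.
by rewrite sgw_cons IH -exprD gdeg_cons /=; congr (_ ^+ _); lia.
Qed.

Lemma exprN1_odd (m n : nat) : odd m = odd n -> (-1) ^+ m = (-1) ^+ n :> K.
Proof. by move=> e; rewrite -signr_odd e signr_odd. Qed.

Definition slot_linear (M : lmodType K) (g : word -> M) :=
  forall l r i (a : K) (x y : A i), g (l ++ Tagged A (a *: x + y) :: r) =
    a *: g (l ++ Tagged A x :: r) + g (l ++ Tagged A y :: r).

Section OneModule.
Variable M : lmodType K.
Implicit Types (g : word -> M).

Lemma slot_linear0 g l r i : slot_linear g -> g (l ++ Tagged A (0 : A i) :: r) = 0.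
Proof.
move=> sg; have := sg l r i (-1) 0 0.
by rewrite scaler0 addr0 scaleN1r addNr.
Qed.

Lemma slot_linear_scale_slot g l r i c (x : A i) : slot_linear g ->
  g (l ++ Tagged A (c *: x) :: r) = c *: g (l ++ Tagged A x :: r).
Proof.
by move=> sg; have := sg l r i c x 0; rewrite addr0 slot_linear0 // addr0.
Qed.

Lemma slot_linear_cons g a : slot_linear g -> slot_linear (fun w => g (a :: w)).
Proof. by move=> sg l r i c x y; exact: (sg (a :: l)). Qed.

Lemma slot_linear_slot g l r i : slot_linear g ->
  linear (fun x : A i => g (l ++ Tagged A x :: r)).
Proof. by move=> sg a x y; exact: sg. Qed.

Lemma slot_linear_splits (psi : word -> word -> M) :
  (forall l1, slot_linear (psi l1)) -> (forall l2, slot_linear (psi^~ l2)) ->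
  slot_linear (splits psi).
Proof.
move=> psi1 psi2 l r i c x y; elim: l psi psi1 psi2 => [|a l IH] psi psi1 psi2.
  rewrite !cat0s !splits_cons (psi1 [::] [::]) scalerDr addrACA; congr (_ + _).
  rewrite -splitsZ -splitsD; apply: eq_splits => l1 l2 _.
  exact: (psi2 l2 [::] l1).
rewrite !cat_cons !splits_cons (psi1 [::] (a :: l)) scalerDr addrACA; congr (_ + _).
by apply: IH => w; [exact: psi1 | exact: slot_linear_cons (psi2 w)].
Qed.

Lemma slot_linearZ (c : K) g : slot_linear g -> slot_linear (fun w => c *: g w).
Proof. by move=> sg l r i a x y; rewrite sg scalerDr !scalerA mulrC. Qed.

Lemma slot_linearD g g' : slot_linear g -> slot_linear g' -> slot_linear (fun w => g w + g' w).
Proof. by move=> sg sg' l r i a x y; rewrite sg sg' scalerDr addrACA. Qed.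

Lemma slot_linearN g : slot_linear g -> slot_linear (fun w => - g w).
Proof. by move=> sg l r i a x y; rewrite sg opprD scalerN. Qed.

Lemma slot_linear_scale (c : word -> K) g :
  (forall l r i (x y : A i), c (l ++ Tagged A x :: r) = c (l ++ Tagged A y :: r)) ->
  slot_linear g -> slot_linear (fun w => c w *: g w).
Proof.
move=> ce sg l r i a x y; rewrite sg scalerDr !scalerA.
by rewrite (ce l r i _ x) (ce l r i y x) mulrC.
Qed.

Lemma sg_slot l r i (x y : A i) : sg (l ++ Tagged A x :: r) = sg (l ++ Tagged A y :: r).
Proof. by rewrite !sgw_cat !sgw_cons. Qed.

Lemma linear_slot (N : lmodType K) (f : {linear M -> N}) g :
  slot_linear g -> slot_linear (fun w => f (g w)).
Proof. by move=> sg l r i a x y; rewrite sg linearP. Qed.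

End OneModule.

Lemma gdeg_slot l r i (x y : A i) :
  gdeg (l ++ Tagged A x :: r) = gdeg (l ++ Tagged A y :: r).
Proof. by rewrite !gdeg_cat !gdeg_cons. Qed.

Lemma size_slot l r i (x y : A i) :
  size (l ++ Tagged A x :: r) = size (l ++ Tagged A y :: r).
Proof. by rewrite !size_cat. Qed.

End GradedWords.

Lemma gval0 (K : fieldType) (A B : nat -> lmodType K) k (f : gmap A B) l :
  of_degree k f -> (gdeg l + k < size l)%N -> f (gdeg l + k - size l)%N l = 0.
Proof. by move=> fd lt; apply: fd; apply/eqP; lia. Qed.

Lemma gval_slot_lin (K : fieldType) (A B : nat -> lmodType K) (M : lmodType K)
    (g : gelt B -> M) (k : nat) (f : gmap A B) :
  (forall i, linear (fun x : B i => g (Tagged B x))) -> multilinear f ->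
  slot_linear (fun w => g (gval k f w)).
Proof.
move=> gl fl l r i a x y; rewrite /gval.
rewrite !(gdeg_slot _ _ (a *: x + y) x) !(size_slot _ _ (a *: x + y) x).
rewrite (gdeg_slot _ _ y x) (size_slot _ _ y x).
by rewrite fl gl.
Qed.

(** * The coderivation attached to a graded family of operations *)

Section GradedCoder.
Variables (K : fieldType) (A : nat -> lmodType K) (b : gmap A A).
Hypothesis b_lin : multilinear b.
Hypothesis b_deg : of_degree 2 b.
Local Notation word := (seq (gelt A)).
Local Notation beta := (gval 2 b).
Local Notation sg := (sgw (@ssgn K A)).
Local Notation coder := (coder beta (@ssgn K A)).

Lemma slot_linear_coder (M : lmodType K) (g : word -> M) :
  slot_linear g -> slot_linear (coder g).
Proof.
move=> gl; apply: slot_linear_splits => [l1|l23].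
  apply: slot_linearZ; apply: slot_linear_splits => [l2|l3].
    by move=> l r i c x y; have := gl (l1 ++ beta l2 :: l) r i c x y; rewrite -!catA.
  apply: (@gval_slot_lin _ _ _ M (fun z => g (l1 ++ z :: l3)) 2 b) => // i.
  exact: slot_linear_slot.
apply: slot_linear_scale; first exact: sg_slot.
move=> l r i c x y; rewrite -splitsZ -splitsD; apply: eq_splits => l2 l3 _.
by rewrite -!catA !cat_cons gl.
Qed.

(** After suspension the operations have degree 1. If the target degree is negative, truncated
    subtraction spoils the parity, but the letter is then 0 and both sides vanish. *)
Lemma beta_sgn (M : lmodType K) (g : word -> M) : slot_linear g ->
  forall l1 w l3, ssgn (beta w) *: g (l1 ++ beta w :: l3) = - (sg w *: g (l1 ++ beta w :: l3)).
Proof.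
move=> gl l1 w l3; case: (leqP (size w) (gdeg w + 2)) => [le|lt].
  rewrite sgE /ssgn /= -scaleNr; congr (_ *: _).
  transitivity ((-1) ^+ (size w + gdeg w).+1 : K); last by rewrite exprS mulN1r.
  by apply: exprN1_odd; rewrite /= oddB // !oddD addbF addbC.
by rewrite /gval (gval0 b_deg lt) slot_linear0 // !scaler0 oppr0.
Qed.

(** The degree of a nested bracket depends only on the whole factor, so that all the nested terms
    over one factor live in the same component of [b] and can be added. *)
Lemma gval_beta (M : lmodType K) (g : word -> M) l1 l3 u v w : slot_linear g ->
  g (l1 ++ beta (u ++ beta v :: w) :: l3) =
  g (l1 ++ Tagged A (b (gdeg (u ++ v ++ w) + 3 - size (u ++ v ++ w))%N (u ++ beta v :: w)) :: l3).
Proof.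
move=> gl; case: (leqP (size v) (gdeg v + 2)) => [le|lt].
  rewrite {1}/gval; set e := (_ - _)%N; set e' := (_ - _)%N; have -> : e = e' => //.
  by rewrite /e /e' !gdeg_cat gdeg_cons !size_cat /=; lia.
have b0 e : b e (u ++ beta v :: w) = 0.
  by rewrite /gval (gval0 b_deg lt) (slot_linear0 (g := b e)).
by rewrite {1}/gval !b0 !slot_linear0.
Qed.

Lemma coder_slot (M : lmodType K) (g : word -> M) l1 l2 l3 : slot_linear g ->
  coder (fun w => g (l1 ++ beta w :: l3)) l2 =
  g (l1 ++ Tagged A (coder (b (gdeg l2 + 3 - size l2)%N) l2) :: l3).
Proof.
move=> gl; set e := (_ - _)%N.
pose f : {linear A e -> M} := HB.pack (fun x : A e => g (l1 ++ Tagged A x :: l3))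
  (GRing.isLinear.Build K _ _ _ _ (slot_linear_slot l1 l3 gl)).
rewrite -[RHS]/(f _) linear_coder; apply: eq_coder => u v w el.
by rewrite (gval_beta l1 l3) // -el.
Qed.

(** Of the nested contractions left by [coder_coder], those inside a proper factor are zero letters
    by assumption; only the whole word is left. *)
Lemma coder_coder_slot (M : lmodType K) (g : word -> M) l : slot_linear g ->
  (forall l1 l2 l3, l = l1 ++ l2 ++ l3 -> (size l2 < size l)%N ->
     coder (b (gdeg l2 + 3 - size l2)%N) l2 = 0) ->
  coder (coder g) l = g [:: Tagged A (coder (b (gdeg l + 3 - size l)%N) l)].
Proof.
move=> gl cb0; rewrite coder_coder; [|exact: ssgn2|exact: beta_sgn].
rewrite splits_first => [|a l1 l2 e].
  rewrite splits_last => [|l1 a l2 e].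
    by rewrite coder_slot.
  rewrite coder_slot // (cb0 [::] l1 (a :: l2)) ?slot_linear0 //.
  by rewrite e size_cat /= addnS ltnS leq_addr.
apply: splits0 => l3 l4 e'; rewrite coder_slot // (cb0 (a :: l1) l3 l4) ?slot_linear0 //.
  by rewrite e e'.
by rewrite e e' /= !size_cat; lia.
Qed.

End GradedCoder.

(** * Complements of subspaces *)

Section Complements.
Variables (K : fieldType) (V : lmodType K).
Implicit Types (U B : set V).

Definition subspace U := U 0 /\ forall a x y, U x -> U y -> U (a *: x + y).

Lemma subspaceZ U a x : subspace U -> U x -> U (a *: x).
Proof. by move=> [U0 UP] Ux; rewrite -[_ *: _]addr0; exact: UP. Qed.
Lemma subspaceD U x y : subspace U -> U x -> U y -> U (x + y).
Proof. by move=> [U0 UP] Ux Uy; rewrite -[x]scale1r; exact: UP. Qed.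
Lemma subspaceN U x : subspace U -> U x -> U (- x).
Proof. by move=> sU Ux; rewrite -scaleN1r; exact: subspaceZ. Qed.
Lemma subspaceB U x y : subspace U -> U x -> U y -> U (x - y).
Proof. by move=> sU Ux Uy; apply: subspaceD => //; exact: subspaceN. Qed.

(** The prescribed part [B0] is for small extensions, where a linear functional must vanish on the
    product of the maximal ideal with J. *)
Lemma complement_above U B0 : subspace U -> subspace B0 ->
  (forall x, U x -> B0 x -> x = 0) ->
  exists B, [/\ subspace B, B0 `<=` B, forall x, U x -> B x -> x = 0 &
    forall v, exists2 u, U u & B (v - u)].
Proof.
move=> sU sB0 UB0.
(* Zorn is applied to the sets P such that B0 `|` P is an admissible complement. *)
pose ok P := subspace (B0 `|` P) /\ forall x, U x -> (B0 `|` P) x -> x = 0.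
have [P [okP maxP]] : exists P, ok P /\ forall Q, P `<` Q -> ~ ok Q.
  apply: Zorn_bigcup => F okF totF.
  split=> [|x Ux [B0x|[P FP Px]]]; last 2 first.
  - exact: UB0.
  - by case: (okF _ FP) => _; apply => //; right.
  split=> [|a x y]; first by left; case: sB0.
  have cvx Q z : F Q -> (B0 `|` Q) z -> (B0 `|` \bigcup_(X in F) X) z.
    by move=> FQ [?|Qz]; [left | right; exists Q].
  have okP Q : F Q -> (B0 `|` Q) x -> (B0 `|` Q) y -> (B0 `|` Q) (a *: x + y).
    by move=> FQ; exact: (okF _ FQ).1.2.
  move=> [Bx|[P FP Px]] [By|[Q FQ Qy]].
  - by left; apply: (sB0.2).
  - by apply: (cvx Q _ FQ); apply: okP FQ _ _; [left|right].
  - by apply: (cvx P _ FP); apply: okP FP _ _; [right|left].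
  - have [PQ|QP] := totF _ _ FP FQ.
      by apply: (cvx Q _ FQ); apply: okP FQ _ _; right=> //; exact: PQ.
    by apply: (cvx P _ FP); apply: okP FP _ _; right=> //; exact: QP.
exists (B0 `|` P); case: okP => sB UB; split=> //.
move=> v; apply: contrapT => nv.
pose Q := [set x | exists a b, (B0 `|` P) b /\ x = a *: v + b].
have BQ : B0 `|` P `<=` Q by move=> x Bx; exists 0, x; rewrite scale0r add0r.
have : ok Q.
  split.
    split=> [|a x y]; first by left; case: sB0.
    have BQQ z : (B0 `|` Q) z -> Q z by move=> [?|//]; apply: BQ; left.
    move=> /BQQ [a1 [b1 [B1 ->]]] /BQQ [a2 [b2 [B2 ->]]]; right.
    exists (a * a1 + a2), (a *: b1 + b2); split; first exact: sB.2.
    by rewrite scalerDr scalerA addrACA -scalerDl.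
  move=> x Ux [B0x|[a [b [Bb xE]]]]; first exact: UB0.
  have [a0|a0] := eqVneq a 0.
    by move: xE; rewrite a0 scale0r add0r => xE; apply: UB => //; rewrite xE.
  case: nv; exists (a^-1 *: x); first exact: subspaceZ.
  rewrite xE scalerDr scalerA mulVf // scale1r opprD addNKr.
  by apply: subspaceN => //; exact: subspaceZ.
apply: (maxP Q); split; first by move=> x Px; apply: BQ; right.
move=> QP; apply: nv; exists 0; first by case: sU.
rewrite subr0; right; apply: QP; exists 1, 0; rewrite scale1r addr0; split=> //.
by case: sB.
Qed.

Lemma projector U : subspace U ->
  exists p : {linear V -> V}, (forall x, U (p x)) /\ forall x, U x -> p x = x.
Proof.
move=> sU; have s0 : subspace [set 0 : V].
  by split=> // a x y /= -> ->; rewrite scaler0 addr0.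
have [//|B [sB _ UB UBV]] := complement_above sU s0.
have /choice [p pP] : forall v, exists u, U u /\ B (v - u).
  by move=> v; have [u Uu Bu] := UBV v; exists u.
have uniq_p v u : U u -> B (v - u) -> p v = u.
  move=> Uu Bu; apply/eqP; rewrite -subr_eq0; apply/eqP/UB.
    by apply: subspaceB => //; case: (pP v).
  have -> : p v - u = (v - u) - (v - p v) by abel.
  by apply: subspaceB => //; case: (pP v).
have lp : linear p.
  move=> a x y; case: (pP x) (pP y) => [Ux Bx] [Uy By]; apply: uniq_p.
    exact: sU.2.
  have -> : a *: x + y - (a *: p x + p y) = a *: (x - p x) + (y - p y).
    by rewrite scalerBr; abel.
  exact: sB.2.
exists (HB.pack_for {linear V -> V} p (GRing.isLinear.Build K V V _ p lp)); split=> x; first by case: (pP x).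
by move=> Ux; apply: uniq_p => //; rewrite subrr; case: sB.
Qed.

End Complements.

(** One generalised inverse yields the section of [pr], the retraction onto the cocycles and the
    contraction of the coboundaries. *)
Lemma linear_quasi_inverse (K : fieldType) (V W : lmodType K) (f : {linear V -> W}) :
  exists g : {linear W -> V}, forall x, f (g (f x)) = f x.
Proof.
have sN : subspace [set x | f x = 0].
  by split=> [|a x y /= x0 y0]; rewrite /= ?linear0 // linearP x0 y0 scaler0 addr0.
have sI : subspace (range f).
  split=> [|a _ _ [x _ <-] [y _ <-]]; first by exists 0; rewrite ?linear0.
  by exists (a *: x + y); rewrite ?linearP.
have [p [pN pid]] := projector sN; have [r [rI rid]] := projector sI.
have /choice [g gP] : forall w, exists v, f v = r w.
  by move=> w; have [v _ e] := rI w; exists v.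
(* Removing the component in the kernel makes the value independent of the chosen preimage, hence
   linear. *)
pose k w := g w - p (g w).
have eqk v v' : f v = f v' -> v - p v = v' - p v'.
  move=> e; have /pid : f (v - v') = 0 by rewrite linearB e subrr.
  rewrite linearB => /= e'; apply/subr0_eq.
  have -> : v - p v - (v' - p v') = (v - v') - (p v - p v') by abel.
  by rewrite e' subrr.
have lk : linear k.
  move=> a x y; rewrite /k.
  rewrite (@eqk (g (a *: x + y)) (a *: g x + g y)); last by rewrite linearP !gP linearP.
  by rewrite linearP /= scalerBr; abel.
exists (HB.pack_for {linear W -> V} k (GRing.isLinear.Build K W V _ k lk)) => x /=.
by rewrite /k linearB /= (pN (g (f x)) : f _ = 0) subr0 gP rid //.
Qed.

(** * Transfer of a dg algebra structure *)

Section TaggedProjection.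
Variables (K : fieldType) (C : nat -> lmodType K).

Definition tproj e (u : gelt C) : C e := tagged_as (Tagged C (0 : C e)) u.

Lemma tproj_tag e (x : C e) : tproj e (Tagged C x) = x.
Proof. by rewrite /tproj /tagged_as /=; case: eqP => // eq_uu; rewrite [eq_uu]eq_axiomK. Qed.

Lemma tproj_neq e (u : gelt C) : tag u <> e -> tproj e u = 0.
Proof.
rewrite /tproj /tagged_as => ne; case: eqP => // eu.
by case: ne.
Qed.

Lemma tproj_linear e i : linear (fun x : C i => tproj e (Tagged C x)).
Proof.
move=> a x y; have [ei|ne] := eqVneq i e.
  by case: e / ei; rewrite !tproj_tag.
by rewrite !tproj_neq ?scaler0 ?addr0 //=; apply/eqP.
Qed.

Lemma tproj0 e i : tproj e (Tagged C (0 : C i)) = 0.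
Proof. by have := tproj_linear e (-1) (0 : C i) 0; rewrite scaler0 addr0 scaleN1r addNr. Qed.
End TaggedProjection.

Section Cut.
Variables (K : fieldType) (A B : nat -> lmodType K).

Definition cut n (f : gmap A B) : gmap A B := fun e w => if (size w < n)%N then f e w else 0.

Lemma cut_cut m n f : (m <= n)%N -> cut m (cut n f) = cut m f.
Proof.
move=> mn; apply: functional_extensionality_dep => e; apply/funext => w; rewrite /cut.
by case: ltnP => // wm; rewrite (leq_trans wm mn).
Qed.

End Cut.

Section Transfer.
Variables (K : fieldType) (C H : nat -> lmodType K).
Variables (d : forall i, {linear C i -> C i.+1}) (mu : forall i j, C i -> C j -> C (i + j)%N).
Hypothesis mu_linl : forall i j (y : C j), linear (fun x : C i => mu x y).
Hypothesis mu_linr : forall i j (x : C i), linear (@mu i j x).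

(* An embedding of all the C i into a single associative dg algebra. *)
Variables (X : lmodType K) (D : {linear X -> X}) (cup : X -> X -> X).
Variable j : forall i, {linear C i -> X}.
Arguments j {i}.
Hypothesis j_inj : forall i, injective (@j i).
Hypothesis j_d : forall i (x : C i), j (d i x) = D (j x).
Hypothesis j_mu : forall i k (x : C i) (y : C k), j (mu x y) = cup (j x) (j y).
Hypothesis DD : forall x, D (D x) = 0.
Hypothesis cup_linl : forall y, linear (cup^~ y).
Hypothesis cup_linr : forall x, linear (cup x).
Hypothesis cupA : associative cup.
Hypothesis Leibniz : forall i (x : C i) y,
  D (cup (j x) y) = cup (D (j x)) y + (-1) ^+ i *: cup (j x) (D y).

Variables (q : forall e, {linear C e -> H e}) (sigma : forall e, {linear H e -> C e}).
Variable h : forall e, {linear C e.+1 -> C e}.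
Arguments sigma {e}.
Arguments h {e}.
Hypothesis d_sigma : forall e (x : H e), d e (sigma x) = 0.
Hypothesis q_sigma : forall e (x : H e), q e (sigma x) = x.
Hypothesis q_d : forall e (y : C e), q e.+1 (d e y) = 0.
Hypothesis d_h : forall e (x : C e.+1), d _ x = 0 -> d e (h (sigma (q _ x) - x)) = sigma (q _ x) - x.
Hypothesis sigma_q0 : forall x : C 0, d 0 x = 0 -> sigma (q 0 x) = x.

Local Notation sg := (sgw (@ssgn K H)).
Local Notation cdr b := (coder (gval 2 b) (@ssgn K H)).
Implicit Types (b : gmap H H) (F : gmap H C).

(** The product term of the morphism equation after the bar twist; [tproj] reads it in degree
    [e]. *)
Definition quad F : gmap H C := fun e =>
  splits (fun l1 l2 => sg l1 *:
    tproj e (Tagged C (mu (tagged (gval 1 F l1)) (tagged (gval 1 F l2))))).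

(* With U the obstruction built from the components of smaller arity, b_n = q U and
   F_n = h (sigma q U - U). *)
Definition lower b F : gmap H C := fun e l => - (quad F e l + cdr b (F e) l).

Definition next_b b F : gmap H H := fun e l =>
  if (1 < size l)%N && (e + size l == gdeg l + 2)%N
  then q e (lower (cut (size l) b) (cut (size l) F) e l) else 0.

Definition next_F b F : gmap H C := fun e l =>
  if l is [:: x] then tproj e (Tagged C (sigma (tagged x)))
  else if (1 < size l)%N && (e + size l == gdeg l + 1)%N
  then let u := lower (cut (size l) b) (cut (size l) F) e.+1 l in h (sigma (q _ u) - u) else 0.

(** The recursion is on the arity, but it evaluates [b] and [F] at words unrelated to the given one,
    so whole families are iterated; after [k] rounds the values on words shorter than [k] are
    final. *)
Fixpoint approx k : gmap H H * gmap H C :=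
  if k is k'.+1 then (next_b (approx k').1 (approx k').2, next_F (approx k').1 (approx k').2)
  else (fun _ _ => 0, fun _ _ => 0).

Lemma next_ext n b b' F F' : cut n b = cut n b' -> cut n F = cut n F' ->
  cut n.+1 (next_b b F) = cut n.+1 (next_b b' F') /\
  cut n.+1 (next_F b F) = cut n.+1 (next_F b' F').
Proof.
move=> eb eF.
have cE m : (m <= n)%N -> cut m b = cut m b' /\ cut m F = cut m F'.
  by move=> mn; rewrite -(cut_cut b mn) -(cut_cut F mn) eb eF !cut_cut.
split; apply: functional_extensionality_dep => e; apply/funext => w; rewrite /cut ltnS; case: ifP => // /cE [eb' eF'].
  by rewrite /next_b eb' eF'.
by rewrite /next_F eb' eF'.
Qed.

Lemma approx_stable k m : (k <= m)%N ->
  cut k (approx k).1 = cut k (approx m).1 /\ cut k (approx k).2 = cut k (approx m).2.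
Proof.
elim: k m => [|k IH] [|m] //= km; by apply: next_ext; case: (IH m km).
Qed.

Lemma next_fixpoint : exists b F, b = next_b b F /\ F = next_F b F.
Proof.
pose b : gmap H H := fun e l => (approx (size l).+1).1 e l.
pose F : gmap H C := fun e l => (approx (size l).+1).2 e l.
have cutE k : cut k b = cut k (approx k).1 /\ cut k F = cut k (approx k).2.
  split; apply: functional_extensionality_dep => e; apply/funext => w; rewrite /cut; case: ifP => // wk.
    have [/(congr1 (fun f => f e w)) + _] := approx_stable wk.
    by rewrite /cut ltnSn.
  have [_ /(congr1 (fun f => f e w))] := approx_stable wk.
  by rewrite /cut ltnSn.
exists b, F; split; apply: functional_extensionality_dep => e; apply/funext => w.
  by rewrite /b /= /next_b; have [-> ->] := cutE (size w).
by rewrite /F /= /next_F; have [-> ->] := cutE (size w).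
Qed.

Lemma quad_lin F : multilinear F -> multilinear (quad F).
Proof.
move=> Fl e; change (slot_linear (quad F e)); apply: slot_linear_splits => [l1|l2].
  apply: slot_linearZ; apply: (@gval_slot_lin _ H C _ (fun z =>
    tproj e (Tagged C (mu (tagged (gval 1 F l1)) (tagged z)))) 1 F) => // i c x y.
  by rewrite /= mu_linr tproj_linear.
apply: slot_linear_scale; first exact: sg_slot.
apply: (@gval_slot_lin _ H C _ (fun z =>
    tproj e (Tagged C (mu (tagged z) (tagged (gval 1 F l2))))) 1 F) => // i c x y.
by rewrite /= mu_linl tproj_linear.
Qed.

Lemma lower_lin b F : multilinear b -> multilinear F -> multilinear (lower b F).
Proof.
move=> bl Fl e; change (slot_linear (lower b F e)); apply: slot_linearN; apply: slot_linearD; first exact: quad_lin.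
exact: slot_linear_coder.
Qed.

Section Spec.
Variables (b : gmap H H) (F : gmap H C).
Hypotheses (bE : b = next_b b F) (FE : F = next_F b F).

Lemma b_deg : of_degree 2 b.
Proof. by move=> e l ne; rewrite bE /next_b (negbTE ne) andbF. Qed.

Lemma F_deg : of_degree 1 F.
Proof.
move=> e l ne; rewrite FE /next_F; case: l ne => [|x [|y l]] ne //.
  apply: tproj_neq => /= ex; case/eqP: ne.
  by rewrite gdeg_cons gdeg_nil ex addn0.
by rewrite (negbTE ne) andbF.
Qed.

Lemma b_small e l : (size l <= 1)%N -> b e l = 0.
Proof. by move=> l1; rewrite bE /next_b ltnNge l1. Qed.

Lemma F_nil e : F e [::] = 0.
Proof. by rewrite FE. Qed.

Lemma F_one e x : F e [:: x] = tproj e (Tagged C (sigma (tagged x))).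
Proof. by rewrite FE. Qed.

(** Induction on the arity: a new component is a linear function of [lower], which involves smaller
    arities only, and the degree tests do not depend on the entries. *)
Lemma cut_multilinear n : multilinear (cut n b) /\ multilinear (cut n F).
Proof.
elim: n => [|n [bl Fl]].
  by split=> e l r i a x y; rewrite /cut /= scaler0 addr0.
have ll := lower_lin bl Fl.
have small (B : nat -> lmodType K) (f : gmap H B) : multilinear (cut n f) ->
    (forall e l r i a (x y : H i), size (l ++ Tagged H x :: r) = n ->
     f e (l ++ Tagged H (a *: x + y) :: r) =
    a *: f e (l ++ Tagged H x :: r) + f e (l ++ Tagged H y :: r)) ->
    multilinear (cut n.+1 f).
  move=> cl fl e l r i a x y; rewrite /cut !(size_slot _ _ (a *: x + y) x) !(size_slot _ _ y x) ltnS.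
  case: ltngtP => sn; rewrite ?scaler0 ?addr0 //; last exact: fl.
  by have := cl e l r i a x y; rewrite /cut !(size_slot _ _ (a *: x + y) x) !(size_slot _ _ y x) sn.
split; apply: small => // e l r i a x y sn.
  rewrite bE /next_b !(size_slot _ _ (a *: x + y) x) !(size_slot _ _ y x) !(gdeg_slot _ _ (a *: x + y) x) !(gdeg_slot _ _ y x) sn.
  by case: ifP => _; rewrite ?scaler0 ?addr0 // ll linearP.
have [s1|s1] := eqVneq n 1%N.
  move: sn; rewrite s1 size_cat; case: l => [|? [|? ?]] //; case: r => // _.
  by rewrite !F_one /= linearP tproj_linear.
have nF e' z : size (l ++ z :: r) = n -> F e' (l ++ z :: r) =
    if (1 < n)%N && (e' + n == gdeg (l ++ z :: r) + 1)%N then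
    let u := lower (cut n b) (cut n F) e'.+1 (l ++ z :: r) in h (sigma (q _ u) - u) else 0.
  by move: s1 => /[swap] <-; rewrite {1}FE /next_F; case: (l ++ z :: r) => [|c [|c' w]].
rewrite !nF ?(size_slot _ _ (a *: x + y) x) ?(size_slot _ _ y x) //= !(gdeg_slot _ _ (a *: x + y) x) !(gdeg_slot _ _ y x).
case: ifP => _; rewrite ?scaler0 ?addr0 // ll -[RHS]linearP; congr (h _).
by rewrite !linearP /= scalerBr scalerN; abel.
Qed.

Lemma b_lin : multilinear b.
Proof.
move=> e l r i a x y; have [/(_ e l r i a x y)] := cut_multilinear (size (l ++ Tagged H x :: r)).+1.
by rewrite /cut !(size_slot _ _ (a *: x + y) x) !(size_slot _ _ y x) ltnSn.
Qed.

Lemma F_lin : multilinear F.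
Proof.
move=> e l r i a x y; have [_ /(_ e l r i a x y)] := cut_multilinear (size (l ++ Tagged H x :: r)).+1.
by rewrite /cut !(size_slot _ _ (a *: x + y) x) !(size_slot _ _ y x) ltnSn.
Qed.

Definition Phi (l : seq (gelt H)) : X := j (tagged (gval 1 F l)).

Lemma gval_b_small v : (size v <= 1)%N -> exists k, gval 2 b v = Tagged H (0 : H k).
Proof. by move=> v1; rewrite /gval b_small //; eexists. Qed.

Lemma gval_b0 v : (gdeg v + 2 < size v)%N -> exists k, gval 2 b v = Tagged H (0 : H k).
Proof. by move=> lt; rewrite /gval (gval0 b_deg lt); eexists. Qed.

Lemma PhiE e l : (e + size l = gdeg l + 1)%N -> Phi l = j (F e l).
Proof.
by move=> el; rewrite /Phi /gval /=; have -> : (gdeg l + 1 - size l)%N = e by lia.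
Qed.

Lemma Phi0 l : (gdeg l + 1 < size l)%N -> Phi l = 0.
Proof. by move=> lt; rewrite /Phi /= (gval0 F_deg lt) linear0. Qed.

Lemma Phi_lin : slot_linear Phi.
Proof.
apply: (@gval_slot_lin _ H C _ (fun z => j (tagged z)) 1 F); last exact: F_lin.
by move=> i c x y; rewrite /= linearP.
Qed.

Lemma Phi_word e u v w : (e + size (u ++ v ++ w) = gdeg (u ++ v ++ w) + 2)%N ->
  Phi (u ++ gval 2 b v :: w) = j (F e (u ++ gval 2 b v :: w)).
Proof.
case: (leqP (size v) (gdeg v + 2)) => [le|/gval_b0 [k ->]] ee.
  by apply: PhiE; move: ee; rewrite !gdeg_cat gdeg_cons !size_cat /=; lia.
by rewrite (slot_linear0 _ _ _ Phi_lin) (slot_linear0 (g := F e) _ _ _ (F_lin e)) linear0.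
Qed.

Lemma mu0l i k (y : C k) : mu (0 : C i) y = 0.
Proof. by have := @mu_linl i k y (-1) 0 0; rewrite /= scaler0 addr0 scaleN1r addNr. Qed.
Lemma mu0r i k (x : C i) : mu x (0 : C k) = 0.
Proof. by have := @mu_linr i k x (-1) 0 0; rewrite /= scaler0 addr0 scaleN1r addNr. Qed.

Lemma cup_Phi e l1 l2 : (e + size (l1 ++ l2) = gdeg (l1 ++ l2) + 2)%N ->
  cup (Phi l1) (Phi l2) =
  j (tproj e (Tagged C (mu (tagged (gval 1 F l1)) (tagged (gval 1 F l2))))).
Proof.
rewrite gdeg_cat size_cat => ee; rewrite /Phi -j_mu.
case: (leqP (size l1) (gdeg l1 + 1)) => [le1|lt1]; last first.
  by rewrite {1 3}/gval /= (gval0 F_deg lt1) !mu0l tproj0 !linear0.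
case: (leqP (size l2) (gdeg l2 + 1)) => [le2|lt2]; last first.
  by rewrite {2 4}/gval /= (gval0 F_deg lt2) !mu0r tproj0 !linear0.
move: (mu _ _) => /=.
have -> : (gdeg l1 + 1 - size l1 + (gdeg l2 + 1 - size l2))%N = e by lia.
by move=> z; rewrite tproj_tag.
Qed.

(** The defect before its embedding into [X], in one degree, so that [q] and [h] apply to it. *)
Definition tdefect e l : C e :=
  cdr b (F e) l - tproj e (Tagged C (d _ (tagged (gval 1 F l)))) + quad F e l.

Local Notation dft := (defect (gval 2 b) (@ssgn K H) D cup Phi).

Lemma defectE e l : (e + size l = gdeg l + 2)%N -> dft l = j (tdefect e l).
Proof.
move=> el; rewrite /defect /tdefect linearD linearB /=; congr (_ - _ + _).
- rewrite linear_coder; apply: eq_coder => u v w e'; apply: Phi_word.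
  by rewrite -e'.
- case: (leqP (size l) (gdeg l + 1)) => [le|lt]; last first.
    by rewrite Phi0 // (gval0 F_deg lt) 2!linear0 tproj0 linear0.
  rewrite /Phi -j_d; move: (d _ _) => /=.
  have -> : (gdeg l + 1 - size l).+1 = e by lia.
  by move=> z; rewrite tproj_tag.
- rewrite /conv /quad raddf_splits; apply: eq_splits => l1 l2 e'.
  by rewrite /= linearZ /= (cup_Phi (e := e)) // -e'.
Qed.

Lemma defect0 l : (gdeg l + 2 < size l)%N -> dft l = 0.
Proof.
move=> lt; rewrite /defect Phi0 ?linear0 ?subr0; last by lia.
rewrite /conv [splits _ l]splits0 ?addr0; last first.
  move=> l1 l2 e; move: lt; rewrite e gdeg_cat size_cat => lt.
  case: (ltnP (gdeg l1 + 1) (size l1)) => l1s.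
    by rewrite (Phi0 l1s) (cup0l cup_linl) scaler0.
  by rewrite (Phi0 (l := l2)) ?(cup0r cup_linr) ?scaler0 //; lia.
apply: splits0 => u v' e; rewrite [splits _ v']splits0 ?scaler0 // => v w e'.
case: (leqP (size v) (gdeg v + 2)) => [le|/gval_b0 [k ->]]; last first.
  by rewrite (slot_linear0 _ _ _ Phi_lin).
apply: Phi0; move: lt; rewrite e e' !gdeg_cat gdeg_cons !size_cat /=; lia.
Qed.

Lemma cdr_deg e l : (e + size l != gdeg l + 3)%N -> cdr b (b e) l = 0.
Proof.
move=> ne; apply: splits0 => u v' e1; rewrite [splits _ v']splits0 ?scaler0 // => v w e2.
case: (leqP (size v) (gdeg v + 2)) => [le|/gval_b0 [k ->]]; last first.
  by rewrite (slot_linear0 (g := b e) _ _ _ (b_lin e)).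
apply: b_deg; move: ne; rewrite e1 e2 !gdeg_cat gdeg_cons !size_cat /=.
by apply: contraNneq; lia.
Qed.

(* Words of length at most 1 only produce words with a vanishing letter. *)
Lemma cdr_small (M : lmodType K) (g : seq (gelt H) -> M) l :
  slot_linear g -> (size l <= 1)%N -> cdr b g l = 0.
Proof.
move=> gl l1; apply: splits0 => u v' e1; rewrite [splits _ v']splits0 ?scaler0 // => v w e2.
have [|k ->] := @gval_b_small v; last by rewrite slot_linear0.
by move: l1; rewrite e1 e2 !size_cat; lia.
Qed.

(** Isolates the component to be chosen: contracting the whole word gives F_1 of b_n, that is sigma
    b_n, and all other terms are of smaller arity. *)
Lemma cdr_cut e l : (1 < size l)%N ->
  cdr b (F e) l = F e [:: gval 2 b l] + cdr (cut (size l) b) (cut (size l) F e) l.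
Proof.
move=> l1; apply/eqP; rewrite -subr_eq; apply/eqP.
have cl := (cut_multilinear (size l)).2.
rewrite /coder -splitsN -splitsD.
have step u v w : l = u ++ v ++ w ->
   (u == [::]) && (w == [::]) = false ->
   F e (u ++ gval 2 b v :: w) = cut (size l) F e (u ++ gval 2 (cut (size l) b) v :: w).
  move=> lE ne; have sv : (size v < size l)%N.
    by rewrite lE; case: u w ne {lE} => [|? u] [|? w] //= _; rewrite !size_cat /=; lia.
  have -> : gval 2 (cut (size l) b) v = gval 2 b v by rewrite /gval /cut sv.
  (* Contracting a factor of length at most 1 does not shorten the word, but it creates a zero
     letter. *)
  have [v1|v1] := leqP (size v) 1.
    have [k ->] := gval_b_small v1.
    by rewrite (slot_linear0 (g := F e) _ _ _ (F_lin e)) (slot_linear0 (g := cut _ F e) _ _ _ (cl e)).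
  rewrite /cut ifT //; move: v1; rewrite lE !size_cat /=; lia.
have top : cut (size l) F e [:: gval 2 (cut (size l) b) l] = 0.
  have -> : gval 2 (cut (size l) b) l = Tagged H (0 : H (gdeg l + 2 - size l)%N).
    by rewrite /gval /cut ltnn.
  exact: (slot_linear0 (g := cut _ F e) [::] [::] _ (cl e)).
rewrite splits_first => [|a u v e1].
  rewrite sgw_nil !scale1r -splitsN -splitsD splits_last; first by rewrite top subr0.
  by move=> v a w e1; rewrite (step [::] v (a :: w)) ?subrr.
rewrite -scalerBr -splitsN -splitsD splits0 ?scaler0 // => v' w e2.
by rewrite (step (a :: u)) ?subrr // e1 e2.
Qed.

Lemma Phi_nil : Phi [::] = 0.
Proof. by rewrite /Phi /= F_nil linear0. Qed.

Lemma Phi_Leibniz l y :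
  D (cup (Phi l) y) = cup (D (Phi l)) y - sg l *: cup (Phi l) (D y).
Proof.
case: (leqP (size l) (gdeg l + 1)) => [le|lt].
  rewrite /Phi Leibniz /= -scaleNr sgE; congr (_ + _ *: _).
  transitivity ((-1) ^+ (size l + gdeg l).+1 : K); last by rewrite exprS mulN1r.
  by apply: exprN1_odd; rewrite /= oddB // !oddD addbT addbC addbN.
by rewrite Phi0 // linear0 !(cup0l cup_linl) linear0 scaler0 subr0.
Qed.

Lemma quad_cut e l : quad (cut (size l) F) e l = quad F e l.
Proof.
apply: eq_splits => l1 l2 lE; congr (_ *: _).
have c w : (size w < size l)%N -> gval 1 (cut (size l) F) w = gval 1 F w.
  by move=> lt; rewrite /gval /cut lt.
case: l2 lE => [|a l2] lE.
  have c0 : cut (size l) F (gdeg ([::] : seq (gelt H)) + 1 - 0)%N [::] = 0.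
    by rewrite /cut F_nil if_same.
  by rewrite {2 4}/gval /= c0 F_nil !mu0r !tproj0.
case: l1 lE => [|a' l1] lE.
  have c0 : cut (size l) F (gdeg ([::] : seq (gelt H)) + 1 - 0)%N [::] = 0.
    by rewrite /cut F_nil if_same.
  by rewrite {1 3}/gval /= c0 F_nil !mu0l !tproj0.
by rewrite !c // lE size_cat /=; lia.
Qed.

Lemma dd e (x : C e) : d _ (d _ x) = 0.
Proof. by apply: j_inj; rewrite !j_d DD linear0. Qed.

(* The differential of the defect is sigma of the relation for b ([D_defect]), so that q
   kills the latter; the defect is then a cocycle, and next_b, next_F make it 0. *)
Lemma relations l : (forall e, cdr b (b e) l = 0) /\ dft l = 0.
Proof.
have [n] := ubnP (size l); elim: n l => // n IH l; rewrite ltnS => ln.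
have {}IH l' : (size l' < size l)%N -> (forall e, cdr b (b e) l' = 0) /\ dft l' = 0.
  by move=> lt; apply: IH; exact: leq_trans ln.
have [l1|l1] := leqP (size l) 1.
  split=> [e|]; first by rewrite cdr_small //; exact: b_lin.
  rewrite /defect cdr_small //; last exact: Phi_lin.
  case: l l1 {ln IH} => [|x [|//]] _.
    by rewrite /conv splits_nil Phi_nil linear0 (cup0l cup_linl) scaler0 subr0 addr0.
  rewrite /conv splits_cons splits_nil Phi_nil (cup0l cup_linl) (cup0r cup_linr).
  rewrite !scaler0 !addr0 sub0r /Phi -j_d /gval /= F_one.
  have -> : (gdeg [:: x] + 1 - 1)%N = tag x by rewrite gdeg_cons gdeg_nil; lia.
  by rewrite tproj_tag d_sigma linear0 oppr0.
pose e3 := (gdeg l + 3 - size l)%N.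
have defD : D (dft l) = Phi [:: Tagged H (cdr b (b e3) l)].
  rewrite D_defect //; first last.
  - by move=> l' /IH [].
  (* Contraction along a factor of length at most 1 gives no shorter word to which the induction
     applies; there the defect vanishes by multilinearity. *)
  - move=> u v w lE; have [v1|v1] := leqP (size v) 1.
      have [k ->] := gval_b_small v1.
      apply: (slot_linear0 (g := dft)).
      apply: slot_linearD; last first.
        apply: slot_linear_splits => [w1|w2].
          apply: slot_linearZ => ? ? ? ? ? ?; rewrite Phi_lin; exact: cup_linr.
        apply: slot_linear_scale; first exact: sg_slot.
        by move=> ? ? ? ? ? ?; rewrite Phi_lin; exact: cup_linl.
      apply: slot_linearD; first by apply: slot_linear_coder; [exact: b_lin | exact: Phi_lin].
      by apply: slot_linearN; apply: linear_slot; exact: Phi_lin.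
    by apply: (IH _ _).2; rewrite lE !size_cat /= ; move: v1; lia.
  - by apply: beta_sgn; [exact: b_deg | exact: Phi_lin].
  - exact: Phi_Leibniz.
  - exact: Phi_nil.
  - exact: ssgn2.
  rewrite coder_coder_slot //; [exact: b_lin | exact: b_deg | exact: Phi_lin |].
  by move=> u v w _ /IH [].
have PhiO : Phi [:: Tagged H (cdr b (b e3) l)] = j (sigma (cdr b (b e3) l)).
  by rewrite (PhiE (e := e3)) ?F_one ?tproj_tag //= gdeg_cons gdeg_nil addn0.
have O0 : cdr b (b e3) l = 0 -> forall e, cdr b (b e) l = 0.
  move=> o0 e; have [ee|] := eqVneq (e + size l)%N (gdeg l + 3)%N; last exact: cdr_deg.
  by have -> : e = e3 by rewrite /e3; lia.
(* The defect lives in degree [gdeg l + 2 - size l]. If that is negative the defect is 0, and so is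
   sigma of the relation, its differential. *)
have [le|lt] := leqP (size l) (gdeg l + 2); last first.
  have df0 := defect0 lt; split=> //; apply: O0.
  rewrite -[LHS]q_sigma; have -> : sigma (cdr b (b e3) l) = 0; last by rewrite linear0.
  by apply: j_inj; rewrite linear0 -PhiO -defD df0 linear0.
pose e := (gdeg l + 2 - size l)%N.
have el : (e + size l = gdeg l + 2)%N by rewrite /e; lia.
have e3E : e3 = e.+1 by rewrite /e3 /e; lia.
clearbody e3; subst e3.
have dY : d e (tdefect e l) = sigma (cdr b (b e.+1) l).
  by apply: j_inj; rewrite -PhiO -defD j_d (defectE el).
have o0 : cdr b (b e.+1) l = 0 by rewrite -[LHS]q_sigma -dY q_d.
split; first exact: O0.
rewrite (defectE el).
rewrite o0 linear0 in dY.
pose u := lower (cut (size l) b) (cut (size l) F) e l.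
have YE : tdefect e l = sigma (q _ u) - u - tproj e (Tagged C (d _ (tagged (gval 1 F l)))).
  rewrite /tdefect cdr_cut // F_one /gval /= tproj_tag {1}bE /next_b l1 el eqxx /= -/u.
  by rewrite /u /lower quad_cut; abel.
have du : d _ u = 0.
  have dF : d _ (tproj e (Tagged C (d _ (tagged (gval 1 F l))))) = 0.
    have [ee|ne] := eqVneq (gdeg l + 1 - size l).+1 e; last first.
      by rewrite tproj_neq ?linear0 //=; apply/eqP.
    by move: (tagged _) => /= z; case: _ / ee; rewrite tproj_tag dd.
  by have := dY; rewrite YE !linearB dF d_sigma /= subr0 sub0r => /eqP; rewrite oppr_eq0 => /eqP.
clear O0 PhiO defD; clearbody e.
(* In degree 0 there is no F to correct with, since it would have degree -1; but there are no
   coboundaries either, so the cocycle [u] equals [sigma (q u)]. *)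
case: e el dY o0 @u YE du => [|e] el dY o0 u YE du; rewrite YE.
  have lt : (gdeg l + 1 < size l)%N by lia.
  by rewrite sigma_q0 // subrr sub0r /= (gval0 F_deg lt) linear0 tproj0 oppr0 linear0.
have -> : tproj e.+1 (Tagged C (d _ (tagged (gval 1 F l)))) = d _ (F e l).
  rewrite /gval /=; have -> : (gdeg l + 1 - size l)%N = e by lia.
  by rewrite tproj_tag.
rewrite FE /next_F; clear ln IH le dY o0 YE; case: l l1 el @u du => [//|x [//|y l]] _ el u du.
have -> : (1 < size [:: x, y & l])%N && (e + size [:: x, y & l] == gdeg [:: x, y & l] + 1)%N.
  by apply/andP; split=> //; apply/eqP; lia.
by rewrite d_h // subrr linear0.
Qed.

Lemma tdefect0 e l : tdefect e l = 0.
Proof.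
have [el|ne] := eqVneq (e + size l)%N (gdeg l + 2)%N.
  by apply: j_inj; rewrite -defectE // linear0; case: (relations l).
rewrite /tdefect /quad [splits _ l]splits0 => [|l1 l2 lE]; last first.
  case: (leqP (size l1) (gdeg l1 + 1)) => [le1|lt1]; last first.
    by rewrite {1 3}/gval /= (gval0 F_deg lt1) !mu0l tproj0 scaler0.
  case: (leqP (size l2) (gdeg l2 + 1)) => [le2|lt2]; last first.
    by rewrite {2 4}/gval /= (gval0 F_deg lt2) !mu0r tproj0 scaler0.
  rewrite tproj_neq ?scaler0 //= => ee; case/eqP: ne.
  by rewrite lE gdeg_cat size_cat -ee; lia.
have -> : tproj e (Tagged C (d _ (tagged (gval 1 F l)))) = 0.
  case: (leqP (size l) (gdeg l + 1)) => [le|lt]; last first.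
    by rewrite /= (gval0 F_deg lt) linear0 tproj0.
  by rewrite tproj_neq //= => ee; case/eqP: ne; rewrite -ee; lia.
rewrite subr0 addr0; apply: splits0 => u v' e1; rewrite [splits _ v']splits0 ?scaler0 // => v w e2.
case: (leqP (size v) (gdeg v + 2)) => [le|/gval_b0 [k ->]]; last first.
  by rewrite (slot_linear0 (g := F e) _ _ _ (F_lin e)).
apply: F_deg; move: ne; rewrite e1 e2 !gdeg_cat gdeg_cons !size_cat /=.
by apply: contraNneq; lia.
Qed.

Lemma gval_F_one i (x : H i) : gval 1 F [:: Tagged H x] = Tagged C (sigma x).
Proof.
rewrite /gval F_one /=.
have : (gdeg [:: Tagged H x] + 1 - 1)%N = i by rewrite gdeg_cons gdeg_nil /=; lia.
by move: (_ - _)%N => e ->; rewrite tproj_tag.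
Qed.

Lemma b_two i k (x : H i) (y : H k) :
  b (i + k)%N [:: Tagged H x; Tagged H y] = q _ ((-1) ^+ i *: mu (sigma x) (sigma y)).
Proof.
rewrite bE /next_b /= {1}/gdeg !big_cons big_nil addn0 eqxx; congr (q _ _).
rewrite /lower [X in - (_ + X)]splits0 ?addr0 => [|u v' e1]; last first.
  rewrite [splits _ v']splits0 ?scaler0 // => v w e2.
  have -> : gval 2 (cut 2 b) v = Tagged H (0 : H (gdeg v + 2 - size v)%N).
    by rewrite /gval /cut; case: ifP => // v1; rewrite b_small.
  exact: (slot_linear0 (g := cut 2 F _) u w _ ((cut_multilinear 2).2 _)).
rewrite (quad_cut _ [:: Tagged H x; Tagged H y]) /quad !splits_cons splits_nil.
have -> : gval 1 F [::] = Tagged C (0 : C (gdeg ([::] : seq (gelt H)) + 1 - 0)%N).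
  by rewrite /gval F_nil.
rewrite !gval_F_one /= mu0l mu0r !tproj0 !scaler0 add0r addr0 tproj_tag sgw_cons sgw_nil mulr1 /ssgn /=.
by rewrite exprS mulN1r scaleNr opprK.
Qed.

End Spec.

Lemma transfer : exists (b : gmap H H) (F : gmap H C),
  [/\ multilinear b, of_degree 2 b, multilinear F & of_degree 1 F] /\
  [/\ forall e l, (size l <= 1)%N -> b e l = 0,
      forall e, F e [::] = 0 /\ forall x, F e [:: x] = tproj e (Tagged C (sigma (tagged x))),
      forall i k (x : H i) (y : H k),
        b (i + k)%N [:: Tagged H x; Tagged H y] = q _ ((-1) ^+ i *: mu (sigma x) (sigma y)),
      forall e l, cdr b (b e) l = 0 &
      forall e l, cdr b (F e) l =
        tproj e (Tagged C (d _ (tagged (gval 1 F l)))) - quad F e l].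
Proof.
have [b [F [bE FE]]] := next_fixpoint; exists b, F; split.
  by split; [apply: b_lin bE FE | apply: b_deg bE | apply: F_lin bE FE | apply: F_deg FE].
split.
- by apply: b_small bE.
- by move=> e; split=> [|x]; rewrite FE.
- by apply: b_two bE FE.
- by move=> e l; case: (relations bE FE l).
- move=> e l; apply/eqP; rewrite -subr_eq0; apply/eqP.
  by rewrite -[RHS](tdefect0 bE FE e l) /tdefect; abel.
Qed.
End Transfer.

(** * Signs of the bar construction *)

Section Twist.
Variables (K : fieldType).

(* the exponent of the sign of omega^n in the definition of [bar] *)
Fixpoint bar_exp (A : nat -> lmodType K) (l : seq (gelt A)) : nat :=
  if l is a :: l' then (tag a * size l' + bar_exp l')%N else 0%N.

Lemma bar_expE (A : nat -> lmodType K) (l : seq (gelt A)) :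
  (\sum_(1 <= j < (size l).+1) (size l - j) * nth 0 (map tag l) j.-1)%N = bar_exp l.
Proof.
rewrite big_add1 /=; elim: l => [|a l IH] /=; first by rewrite big_nil.
rewrite big_nat_recl //= subSS subn0 mulnC -IH; congr (_ + _)%N.
Qed.

Lemma bar_exp_cat (A : nat -> lmodType K) (l1 l2 : seq (gelt A)) :
  bar_exp (l1 ++ l2) = (bar_exp l1 + gdeg l1 * size l2 + bar_exp l2)%N.
Proof.
elim: l1 => [|a l IH] /=; first by rewrite gdeg_nil.
by rewrite IH gdeg_cons size_cat mulnDr mulnDl; lia.
Qed.

Section Defs.
Variables (A B : nat -> lmodType K).
Implicit Type f : gmap A B.

(** The sign of [bar] without its global minus. It is an involution, used in both directions. The
    free value on the empty word is set to 0, because [coder] also contracts empty factors. *)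
Definition twist f : gmap A B := fun e l =>
  if l is [::] then 0 else (-1) ^+ bar_exp l *: f e l.

Lemma twist_lin f : multilinear f -> multilinear (twist f).
Proof.
move=> fl e l r i a x y.
have E w : twist f e (l ++ w :: r) = (-1) ^+ bar_exp (l ++ w :: r) *: f e (l ++ w :: r).
  by case: l.
have be (x' y' : A i) : bar_exp (l ++ Tagged A x' :: r) = bar_exp (l ++ Tagged A y' :: r).
  by rewrite !bar_exp_cat.
by rewrite !E fl scalerDr !scalerA mulrC (be _ x) (be y x).
Qed.

Lemma twist_deg k f : of_degree k f -> of_degree k (twist f).
Proof. by move=> fd e [|a l] ne //; rewrite /twist fd ?scaler0. Qed.

Lemma twistK f : (forall e, f e [::] = 0) -> twist (twist f) = f.
Proof.
move=> f0; apply: functional_extensionality_dep => e; apply/funext => -[|a l] /=.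
  by rewrite f0.
by rewrite /twist scalerA -expr2 sqrr_sign scale1r.
Qed.

End Defs.

Lemma gval_twist_lin (A B : nat -> lmodType K) k (f : gmap A B) l : (0 < size l)%N ->
  gval k (twist f) l = Tagged B ((-1) ^+ bar_exp l *: tagged (gval k f l)).
Proof. by case: l. Qed.

Section Stasheff.
Variables (A B : nat -> lmodType K) (g : gmap A B) (m : gmap A A).
Hypotheses (g_lin : multilinear g) (m_lin : multilinear m) (m_deg : of_degree 2 m).

(** The pairs (r, s) are the factorisations of the word into three parts; those with an empty middle
    part are absent on the left and vanish on the right. *)
Lemma stasheff_twist e l :
  stasheff_sum g m e l = (-1) ^+ bar_exp l *:
    coder (gval 2 (twist m)) (@ssgn K A) (twist g e) l.
Proof.
have tg : slot_linear (twist g e) by exact: twist_lin.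
have nil0 u w : twist g e (u ++ gval 2 (twist m) [::] :: w) = 0 by exact: slot_linear0.
rewrite /stasheff_sum /coder splitsE big_nat_recr //= take_size drop_size splits_nil.
rewrite nil0 scaler0 addr0 scaler_sumr; apply: eq_big_nat => r /andP [_ rn].
rewrite splitsE size_drop [in RHS]big_ltn // take0 drop0 nil0 add0r !scaler_sumr.
apply: eq_big_nat => s /andP [s1 sn].
have smid : size (take s (drop r l)) = s by rewrite size_takel // size_drop.
have srl : size (take r l) = r by rewrite size_takel // ltnW.
have lE : l = take r l ++ take s (drop r l) ++ drop s (drop r l) by rewrite !cat_take_drop.
have swl : (size l - r - s)%N = size (drop s (drop r l)) by rewrite !size_drop.
rewrite swl (_ : drop (r + s) l = drop s (drop r l)) {swl}; last by rewrite drop_drop addnC.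
move: (take r l) (take s (drop r l)) (drop s (drop r l)) lE smid srl => u v w lE sv su.
rewrite gval_twist_lin ?sv //.
rewrite (slot_linear_scale_slot _ _ _ _ tg).
have -> : twist g e (u ++ Tagged A (tagged (gval 2 m v)) :: w) =
    (-1) ^+ bar_exp (u ++ gval 2 m v :: w) *: g e (u ++ gval 2 m v :: w) by case: (u).
case: (leqP (size v) (gdeg v + 2)) => [le|lt]; last first.
  rewrite /gval (gval0 m_deg lt) !(slot_linear0 (g := g e)) ?scaler0 //; exact: g_lin.
rewrite !scalerA sgE -!exprD. congr (_ *: _); apply: exprN1_odd.
rewrite lE !bar_exp_cat /= -sv -su size_cat !oddD !oddM !oddD /= !oddB // !oddD.
(* Both exponents are polynomials in the parities of lengths, degrees and bar exponents; all values
   are tried. *)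
by case: (odd (size u)) (odd (size v)) (odd (size w)) (odd (gdeg u)) (odd (gdeg v))
  (odd (bar_exp u)) (odd (bar_exp v)) (odd (bar_exp w)) => [] [] [] [] [] [] [] [].
Qed.
End Stasheff.

Section Composition.
Variables (H C : nat -> lmodType K) (d : forall i, {linear C i -> C i.+1}).
Variable mu : forall i j, C i -> C j -> C (i + j)%N.
Hypothesis mu_linl : forall i j (y : C j), linear (fun x : C i => mu x y).
Hypothesis mu_linr : forall i j (x : C i), linear (@mu i j x).
Variable (f : gmap H C).
Local Notation dg := (dg_Ainf d mu).

Lemma dg_Ainf_other e l : (2 < size l)%N -> dg e l = 0.
Proof. by case: l => [|x [|y [|z l]]]. Qed.

(** The terms of [composition_sum] with [r] blocks. A dg algebra has no operation of arity above 2,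
    so only r = 1 and r = 2 count. *)
Definition block_sum e r (l : seq (gelt H)) : C e :=
  \sum_(i : r.-tuple 'I_(size l).+1 |
      all (leq 1) (map val i) && (sumn (map val i) == size l))
      let ii := map val i in
      let s := (\sum_(1 <= j < r) j * (nth 0 ii j.-1 - 1))%N in
      let koszul := (\sum_(j < r) (nth 0 ii j - 1) * gdeg (take (sumn (take j ii)) l))%N in
      (-1) ^+ (s + koszul) *: dg e [seq gval 1 f l' | l' <- reshape ii l].

Lemma block_sum_large e r l : (2 < r)%N -> block_sum e r l = 0.
Proof.
move=> r2; apply: big1 => i _; cbv zeta; rewrite dg_Ainf_other ?scaler0 //.
by rewrite size_map size_reshape size_map size_tuple.
Qed.

Lemma block_sum1 e l : (0 < size l)%N ->
  block_sum e 1 l = tproj e (Tagged C (d _ (tagged (gval 1 f l)))).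
Proof.
move=> l0; rewrite /block_sum (big_pred1 [tuple ord_max]) => [|i].
  rewrite big_ord_recl big_ord0 big_geq //= take0 gdeg_nil muln0 addn0 expr0 scale1r.
  by rewrite take_size.
case/tupleP: i => i i'; rewrite tuple0 /= addn0 andbT.
apply/andP/eqP => [[_ /eqP il]|/(congr1 val) [->]]; last by rewrite /= eqxx.
by apply/val_inj => /=; congr [:: _]; exact/val_inj.
Qed.

Lemma block_sum2 e l : block_sum e 2 l = - ((-1) ^+ bar_exp l *: quad mu (twist f) e l).
Proof.
rewrite /block_sum.
pose pr2 (k : 'I_(size l).+1) : 2.-tuple 'I_(size l).+1 := [tuple k; inord (size l - k)].
rewrite (reindex_onto pr2 (fun t => tnth t ord0)) => [|i]; last first.
  case/tupleP: i => i1 i; case/tupleP: i => i2 i; rewrite tuple0 /= addn0 => /andP [_ /eqP il].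
  apply/val_inj => /=; congr [:: _; _]; apply/val_inj => /=.
  rewrite /tnth /= inordK -?il ?addKn //; lia.
rewrite /quad splitsE big_mkord scaler_sumr -sumrN big_mkcond /=.
apply: eq_bigr => k _.
have ik : (inord (size l - k) : 'I_(size l).+1) = (size l - k)%N :> nat.
  by rewrite inordK // ltnS leq_subr.
rewrite ik addn0 subnKC ?eqxx ?andbT; last by rewrite -ltnS.
(* The cuts at both ends are no admissible compositions, since blocks are nonempty; in [quad] they
   vanish because [twist f] is 0 on the empty word. *)
have [k0|k0] := posnP k.
  rewrite [in RHS](_ : twist f (gdeg (take k l) + 1 - size (take k l))%N (take k l) = 0).
    by rewrite (mu0l mu_linl) tproj0 !scaler0 oppr0.
  by rewrite k0 take0.
have [nk|nk] := posnP (size l - k)%N.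
  rewrite [in RHS](_ : twist f (gdeg (drop k l) + 1 - size (drop k l))%N (drop k l) = 0).
    by rewrite (mu0r mu_linr) tproj0 !scaler0 oppr0.
  by rewrite drop_oversize // -subn_eq0 nk.
have kn : (k < size l)%N by rewrite -subn_gt0.
rewrite /= big_nat1 mul1n /= !big_ord_recl big_ord0 /= take0 gdeg_nil muln0 add0n !addn0.
have sv : size (drop k l) = (size l - k)%N by rewrite size_drop.
have su : size (take k l) = k by rewrite size_takel // ltnW.
rewrite [take _ (drop k l)]take_oversize ?sv //.
have tE w e' : (0 < size w)%N -> twist f e' w = (-1) ^+ bar_exp w *: f e' w by case: w.
rewrite !tE ?sv ?su //.
have -> (a c : K) i j (x : C i) (y : C j) : mu (a *: x) (c *: y) = (a * c) *: mu x y.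
  have := @mu_linl _ _ (c *: y) a x 0; rewrite /= (mu0l mu_linl) !addr0 => ->.
  have := @mu_linr _ _ x c y 0; rewrite /= (mu0r mu_linr) !addr0 => ->.
  by rewrite scalerA.
rewrite -[tagged_as _ _]/(tproj e (Tagged C (mu _ _))).
have tZ (a : K) i (x : C i) : tproj e (Tagged C (a *: x)) = a *: tproj e (Tagged C x).
  by have := @tproj_linear _ C e i a x 0; rewrite /= tproj0 !addr0.
rewrite tZ !scalerA -scaleNr; congr (_ *: _).
rewrite sgE -!exprD -[RHS]mulN1r -exprS; apply: exprN1_odd.
have -> : bar_exp l = bar_exp (take k l ++ drop k l) by rewrite cat_take_drop.
rewrite bar_exp_cat sv su; move: k0 nk.
move: (nat_of_ord k) (gdeg _) (bar_exp _) (bar_exp _) (size l - _)%N => i g b1 b2 m.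
case: i m => [//|i] [//|m] _ _; rewrite !subn1 /= !oddD !oddM /=.
by case: (odd i) (odd m) (odd g) (odd b1) (odd b2) => [] [] [] [] [].
Qed.

Lemma composition_twist e l : (0 < size l)%N ->
  composition_sum dg f e l = (-1) ^+ bar_exp l *:
    (tproj e (Tagged C (d _ (tagged (gval 1 (twist f) l)))) - quad mu (twist f) e l).
Proof.
move=> l0; rewrite scalerBr -block_sum2.
have -> : (-1) ^+ bar_exp l *: tproj e (Tagged C (d _ (tagged (gval 1 (twist f) l)))) = block_sum e 1 l.
  rewrite block_sum1 // gval_twist_lin // /= linearZ /=.
  have tZ (a : K) i (x : C i) : tproj e (Tagged C (a *: x)) = a *: tproj e (Tagged C x).
    by have := @tproj_linear _ C e i a x 0; rewrite /= tproj0 !addr0.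
  by rewrite tZ scalerA -expr2 sqrr_sign scale1r.
rewrite -[LHS]/(\sum_(1 <= r < (size l).+1) block_sum e r l).
rewrite big_ltn // ; congr (_ + _).
case: (leqP (size l) 1) => [l1|l1].
  rewrite big_geq //; symmetry; apply: big1 => i /andP [].
  case/tupleP: i => i1 i; case/tupleP: i => i2 i; rewrite tuple0 /= addn0 => /and3P [i10 i20 _] /eqP.
  lia.
rewrite big_ltn // big_nat big1 ?addr0 // => r /andP [r3 _].
exact: block_sum_large.
Qed.

End Composition.
End Twist.

(** * Group cochains as Hochschild cochains *)

Section ListCochains.
Variables (K : fieldType) (G : groupType) (d : nat) (rho : G -> 'M[K]_d).
Hypothesis rhoM : forall g h, rho (g * h)%g = rho g *m rho h.
Local Notation M := 'M[K]_d.
(** All degrees in a single type: products of cochains need no transport between the types of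
    degrees [i + j] and [k]. *)
Definition list_cochain := seq G -> M.
HB.instance Definition _ := GRing.Lmodule.copy list_cochain (seq G -> M).
Local Notation X := list_cochain.
Implicit Types (x y : X) (l : seq G).

Definition xcup x y : X := splits (fun a b => x a *m y b).

Definition xsgn x : X := fun l => (-1) ^+ size l *: x l.

Definition xmul (g : G) x : X := fun l => if l is h :: l' then x (g * h :: l')%g else 0.

(** The alternating sum of the middle faces: either the first entry is merged with the second or it
    is kept. [xcontrE] is the closed form. *)
Fixpoint xcontr_rec (l : seq G) x : M :=
  if l is g :: l' then - xmul g x l' - xcontr_rec l' (fun w => x (g :: w)) else 0.
Definition xcontr x : X := fun l => xcontr_rec l x.

Definition xrho : X := fun l => if l is [:: g] then rho g else 0.

(* The twist c(g_1, ..., g_n) rho(g_1 ... g_n) turns inhomogeneous cochains into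
   Hochschild cochains; [xd] is the Hochschild differential. *)
Definition xd x : X := fun l => xcup xrho x l - xcup (xsgn x) xrho l + xcontr x l.

Lemma xcontr_cons x g l : xcontr x (g :: l) = - xmul g x l - xcontr (fun w => x (g :: w)) l.
Proof. by []. Qed.

Lemma xcup_cons x y g l :
  xcup x y (g :: l) = x [::] *m y (g :: l) + xcup (fun w => x (g :: w)) y l.
Proof. by []. Qed.

Lemma xcupl y : linear (xcup^~ y).
Proof.
move=> a x x'; apply/funext => l; change (xcup (a *: x + x') y l = a *: xcup x y l + xcup x' y l).
rewrite /xcup -splitsZ -splitsD; apply: eq_splits => l1 l2 _.
by change ((a *: x l1 + x' l1) *m y l2 = a *: (x l1 *m y l2) + x' l1 *m y l2);
  rewrite mulmxDl scalemxAl.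
Qed.

Lemma xcupr x : linear (xcup x).
Proof.
move=> a y y'; apply/funext => l; change (xcup x (a *: y + y') l = a *: xcup x y l + xcup x y' l).
rewrite /xcup -splitsZ -splitsD; apply: eq_splits => l1 l2 _.
by change (x l1 *m (a *: y l2 + y' l2) = a *: (x l1 *m y l2) + x l1 *m y' l2);
  rewrite mulmxDr scalemxAr.
Qed.

Lemma xcupA : associative xcup.
Proof.
move=> x y z; apply/funext => l; rewrite /xcup.
transitivity (splits (fun l1 l23 => splits (fun l2 l3 => x l1 *m y l2 *m z l3) l23) l).
  apply: eq_splits => l1 l2 _; rewrite (raddf_splits (mulmx (x l1))).
  by apply: eq_splits => u v _; rewrite /= mulmxA.
rewrite (splits_coassoc (fun l1 l2 l3 => x l1 *m y l2 *m z l3)).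
by apply: eq_splits => l1 l2 _; rewrite -(raddf_splits (mulmxr (z l2))).
Qed.

Lemma xcontr_linear : linear xcontr.
Proof.
move=> a x y; apply/funext => l; change (xcontr (a *: x + y) l = a *: xcontr x l + xcontr y l).
elim: l x y => [|g l IH] x y; first by rewrite /xcontr /= scaler0 addr0.
rewrite !xcontr_cons (IH (fun w => x (g :: w)) (fun w => y (g :: w))).
have -> : xmul g (a *: x + y) l = a *: xmul g x l + xmul g y l.
  by case: l {IH} => [|h l] //=; rewrite scaler0 addr0.
by rewrite scalerBr scalerN; abel.
Qed.

Lemma eq_xcontr x y l : x =1 y -> xcontr x l = xcontr y l.
Proof. by move=> /funext ->. Qed.

Lemma xsgn_cup x y l : xsgn (xcup x y) l = xcup (xsgn x) (xsgn y) l.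
Proof.
rewrite /xsgn /xcup -splitsZ; apply: eq_splits => l1 l2 ->.
by rewrite -scalemxAl -scalemxAr scalerA size_cat exprD.
Qed.

Lemma xsgnK x l : xsgn (xsgn x) l = x l.
Proof. by rewrite /xsgn scalerA -expr2 sqrr_sign scale1r. Qed.

Lemma raddf_xcontr (f : {additive M -> M}) x l : xcontr (fun w => f (x w)) l = f (xcontr x l).
Proof.
elim: l x => [|g l IH] x; first by rewrite /xcontr /= raddf0.
rewrite !xcontr_cons (IH (fun w => x (g :: w))) raddfB raddfN; congr (- _ - _).
by case: l {IH} => [|h l]; rewrite /= ?raddf0.
Qed.

Lemma xcontr0 x l : (forall w, x w = 0) -> xcontr x l = 0.
Proof.
by move=> x0; rewrite -[RHS](raddf_xcontr \0 x l); apply: eq_xcontr => w; rewrite x0.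
Qed.

Lemma xcontrD x y l : xcontr (fun w => x w + y w) l = xcontr x l + xcontr y l.
Proof.
have := xcontr_linear 1 x y; rewrite scale1r => /(congr1 (@^~ l)) ->.
by change (1 *: xcontr x l + xcontr y l = xcontr x l + xcontr y l); rewrite scale1r.
Qed.

Lemma xcontrN x l : xcontr (fun w => - x w) l = - xcontr x l.
Proof. exact: (raddf_xcontr -%R). Qed.

Lemma xcontr_sgn x l : xcontr (xsgn x) l = - xsgn (xcontr x) l.
Proof.
elim: l x => [|g l IH] x; first by rewrite /xsgn /xcontr /= scaler0 oppr0.
rewrite /xsgn !xcontr_cons.
have -> : xcontr (fun w => xsgn x (g :: w)) l = xsgn (xcontr (fun w => x (g :: w))) l.
  rewrite -[RHS]opprK -IH -xcontrN; apply: eq_xcontr => w.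
  by rewrite /xsgn /= exprS mulN1r scaleNr.
have -> : xmul g (fun w => (-1) ^+ size w *: x w) l = (-1) ^+ size l *: xmul g x l.
  by case: l {IH} => [|h l] /=; rewrite ?scaler0.
by rewrite /xsgn /= exprS mulN1r scaleNr opprK scalerBr scalerN.
Qed.

(** A cut of a contracted list leaves the merged entry on one side, so contraction is a graded
    derivation; [xsgn] is the sign of passing the entries on the left. *)
Lemma xcontr_cup x y l :
  xcontr (xcup x y) l = xcup (xcontr x) y l + xcup (xsgn x) (xcontr y) l.
Proof.
elim: l x y => [|g l IH] x y.
  by rewrite /xcup !splits_nil /xcontr /= mul0mx mulmx0 addr0.
rewrite xcontr_cons !xcup_cons.
have -> : xcontr (fun w => xcup x y (g :: w)) l = x [::] *m xcontr (fun w => y (g :: w)) l +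
    (xcup (xcontr (fun w => x (g :: w))) y l + xcup (xsgn (fun w => x (g :: w))) (xcontr y) l).
  rewrite -(raddf_xcontr (mulmx (x [::]))) -IH.
  by rewrite -(xcontrD (fun w => x [::] *m y (g :: w))); exact: eq_xcontr.
have -> : xmul g (xcup x y) l = xcup (xmul g x) y l + x [::] *m xmul g y l.
  case: l {IH} => [|h l]; first by rewrite /xcup splits_nil /= mul0mx mulmx0 addr0.
  by rewrite /= !xcup_cons /= mul0mx add0r addrC.
rewrite [xcontr x [::]](_ : _ = 0) // mul0mx add0r (xcontr_cons y).
have -> : xcup (fun w => xcontr x (g :: w)) y l =
    - xcup (xmul g x) y l - xcup (xcontr (fun w => x (g :: w))) y l.
  rewrite /xcup -!splitsN -splitsD; apply: eq_splits => l1 l2 _.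
  by rewrite xcontr_cons mulmxBl mulNmx.
have -> : xcup (fun w => xsgn x (g :: w)) (xcontr y) l = - xcup (xsgn (fun w => x (g :: w))) (xcontr y) l.
  rewrite /xcup -!splitsN; apply: eq_splits => l1 l2 _.
  by rewrite /xsgn /= exprS mulN1r scaleNr mulNmx.
rewrite {2}/xsgn expr0 scale1r mulmxBr mulmxN.
abel.
Qed.

Lemma xcontr_contr x l : xcontr (xcontr x) l = 0.
Proof.
elim: l x => [//|g l IH] x; rewrite xcontr_cons.
have -> : xcontr (fun w => xcontr x (g :: w)) l =
    - xcontr (xmul g x) l - xcontr (xcontr (fun w => x (g :: w))) l.
  rewrite -!xcontrN -xcontrD; apply: eq_xcontr => w.
  by rewrite xcontr_cons.
rewrite IH subr0 opprK addrC; apply/eqP; rewrite subr_eq0; apply/eqP.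
case: l {IH} => [//|h l]; rewrite -[RHS]/(xcontr x (g * h :: l)%g) !xcontr_cons; congr (- _ - _).
by case: l => [//|k l]; rewrite /= mulgA.
Qed.

(** Multiplicativity of [rho] is the Maurer-Cartan equation of [xrho] for the differential [xcontr].
    As [xd] is [xcontr] plus the graded commutator with [xrho], this is why it squares to 0. *)
Lemma xcontr_rho l : xcontr xrho l = - xcup xrho xrho l.
Proof.
case: l => [|g [|h l]].
- by rewrite /xcup splits_nil mul0mx oppr0.
- by rewrite /xcup splits_cons splits_nil /xcontr /= mul0mx mulmx0 !addr0 !oppr0 addr0.
- rewrite xcontr_cons !xcup_cons [xrho [::]](_ : _ = 0) // mul0mx add0r.
  have -> : xcontr (fun w => xrho (g :: w)) (h :: l) = 0.
    rewrite xcontr_cons; case: l => [|k l]; first by rewrite /xcontr /= !oppr0 addr0.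
    by rewrite [xmul _ _ _]/= oppr0 sub0r xcontr0 ?oppr0.
  rewrite subr0 [xcup (fun w => _) _ l](_ : _ = 0) ?addr0; last first.
    by rewrite /xcup splits0 // => l1 l2 _; rewrite mul0mx.
  by case: l => [|k l]; rewrite /= ?rhoM // mulmx0.
Qed.

Lemma xd_linear : linear xd.
Proof.
move=> a x y; apply/funext => l.
change (xd (a *: x + y) l = a *: xd x l + xd y l).
have e1 := congr1 (@^~ l) (xcupr xrho a x y); have e3 := congr1 (@^~ l) (xcontr_linear a x y).
have e2 := congr1 (@^~ l) (xcupl xrho a (xsgn x) (xsgn y)).
rewrite /xd e1 e3.
have -> : xsgn (a *: x + y) = a *: xsgn x + xsgn y.
  apply/funext => w; change ((-1) ^+ size w *: (a *: x w + y w) = a *: ((-1) ^+ size w *: x w) + (-1) ^+ size w *: y w).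
  by rewrite scalerDr !scalerA mulrC.
rewrite e2.
change (a *: xcup xrho x l + xcup xrho y l - (a *: xcup (xsgn x) xrho l + xcup (xsgn y) xrho l) +
  (a *: xcontr x l + xcontr y l) = a *: xd x l + xd y l).
by rewrite /xd scalerDr scalerBr; abel.
Qed.
HB.instance Definition _ := GRing.isLinear.Build K X X _ xd xd_linear.

Lemma xcup_funD x x' y l : xcup (fun w => x w + x' w) y l = xcup x y l + xcup x' y l.
Proof. by rewrite /xcup -splitsD; apply: eq_splits => l1 l2 _; rewrite mulmxDl. Qed.
Lemma xcup_funDr x y y' l : xcup x (fun w => y w + y' w) l = xcup x y l + xcup x y' l.
Proof. by rewrite /xcup -splitsD; apply: eq_splits => l1 l2 _; rewrite mulmxDr. Qed.
Lemma xcup_funN x y l : xcup (fun w => - x w) y l = - xcup x y l.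
Proof. by rewrite /xcup -splitsN; apply: eq_splits => l1 l2 _; rewrite mulNmx. Qed.
Lemma xcup_funNr x y l : xcup x (fun w => - y w) l = - xcup x y l.
Proof. by rewrite /xcup -splitsN; apply: eq_splits => l1 l2 _; rewrite mulmxN. Qed.
Lemma eq_xcup x x' y y' l : x =1 x' -> y =1 y' -> xcup x y l = xcup x' y' l.
Proof. by move=> /funext -> /funext ->. Qed.

Lemma xsgn_rho l : xsgn xrho l = - xrho l.
Proof. by case: l => [|g [|h l]]; rewrite /xsgn /= ?scaler0 ?oppr0 ?expr1 ?scaleN1r. Qed.

Lemma xd_Leibniz x y l : xd (xcup x y) l = xcup (xd x) y l + xcup (xsgn x) (xd y) l.
Proof.
have A a b c : xcup (xcup a b) c l = xcup a (xcup b c) l by rewrite xcupA.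
have -> : xcup (xd x) y l =
    xcup xrho (xcup x y) l - xcup (xsgn x) (xcup xrho y) l + xcup (xcontr x) y l.
  by rewrite -!A -xcup_funN -!xcup_funD.
have -> : xcup (xsgn x) (xd y) l =
    xcup (xsgn x) (xcup xrho y) l - xcup (xsgn x) (xcup (xsgn y) xrho) l + xcup (xsgn x) (xcontr y) l.
  by rewrite -xcup_funNr -!xcup_funDr.
rewrite /xd xcontr_cup (eq_xcup (y' := xrho) _ (xsgn_cup x y)) // A.
abel.
Qed.

Lemma xd_d x l : xd (xd x) l = 0.
Proof.
have A a b c : xcup (xcup a b) c l = xcup a (xcup b c) l by rewrite xcupA.
have sD : xsgn (xd x) =1 fun w => - xcup xrho (xsgn x) w + xcup x xrho w + xsgn (xcontr x) w.
  move=> w; rewrite /xd /xsgn scalerDr scalerBr -!/(xsgn _ w) !xsgn_cup.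
  rewrite (eq_xcup _ xsgn_rho (fun=> erefl)) (eq_xcup _ (xsgnK x) xsgn_rho).
  by rewrite xcup_funN xcup_funNr opprK.
rewrite {1}/xd.
have -> : xcup xrho (xd x) l =
    xcup xrho (xcup xrho x) l - xcup xrho (xcup (xsgn x) xrho) l + xcup xrho (xcontr x) l.
  by rewrite -xcup_funNr -!xcup_funDr.
rewrite (eq_xcup _ sD (fun=> erefl)) !xcup_funD xcup_funN !A.
have -> : xcontr (xd x) l = - xcup xrho (xcup xrho x) l - xcup xrho (xcontr x) l
    + xcup (xsgn (xcontr x)) xrho l + xcup x (xcup xrho xrho) l.
  rewrite /xd xcontrD xcontr_contr addr0 xcontrD xcontrN !xcontr_cup.
  rewrite (eq_xcup _ xcontr_rho (fun=> erefl)) (eq_xcup _ xsgn_rho (fun=> erefl)).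
  rewrite (eq_xcup _ (xcontr_sgn x) (fun=> erefl)) (eq_xcup _ (xsgnK x) xcontr_rho).
  rewrite !xcup_funN xcup_funNr !A; abel.
abel.
Qed.

End ListCochains.

(** * Inhomogeneous cochains inside Hochschild cochains *)

Section Embedding.
Variables (G : topGroupType) (F : fieldType) (d : nat) (rho : contRep G F d).
Local Notation C := (cochain G F d).
Local Notation X := (list_cochain F G d).
Local Notation tuple_of n l := ((fun i : 'I_n => nth 1%g l i) : {ptws 'I_n -> G}).

Lemma rhoV g : rho g *m rho (g^-1)%g = 1%:M.
Proof. by rewrite -repM mulgV rep1. Qed.
Lemma rhoVl g : rho (g^-1)%g *m rho g = 1%:M.
Proof. by rewrite -repM mulVg rep1. Qed.

Definition emb n (c : C n) : X := fun l =>
  if size l == n then c (tuple_of n l) *m rho (\prod_(g <- l) g)%g else 0.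

Lemma emb_linear n : linear (@emb n).
Proof.
move=> a x y; apply/funext => l.
change (emb (a *: x + y) l = a *: emb x l + emb y l); rewrite /emb.
case: ifP => _; last by rewrite scaler0 addr0.
change ((a *: x (tuple_of n l) + y (tuple_of n l)) *m rho (\prod_(g <- l) g)%g =
  a *: (x (tuple_of n l) *m rho (\prod_(g <- l) g)%g) + y (tuple_of n l) *m rho (\prod_(g <- l) g)%g).
by rewrite mulmxDl scalemxAl.
Qed.
HB.instance Definition _ n := GRing.isLinear.Build F (C n) X _ (@emb n) (@emb_linear n).

Lemma emb_size n (c : C n) l : size l <> n -> emb c l = 0.
Proof. by move=> /eqP/negbTE; rewrite /emb => ->. Qed.

Lemma emb_inj n : injective (@emb n).
Proof.
move=> x y exy; apply/val_inj/funext => g.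
have : emb x [seq g i | i <- enum 'I_n] = emb y [seq g i | i <- enum 'I_n] by rewrite exy.
rewrite /emb size_map size_enum_ord eqxx.
have -> : tuple_of n [seq g i | i <- enum 'I_n] = g.
  by apply/funext => i; rewrite (nth_map i) ?size_enum_ord // nth_ord_enum.
move=> /(congr1 (mulmx^~ (rho (\prod_(g <- [seq g i | i <- enum 'I_n]) g)^-1)%g)).
by rewrite -!mulmxA rhoV !mulmx1.
Qed.

(** The inverse factor of the adjoint action cancels the [rho] gained by the first block. *)
Lemma emb_cup i j (b : C i) (c : C j) : emb (cup rho b c) = xcup (emb b) (emb c).
Proof.
apply/funext => l; rewrite /xcup splitsE big_mkord.
have [sl|sl] := eqVneq (size l) (i + j)%N; last first.
  rewrite emb_size; last exact/eqP.
  rewrite big1 // => k _; have [sk|sk] := eqVneq (size (take k l)) i; last first.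
    by rewrite emb_size ?mul0mx //; apply/eqP.
  rewrite [emb c _]emb_size ?mulmx0 // => sk'; case/eqP: sl.
  by rewrite -sk -sk' -size_cat cat_take_drop.
have il : (i < (size l).+1)%N by rewrite sl ltnS leq_addr.
rewrite (bigD1 (Ordinal il)) //= big1 ?addr0 => [|k ki]; last first.
  rewrite emb_size ?mul0mx // size_takel; last by rewrite -ltnS.
  by move=> e; case/eqP: ki; apply/val_inj.
have st : size (take i l) = i by rewrite size_takel // sl leq_addr.
rewrite /emb sl eqxx st eqxx size_drop sl addKn eqxx /=.
rewrite /cupfun /adj.
rewrite -[in LHS](cat_take_drop i l) big_cat /= repM.
have -> : (\prod_(k < i) nth 1 (take i l ++ drop i l) (lshift j k) = \prod_(g <- take i l) g)%g.
  rewrite [RHS](big_nth 1%g) st big_mkord; apply: eq_bigr => k _.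
  by rewrite nth_cat st /= ltn_ord.
rewrite -!mulmxA; congr (b _ *m _).
  by apply/funext => k; rewrite cat_take_drop nth_take.
rewrite (mulmxA (rho (_^-1)%g)) rhoVl mul1mx; congr (_ *m (c _ *m _)).
by apply/funext => k; rewrite cat_take_drop nth_drop.
Qed.

Definition list_contract i (l : seq G) :=
  take i l ++ (nth 1 l i * nth 1 l i.+1)%g :: drop i.+2 l.

Lemma xcontrE (x : X) l :
  xcontr x l = \sum_(i < (size l).-1) (-1) ^+ i.+1 *: x (list_contract i l).
Proof.
elim: l x => [|g [|h l] IH] x; first by rewrite big_ord0.
  by rewrite xcontr_cons /= big_ord0 /xcontr /= oppr0 addr0.
rewrite xcontr_cons IH [RHS]big_ord_recl /= expr1 scaleN1r.
rewrite /list_contract /= drop0; congr (_ + _).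
rewrite -sumrN; apply: eq_bigr => i _.
by rewrite /bump /= add1n add0n [in RHS]exprS mulN1r scaleNr.
Qed.

Lemma xcup_rhol (x : X) l :
  xcup (xrho rho) x l = if l is g :: l' then rho g *m x l' else 0.
Proof.
case: l => [|g l]; first by rewrite /xcup splits_nil mul0mx.
rewrite xcup_cons [xrho rho [::]](_ : _ = 0) // mul0mx add0r.
by rewrite /xcup splits_first // => *; rewrite mul0mx.
Qed.

Lemma xcup_rhor (x : X) l g : xcup x (xrho rho) (rcons l g) = x l *m rho g.
Proof.
elim: l x => [|h l IH] x.
  by rewrite xcup_cons /xcup splits_nil mulmx0 addr0.
by rewrite rcons_cons xcup_cons IH; case: l {IH} => [|k l]; rewrite /= mulmx0 add0r.
Qed.

Lemma prod_contract i l : (i.+1 < size l)%N ->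
  (\prod_(g <- list_contract i l) g = \prod_(g <- l) g)%g.
Proof.
move=> il; rewrite -[in RHS](cat_take_drop i l) !big_cat big_cons /=.
rewrite (drop_nth 1%g (ltnW il)) (drop_nth 1%g il).
by rewrite !big_cons /= !mulgA.
Qed.

Lemma size_contract i l : (i.+1 < size l)%N -> size (list_contract i l) = (size l).-1.
Proof. by move=> il; rewrite /list_contract size_cat /= size_drop size_takel; lia. Qed.

(** The twist turns the adjoint action of the first entry into left multiplication by [rho], and the
    face that forgets the last entry into right multiplication; the middle faces keep the product of
    the entries. *)
Lemma emb_d n (c : C n) : emb (dC rho n c) = xd rho (emb c).
Proof.
apply/funext => l; rewrite /xd.
case/lastP: l => [|l gn].
  rewrite /emb /= /xcontr /= addr0 xcup_rhol sub0r.
  by rewrite /xcup splits_nil mulmx0 oppr0.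
rewrite xcup_rhor xcontrE size_rcons /=.
have [sl|/eqP sl] := eqVneq (size l) n; last first.
  rewrite emb_size ?size_rcons; last by case.
  rewrite big1 ?addr0 => [|i _]; last first.
    by rewrite emb_size ?scaler0 // size_contract ?size_rcons // ltnS.
  rewrite /xsgn [emb c l]emb_size // scaler0 mul0mx subr0.
  rewrite xcup_rhol; case: l sl => [|g l] /= sl; first by rewrite emb_size ?mulmx0.
  by rewrite emb_size ?mulmx0 // size_rcons.
have -> : emb (dC rho n c) (rcons l gn) =
    dfun rho c (tuple_of n.+1 (rcons l gn)) *m rho (\prod_(g <- rcons l gn) g)%g.
  by rewrite /emb size_rcons sl eqxx.
rewrite /dfun !mulmxDl mulmx_suml addrAC; congr (_ + _).
  congr (_ + _).
    rewrite xcup_rhol.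
    have [g [l' lE]] : exists g l', rcons l gn = g :: l' by case: (l) => [|g l']; [exists gn, [::] | exists g, (rcons l' gn)].
    have sl' : size l' = n by have := congr1 size lE; rewrite size_rcons /= sl => -[].
    rewrite lE /emb sl' eqxx big_cons repM /adj /=.
    rewrite -!mulmxA (mulmxA (rho (_^-1)%g)) rhoVl mul1mx; congr (_ *m (c _ *m _)).
  rewrite /xsgn sl exprS mulN1r scaleNr mulNmx; congr (- _).
  rewrite -!scalemxAl; congr (_ *: _); rewrite /emb sl eqxx -mulmxA -repM.
  rewrite -cats1 big_cat big_seq1; congr (c _ *m _).
  apply/funext => i; rewrite /tup_init /= nth_cat sl ltn_ord.
  by apply: set_nth_default; rewrite sl.
rewrite sl; apply: eq_bigr => i _; rewrite -scalemxAl; congr (_ *: _).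
have il : (i.+1 < size (rcons l gn))%N by rewrite size_rcons sl ltnS.
rewrite /emb size_contract // size_rcons sl eqxx prod_contract //; congr (c _ *m _).
apply/funext => k; rewrite /tup_contract /tup_init /tup_tail /= /list_contract nth_cat.
rewrite size_takel; last by rewrite ltnW // ltnW.
case: ltnP => ki; first by rewrite nth_take.
have [->|kne] := eqVneq k i; first by rewrite subnn.
have {}ki : (i < k)%N by rewrite ltn_neqAle eq_sym ki andbT; apply: contra_neq kne => /val_inj.
rewrite -(subnKC ki) addSn -addnS addKn /= nth_drop.
by congr nth; rewrite /bump; lia.
Qed.

Lemma xsgn_emb n (c : C n) : xsgn (emb c) = (-1) ^+ n *: emb c.
Proof.
apply/funext => l; change ((-1) ^+ size l *: emb c l = (-1) ^+ n *: emb c l).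
by have [->//|/eqP sl] := eqVneq (size l) n; rewrite emb_size // !scaler0.
Qed.

End Embedding.

(** * Existence of minimal models *)

Section CohomologyProjection.
Variables (K : fieldType) (C : nat -> lmodType K) (dC : forall i, {linear C i -> C i.+1}).

Lemma pr_eq0 i (z : cocycle dC i) : pr z = 0 <-> coboundary dC (val z).
Proof.
rewrite -(raddf0 (@pr K C dC i)) /pr; split.
  by move/eqP; rewrite eqmodE /= Quotient.equivE subr0 => /asboolP.
by move=> cz; apply/eqP; rewrite eqmodE /= Quotient.equivE subr0; apply/asboolP.
Qed.

Lemma pr_surj i (x : coh dC i) : exists z, pr z = x.
Proof. by exists (repr x); rewrite /pr reprK. Qed.

Lemma cocycle0 i (z : cocycle dC i) : dC i (val z) = 0.
Proof. by apply/eqP; case: z. Qed.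

Definition mk_cocycle i (x : C i) (dx : dC i x = 0) : cocycle dC i :=
  Cocycle (introT eqP dx : x \in @cocycle_pred _ _ dC i).

Lemma coh_section i : exists s : {linear coh dC i -> cocycle dC i}, forall x, pr (s x) = x.
Proof.
have [s sP] := linear_quasi_inverse (@pr K C dC i); exists s => x.
by have [z <-] := pr_surj x; exact: sP.
Qed.

Lemma cocycle_retraction i : exists r : {linear C i -> cocycle dC i}, forall z, r (val z) = z.
Proof.
have [r rP] := linear_quasi_inverse (val : {linear cocycle dC i -> C i}); exists r => z.
exact/val_inj/rP.
Qed.

End CohomologyProjection.

Section Existence.
Variables (G : topGroupType) (F : fieldType) (d : nat) (rho : contRep G F d).
Local Notation C := (cochain G F d).
Local Notation Z := (cocycle (dC rho)).
Local Notation H := (coh (dC rho)).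
Local Notation X := (list_cochain F G d).

Let mu i j (x : C i) (y : C j) : C (i + j)%N := cup rho x y.

Lemma mu_emb i j (x : C i) (y : C j) : emb rho (mu x y) = xcup (emb rho x) (emb rho y).
Proof. exact: emb_cup. Qed.

Lemma mu_linearl i j (y : C j) : linear (fun x : C i => mu x y).
Proof.
move=> a x x'; apply: (@emb_inj _ _ _ rho); rewrite linearP /= !mu_emb linearP /=.
exact: xcupl.
Qed.

Lemma mu_linearr i j (x : C i) : linear (@mu i j x).
Proof.
move=> a y y'; apply: (@emb_inj _ _ _ rho); rewrite linearP /= !mu_emb linearP /=.
exact: xcupr.
Qed.

Lemma emb_Leibniz i (x : C i) y :
  xd rho (xcup (emb rho x) y) =
  xcup (xd rho (emb rho x)) y + (-1) ^+ i *: xcup (emb rho x) (xd rho y).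
Proof.
apply/funext => l; rewrite xd_Leibniz.
change (xcup (xd rho (emb rho x)) y l + xcup (xsgn (emb rho x)) (xd rho y) l =
  xcup (xd rho (emb rho x)) y l + (-1) ^+ i *: xcup (emb rho x) (xd rho y) l).
rewrite xsgn_emb; congr (_ + _).
have := xcupl (xd rho y) ((-1) ^+ i) (emb rho x) 0; rewrite addr0 => ->.
by rewrite (cup0l (@xcupl F G d)) addr0.
Qed.

(** A description free of the degree of the primitive, so that products of coboundaries need no
    cast. If [k.+1] differs from [e], the two sides are supported on lists of different lengths and
    vanish. *)
Lemma coboundaryP e (x : C e) :
  coboundary (dC rho) x <-> exists k (y : C k), emb rho x = emb rho (dC rho k y).
Proof.
split.
  case: e x => [|e] x /=; first by move=> ->; exists 0%N, 0; rewrite !linear0.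
  by move=> [y ->]; exists e, y.
move=> [k [y xy]]; have [ke|ne] := eqVneq k.+1 e.
  by case: _ / ke x xy => x xy; exists y; apply: emb_inj xy.
have -> : x = 0.
  apply: (@emb_inj _ _ _ rho); rewrite linear0; apply/funext => l.
  have [sl|/eqP sl] := eqVneq (size l) e; last by rewrite emb_size.
  rewrite xy emb_size // sl; exact/nesym/eqP.
by case: e {x xy ne} => [//|e]; exists 0; rewrite linear0.
Qed.

Lemma cup_cocycle i j (z : Z i) (w : Z j) : dC rho _ (cup rho (val z) (val w)) = 0.
Proof.
apply: (@emb_inj _ _ _ rho); rewrite emb_d emb_cup emb_Leibniz -!emb_d !cocycle0 !linear0.
by rewrite (cup0l (@xcupl F G d)) (cup0r (@xcupr F G d)) scaler0 addr0.
Qed.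

Lemma coboundaryD i (x y : C i) :
  coboundary (dC rho) x -> coboundary (dC rho) y -> coboundary (dC rho) (x + y).
Proof.
case: i x y => [|i] x y /=; first by move=> -> ->; rewrite addr0.
by move=> [u ->] [v ->]; exists (u + v); rewrite linearD.
Qed.

Lemma cup_coboundaryl i j (x : C i) (w : Z j) :
  coboundary (dC rho) x -> coboundary (dC rho) (cup rho x (val w)).
Proof.
move=> /coboundaryP [k [y xy]]; apply/coboundaryP; exists (k + j)%N, (cup rho y (val w)).
rewrite emb_d !emb_cup emb_Leibniz -!emb_d -xy cocycle0 linear0.
by rewrite (cup0r (@xcupr F G d)) scaler0 addr0.
Qed.

Lemma cup_coboundaryr i j (z : Z i) (y : C j) :
  coboundary (dC rho) y -> coboundary (dC rho) (cup rho (val z) y).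
Proof.
move=> /coboundaryP [k [u yu]]; apply/coboundaryP.
exists (i + k)%N, ((-1) ^+ i *: cup rho (val z) u).
rewrite !linearZ /= emb_d !emb_cup emb_Leibniz -!emb_d -yu cocycle0 linear0.
by rewrite (cup0l (@xcupl F G d)) add0r scalerA -expr2 sqrr_sign scale1r.
Qed.

Theorem Ainf_model_exists : exists (m : gmap H H) (f : gmap H C), Ainf_model m f.
Proof.
pose s e := sval (cid (coh_section (dC rho) e)).
have sP e (x : H e) : pr (s e x) = x by rewrite /s; case: cid.
pose r e := sval (cid (cocycle_retraction (dC rho) e)).
have rP e (z : Z e) : r e (val z) = z by rewrite /r; case: cid.
pose hh e := sval (cid (linear_quasi_inverse (dC rho e))).
have hP e (x : C e) : dC rho e (hh e (dC rho e x)) = dC rho e x by rewrite /hh; case: cid.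
(* The transfer needs [q] on all cochains; it is the class of the retraction, and only its values on
   cocycles are canonical. *)
pose q e : {linear C e -> H e} := @pr _ _ (dC rho) e \o r e.
pose sigma e : {linear H e -> C e} := val \o s e.
have q_cocycle e (x : C e) (dx : dC rho e x = 0) : q e x = pr (mk_cocycle dx).
  by rewrite /q /= -{1}[x]/(val (mk_cocycle dx)) rP.
have sigma_q e (x : C e) (dx : dC rho e x = 0) : coboundary (dC rho) (sigma e (q e x) - x).
  rewrite (q_cocycle _ _ dx) -[X in coboundary _ X]/(val (s e (pr (mk_cocycle dx)) - mk_cocycle dx)).
  by apply/pr_eq0; rewrite linearB /= sP subrr.
have d_sigma e (x : H e) : dC rho e (sigma e x) = 0 by exact: cocycle0.
have q_sigma e (x : H e) : q e (sigma e x) = x by rewrite /q /sigma /= rP sP.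
have q_d e (y : C e) : q e.+1 (dC rho e y) = 0.
  have dd : dC rho e.+1 (dC rho e y) = 0.
    apply: (@emb_inj _ _ _ rho); rewrite !emb_d linear0; apply/funext => l.
    by rewrite xd_d //; exact: repM.
  by rewrite (q_cocycle _ _ dd); apply/pr_eq0; exists y.
have d_h e (x : C e.+1) : dC rho _ x = 0 ->
    dC rho e (hh e (sigma _ (q _ x) - x)) = sigma _ (q _ x) - x.
  by move=> /sigma_q [y ->]; exact: hP.
have sigma_q0 (x : C 0) : dC rho 0 x = 0 -> sigma 0 (q 0 x) = x.
  by move=> /sigma_q /= /subr0_eq.
have emb_DD (x : X) : xd rho (xd rho x) = 0.
  by apply/funext => l; rewrite xd_d //; exact: repM.
have [b [F' [[bl bd Fl Fd] [b_small F_small b_two bR FR]]]] :=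
  @transfer F C H (dC rho) mu (@mu_linearl) (@mu_linearr) X (xd rho) (@xcup _ _ _)
    (fun e => @emb _ _ _ rho e) (@emb_inj _ _ _ rho) (@emb_d _ _ _ rho) (@emb_cup _ _ _ rho)
    emb_DD (@xcupl _ _ _) (@xcupr _ _ _) (@xcupA _ _ _) emb_Leibniz q sigma hh
    d_sigma q_sigma q_d d_h sigma_q0.
have bK : twist (twist b) = b by apply: twistK => e; exact: b_small.
have FK : twist (twist F') = F' by apply: twistK => e; case: (F_small e).
exists (twist b), (twist F').
have m1 i (x : H i) k : op1 (twist b) k x = 0.
  by rewrite /op1 /twist b_small // scaler0.
have f1 i (x : H i) k : op1 (twist F') k x = tproj k (Tagged C (sigma i x)).
  by rewrite /op1 /twist /= muln0 expr0 scale1r; have [_ ->] := F_small k.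
have dg1 i k (u : C i) :
    op1 (dg_Ainf (dC rho) (cup rho)) k u = tproj k (Tagged C (dC rho i u)) by [].
split=> //.
- split; [exact: twist_lin | exact: twist_deg |] => e l l0.
  rewrite stasheff_twist; [|exact: twist_lin|exact: twist_deg].
  by rewrite bK bR scaler0.
- move=> i j z w; exists (mk_cocycle (cup_cocycle z w)) => //.
  rewrite /twist /= b_two linearZ /= scalerA muln1 muln0 !addn0 -expr2 sqrr_sign scale1r.
  have sc k (x : Z k) : coboundary (dC rho) (val (s k (pr x) - x)).
    by apply/pr_eq0; rewrite linearB /= sP subrr.
  rewrite -[LHS]/(q _ (cup rho (val (s i (pr z))) (val (s j (pr w))))).
  rewrite (q_cocycle _ _ (cup_cocycle (s i (pr z)) (s j (pr w)))).
  apply/eqP; rewrite -subr_eq0 -linearB; apply/eqP/pr_eq0.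
  have -> : val (mk_cocycle (cup_cocycle (s i (pr z)) (s j (pr w))) - mk_cocycle (cup_cocycle z w)) =
      cup rho (val (s i (pr z) - z)) (val (s j (pr w))) + cup rho (val z) (val (s j (pr w) - w)).
    apply: (@emb_inj _ _ _ rho); rewrite !linearB linearD /= !emb_cup !linearB /=.
    rewrite (cupBl (@xcupl F G d)) (cupBr (@xcupr F G d)).
    by abel.
  by apply: coboundaryD; [exact: cup_coboundaryl | exact: cup_coboundaryr].
- split.
  + split; [exact: twist_lin | exact: twist_deg |] => e l l0.
    rewrite stasheff_twist; [|exact: twist_lin|exact: twist_deg].
    rewrite (composition_twist _ (@mu_linearl) (@mu_linearr)) //.
    by rewrite bK FK FR.
  (* As m_1 = 0, injectivity on cohomology means x = 0; [q] reads x off its cocycle and kills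
     coboundaries. *)
  + move=> i x _ [k [y]]; rewrite f1 dg1 tproj_tag => xy.
    suff -> : x = 0 by exists i, 0; rewrite m1.
    rewrite -[x]q_sigma xy.
    have [ki|ki] := eqVneq k.+1 i; last by rewrite tproj_neq ?linear0 //=; apply/eqP.
    by case: _ / ki; rewrite tproj_tag q_d.
  + move=> i y; rewrite dg1 tproj_tag => dy.
    exists (q i y); first exact: m1.
    rewrite f1 tproj_tag; have := sigma_q _ _ dy.
    case: i y {dy} => [|i] y.
      by move=> /subr0_eq ->; rewrite subrr; exists 0%N, 0; rewrite dg1 linear0 tproj0.
    move=> [u uE]; exists i, (- u).
    by rewrite dg1 tproj_tag linearN -uE opprB.
- by move=> i x; exists (s i x); rewrite ?f1 ?tproj_tag.
Qed.
End Existence.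

(** * Evaluation of words *)

Section WordEvaluation.
Variables (A : comNzRingType) (h : nat).
Implicit Types (x : 'I_h -> A) (w : seq 'I_h).

Definition xprod x w : A := \prod_(i <- w) x i.

Lemma xprod_cons x i w : xprod x (i :: w) = x i * xprod x w.
Proof. exact: big_cons. Qed.

Section OneModule.
Variable M : lmodType A.
Implicit Types phi : seq 'I_h -> M.

(** The sum of [x_w *: phi w] over words of length less than [N] ([wevalE]), by recursion on the
    first letter so as to match [splits]. *)
Fixpoint weval x N phi : M :=
  if N is N'.+1 then phi [::] + \sum_i x i *: weval x N' (fun w => phi (i :: w)) else 0.

Lemma eq_weval x N phi phi' : phi =1 phi' -> weval x N phi = weval x N phi'.
Proof. by move=> /funext ->. Qed.

Lemma wevalD x N phi phi' :
  weval x N (fun w => phi w + phi' w) = weval x N phi + weval x N phi'.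
Proof.
elim: N phi phi' => [|N IH] phi phi' /=; first by rewrite addr0.
rewrite addrACA -big_split; congr (_ + _); apply: eq_bigr => i _.
by rewrite IH scalerDr.
Qed.

Lemma wevalZ x N c phi : weval x N (fun w => c *: phi w) = c *: weval x N phi.
Proof.
elim: N phi => [|N IH] phi /=; first by rewrite scaler0.
rewrite scalerDr scaler_sumr; congr (_ + _); apply: eq_bigr => i _.
by rewrite IH !scalerA mulrC.
Qed.

Lemma weval_sum x N (I : finType) (phi : I -> seq 'I_h -> M) :
  weval x N (fun w => \sum_j phi j w) = \sum_j weval x N (phi j).
Proof.
elim: N phi => [|N IH] phi /=; first by rewrite big1.
rewrite big_split /= exchange_big; congr (_ + _); apply: eq_bigr => i _.
by rewrite IH scaler_sumr.
Qed.

Lemma wevalE x N phi :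
  weval x N phi = \sum_(0 <= k < N) \sum_(w : k.-tuple 'I_h) xprod x w *: phi w.
Proof.
elim: N phi => [|N IH] phi; first by rewrite big_nil.
rewrite /= big_nat_recl //; congr (_ + _).
  rewrite (big_pred1 [tuple]) => [|w]; last by rewrite (tuple0 w) /= eqxx.
  by rewrite /xprod big_nil scale1r.
rewrite (eq_bigr (fun i => \sum_(0 <= k < N) \sum_(w : k.-tuple 'I_h)
   xprod x (i :: w) *: phi (i :: w))) => [|i _]; last first.
  rewrite IH scaler_sumr; apply: eq_bigr => k _; rewrite scaler_sumr.
  by apply: eq_bigr => w _; rewrite scalerA xprod_cons.
rewrite exchange_big /=; apply: eq_bigr => k _.
rewrite pair_big /= [RHS](reindex (fun p : 'I_h * k.-tuple 'I_h => cons_tuple p.1 p.2)) //=.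
exists (fun t => (thead t, behead_tuple t)) => [[i w] _|t _] /=.
  by congr pair; apply/val_inj.
by rewrite [RHS]tuple_eta; apply/val_inj.
Qed.

(** The scalar [c] stands for the letters already read, which makes the vanishing hypothesis pass
    through the induction. *)
Lemma weval_stable x c N N' phi : (N <= N')%N ->
  (forall w, size w = N -> c * xprod x w = 0) -> c *: weval x N' phi = c *: weval x N phi.
Proof.
elim: N N' c phi => [|N IH] [|N'] // c phi NN' c0.
  by have := c0 [::] erefl; rewrite /xprod big_nil mulr1 => ->; rewrite !scale0r.
rewrite /= !scalerDr; congr (_ + _); rewrite !scaler_sumr; apply: eq_bigr => i _.
rewrite !scalerA; apply: IH => // w wN.
by rewrite -mulrA -xprod_cons c0 //= wN.
Qed.

(** Evaluation turns concatenation into multiplication: pairs of words of total length at least [N]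
    contribute 0, so independent truncations of both factors do no harm. *)
Lemma weval_splits x c N (psi : seq 'I_h -> seq 'I_h -> M) :
  (forall w, size w = N -> c * xprod x w = 0) ->
  c *: weval x N (splits psi) = c *: weval x N (fun w1 => weval x N (psi w1)).
Proof.
elim: N c psi => [//|N IH] c psi c0.
rewrite [in LHS]/= splits_nil (eq_bigr (fun i => x i *: weval x N (fun w => psi [::] (i :: w)) +
    x i *: weval x N (splits (fun w1 => psi (i :: w1))))) => [|i _]; last first.
  by rewrite -scalerDr -wevalD; congr (_ *: _); apply: eq_weval.
rewrite big_split addrA -[psi [::] [::] + _]/(weval x N.+1 (psi [::])).
rewrite [in RHS]/= -[psi [::] [::] + _]/(weval x N.+1 (psi [::])) !scalerDr; congr (_ + _).
rewrite !scaler_sumr; apply: eq_bigr => i _; rewrite !scalerA.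
have c0' w : size w = N -> c * x i * xprod x w = 0.
  by move=> wN; rewrite -mulrA -xprod_cons c0 //= wN.
rewrite IH // -!wevalZ; apply: eq_weval => w1.
exact: (esym (weval_stable (psi (i :: w1)) (leqnSn N) c0')).
Qed.

End OneModule.

Lemma weval_mul x N (phi : seq 'I_h -> A) (M : lmodType A) (v : M) :
  weval x N (fun w => phi w *: v) = weval x N (phi : seq 'I_h -> A^o) *: v.
Proof.
elim: N phi => [|N IH] phi /=; first by rewrite scale0r.
rewrite scalerDl scaler_suml; congr (_ + _); apply: eq_bigr => i _.
by rewrite IH scalerA.
Qed.

End WordEvaluation.

Lemma weval_raddf (A B : comNzRingType) (h : nat) (psi : {rmorphism A -> B})
    (M : lmodType A) (N : lmodType B) (f : {additive M -> N}) (x : 'I_h -> A) n phi :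
  (forall a v, f (a *: v) = psi a *: f v) ->
  f (weval x n phi) = weval (fun i => psi (x i)) n (fun w => f (phi w)).
Proof.
move=> fZ; elim: n phi => [|n IH] phi /=; first exact: raddf0.
rewrite raddfD raddf_sum; congr (_ + _); apply: eq_bigr => i _.
by rewrite fZ IH.
Qed.

(** * Evaluation at congruent points *)

Section IdealMultiples.
Variables (A : comNzRingType) (M : lmodType A).
Implicit Types (J : set A) (v : M).

Definition ideal_mul J : set M :=
  [set v | exists s : seq (A * M), (forall u, u \in s -> J u.1) /\ v = \sum_(u <- s) u.1 *: u.2].

Lemma ideal_mul0 J : ideal_mul J 0.
Proof. by exists [::]; rewrite big_nil. Qed.

Lemma ideal_mulD J v v' : ideal_mul J v -> ideal_mul J v' -> ideal_mul J (v + v').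
Proof.
move=> [s [sP ->]] [t [tP ->]]; exists (s ++ t); split; last by rewrite big_cat.
by move=> u; rewrite mem_cat => /orP [/sP|/tP].
Qed.

Lemma ideal_mulZ J a v : is_ideal J -> ideal_mul J v -> ideal_mul J (a *: v).
Proof.
move=> [_ _ JM] [s [sP ->]]; exists [seq (a * u.1, u.2) | u <- s]; split.
  by move=> u /mapP [u' /sP Ju ->]; exact: JM.
by rewrite big_map scaler_sumr; apply: eq_bigr => u _; rewrite scalerA.
Qed.

Lemma ideal_mul_sum J (I : Type) (r : seq I) (F : I -> M) :
  (forall i, ideal_mul J (F i)) -> ideal_mul J (\sum_(i <- r) F i).
Proof.
move=> JF; elim: r => [|i r IH]; first by rewrite big_nil; exact: ideal_mul0.
by rewrite big_cons; apply: ideal_mulD.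
Qed.

Lemma ideal_mul_scale J a v : J a -> ideal_mul J (a *: v).
Proof. by move=> Ja; exists [:: (a, v)]; split=> [u|]; rewrite ?big_seq1 // inE => /eqP ->. Qed.

Lemma ideal_mul_mul J I J' a v : is_ideal J' -> (forall a b, I a -> J b -> J' (a * b)) ->
  I a -> ideal_mul J v -> ideal_mul J' (a *: v).
Proof.
move=> iJ' IJ Ia [s [sP ->]]; exists [seq (a * u.1, u.2) | u <- s]; split.
  by move=> u /mapP [u' /sP Ju ->]; exact: IJ.
by rewrite big_map scaler_sumr; apply: eq_bigr => u _; rewrite scalerA.
Qed.

Variables (h : nat) (x x' : 'I_h -> A) (m J J' : set A).
Hypotheses (im : is_ideal m) (iJ : is_ideal J) (iJ' : is_ideal J').
Hypothesis mJ : forall a b, m a -> J b -> J' (a * b).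
Hypotheses (mx : forall i, m (x i)) (mx' : forall i, m (x' i)) (Jx : forall i, J (x' i - x i)).

Lemma weval_head N phi : ideal_mul m (weval x N.+1 phi - phi [::]).
Proof.
by rewrite /= addrC addKr; apply: ideal_mul_sum => i; apply: ideal_mul_scale.
Qed.

Lemma weval_diff N phi : ideal_mul J (weval x' N phi - weval x N phi).
Proof.
elim: N phi => [|N IH] phi /=; first by rewrite subr0; exact: ideal_mul0.
rewrite opprD addrACA subrr add0r -sumrB; apply: ideal_mul_sum => i.
have -> : x' i *: weval x' N (fun w => phi (i :: w)) - x i *: weval x N (fun w => phi (i :: w)) =
   (x' i - x i) *: weval x' N (fun w => phi (i :: w)) +
   x i *: (weval x' N (fun w => phi (i :: w)) - weval x N (fun w => phi (i :: w))).
  by rewrite scalerBl scalerBr; abel.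
by apply: ideal_mulD; [apply: ideal_mul_scale | apply: ideal_mulZ].
Qed.

(** First-order Taylor expansion. In a word of length at least 2 the change of a letter, in J, is
    multiplied by another letter, in m, and falls into J'. The bound [N.+2] keeps the words of
    length 1 below the truncation. *)
Lemma weval_diff1 N phi :
  ideal_mul J' (weval x' N.+2 phi - weval x N.+2 phi - \sum_i (x' i - x i) *: phi [:: i]).
Proof.
rewrite [weval x' _ _]/= [weval x _ _]/= opprD addrACA subrr add0r -!sumrB.
apply: ideal_mul_sum => i.
have -> : x' i *: weval x' N.+1 (fun w => phi (i :: w)) - x i *: weval x N.+1 (fun w => phi (i :: w))
     - (x' i - x i) *: phi [:: i] =
   (x' i - x i) *: (weval x' N.+1 (fun w => phi (i :: w)) - phi [:: i]) +
   x i *: (weval x' N.+1 (fun w => phi (i :: w)) - weval x N.+1 (fun w => phi (i :: w))).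
  by rewrite !scalerBl !scalerBr; abel.
apply: ideal_mulD; last by apply: (ideal_mul_mul iJ' mJ) => //; exact: weval_diff.
apply: (@ideal_mul_mul m J) => // [a b Ja mb|]; first by rewrite mulrC; exact: mJ.
rewrite /= addrC addKr; apply: ideal_mul_sum => j; exact: ideal_mul_scale.
Qed.

End IdealMultiples.

(** * Ideals and quotients *)

Section Ideals.
Variable S : comNzRingType.
Implicit Types (I J : set S).

Lemma ideal0 I : is_ideal I -> I 0. Proof. by case. Qed.
Lemma idealD I x y : is_ideal I -> I x -> I y -> I (x + y). Proof. by move=> [_ + _]; exact. Qed.
Lemma idealM I a x : is_ideal I -> I x -> I (a * x). Proof. by move=> [_ _]; exact. Qed.
Lemma idealMr I a x : is_ideal I -> I x -> I (x * a).
Proof. by rewrite mulrC; exact: idealM. Qed.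
Lemma idealN I x : is_ideal I -> I x -> I (- x).
Proof. by rewrite -mulN1r; exact: idealM. Qed.
Lemma idealB I x y : is_ideal I -> I x -> I y -> I (x - y).
Proof. by move=> iI Ix Iy; apply: idealD => //; exact: idealN. Qed.
Lemma ideal_sum I (T : Type) (r : seq T) (P : pred T) (f : T -> S) : is_ideal I ->
  (forall i, P i -> I (f i)) -> I (\sum_(i <- r | P i) f i).
Proof.
by move=> iI If; elim/big_ind: _ => //; [exact: ideal0 | move=> *; exact: idealD].
Qed.

Lemma ideal_gen_ideal (P : set S) : is_ideal (ideal_gen P).
Proof.
split=> [|x y [s [sP ->]] [t [tP ->]]|a x [s [sP ->]]].
- by exists [::]; rewrite big_nil.
- exists (s ++ t); rewrite big_cat; split=> // u.
  by rewrite mem_cat => /orP [/sP|/tP].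
- exists [seq (a * u.1, u.2) | u <- s]; split=> [u /mapP [u' /sP Pu ->] //|].
  by rewrite big_map mulr_sumr; apply: eq_bigr => u _; rewrite mulrA.
Qed.

Lemma sub_ideal_gen (P : set S) : P `<=` ideal_gen P.
Proof.
move=> x Px; exists [:: (1, x)]; rewrite big_seq1 mul1r; split=> // u.
by rewrite inE => /eqP ->.
Qed.

Lemma ideal_gen_sub (P J : set S) : is_ideal J -> P `<=` J -> ideal_gen P `<=` J.
Proof.
move=> iJ PJ x [s [sP ->]]; rewrite big_seq; apply: ideal_sum => // u /sP Pu.
by apply: idealM => //; exact: PJ.
Qed.

Lemma ideal_pow_ideal I k : is_ideal (ideal_pow I k).
Proof. exact: ideal_gen_ideal. Qed.

Lemma ideal_pow0 I x : ideal_pow I 0 x.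
Proof.
rewrite -[x]mulr1; apply: idealM; first exact: ideal_pow_ideal.
by apply: sub_ideal_gen; exists [tuple]; [case | rewrite big_nil].
Qed.

Lemma ideal_powS I k a b : I a -> ideal_pow I k b -> ideal_pow I k.+1 (a * b).
Proof.
move=> Ia [s [sP ->]]; rewrite mulr_sumr big_seq; apply: ideal_sum => [|u /sP [t tI ->]].
  exact: ideal_pow_ideal.
rewrite mulrCA; apply: idealM; first exact: ideal_pow_ideal.
apply: sub_ideal_gen; exists (cons_tuple a t); last by rewrite big_cons.
by move=> i; case: (unliftP ord0 i) => [j ->|->]; rewrite ?tnthS ?tnth0.
Qed.

Lemma ideal_pow_xprod I k h (x : 'I_h -> S) w : (forall i, I (x i)) -> size w = k ->
  ideal_pow I k (xprod x w).
Proof.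
move=> Ix; elim: w k => [|i w IH] [|k] //=; first by move=> _; exact: ideal_pow0.
by move=> [wk]; rewrite xprod_cons; apply: ideal_powS => //; exact: IH.
Qed.

Lemma ideal_pow_min I k (J : set S) : is_ideal J ->
  (forall a b, I a -> ideal_pow I k b -> J (a * b)) -> ideal_pow I k.+1 `<=` J.
Proof.
move=> iJ IJ; apply: ideal_gen_sub => // _ [t tI ->].
case/tupleP: t tI => a t tI; rewrite big_cons; apply: IJ; first by have := tI ord0; rewrite tnth0.
apply: sub_ideal_gen; exists t => // i.
by have := tI (lift ord0 i); rewrite tnthS.
Qed.

Lemma ideal_pow_sub I k : is_ideal I -> ideal_pow I k.+1 `<=` ideal_pow I k.
Proof.
move=> iI; apply: ideal_pow_min => [|a b _]; first exact: ideal_pow_ideal.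
by apply: idealM; exact: ideal_pow_ideal.
Qed.

Lemma ideal_pow_le I k l : is_ideal I -> (k <= l)%N -> ideal_pow I l `<=` ideal_pow I k.
Proof.
move=> iI; elim: l => [|l IH]; first by rewrite leqn0 => /eqP ->.
rewrite leq_eqVlt => /predU1P [-> //|/IH kl] x Ix.
by apply/kl/ideal_pow_sub.
Qed.

Lemma ideal_pow1 I x : is_ideal I -> ideal_pow I 1 x -> I x.
Proof.
by move=> iI; apply: ideal_pow_min => // a b Ia _; exact: idealMr.
Qed.

Lemma ideal_pow_exp I k x : I x -> ideal_pow I k (x ^+ k).
Proof.
move=> Ix; elim: k => [|k IH]; first exact: ideal_pow0.
by rewrite exprS; exact: ideal_powS.
Qed.

End Ideals.

Lemma ideal_pow_morph (A B : comNzRingType) (psi : {rmorphism A -> B}) (I : set A) (J : set B) k a :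
  (forall x, I x -> J (psi x)) -> ideal_pow I k a -> ideal_pow J k (psi a).
Proof.
move=> IJ; elim: k a => [|k IH] a; first by move=> _; exact: ideal_pow0.
have iP : is_ideal [set y | ideal_pow J k.+1 (psi y)].
  split=> [|x y Jx Jy|c x Jx] /=.
  - by rewrite rmorph0; apply: ideal0; exact: ideal_pow_ideal.
  - by rewrite rmorphD; apply: idealD => //; exact: ideal_pow_ideal.
  - by rewrite rmorphM; apply: idealM => //; exact: ideal_pow_ideal.
apply: ideal_pow_min iP _ _ => x y Ix Iy /=.
by rewrite rmorphM; apply: ideal_powS; [exact: IJ | exact: IH].
Qed.

(** * Quotient algebras and factorisation through them *)

Section Quotients.
Variable K : fieldType.

Section IdealOfSet.
Variables (S : comAlgType K) (I : set S).
Hypotheses (iI : is_ideal I) (I1 : ~ I 1).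

Definition set_ideal : {pred S} := fun x => `[< I x >].

Lemma set_idealr : idealr_closed set_ideal.
Proof.
split; first by apply/asboolP; exact: ideal0.
  by apply/negP => /asboolP.
move=> a u v /asboolP Iu /asboolP Iv; apply/asboolP.
by apply: idealD => //; exact: idealM.
Qed.
End IdealOfSet.

Section PiMorphism.
Variables (S : comAlgType K) (I : idealr S).
Local Notation Q := {ideal_quot I}.

Definition quot_pi (x : S) : Q := (\pi_Q x)%qT.

Lemma quot_pi_zmod : zmod_morphism quot_pi. Proof. exact: raddfB. Qed.
Lemma quot_pi_monoid : monoid_morphism quot_pi. Proof. by split; [exact: rmorph1 | exact: rmorphM]. Qed.
Lemma quot_pi_scale : scalable quot_pi.
Proof. by move=> a x; exact: pi_iscale. Qed.
HB.instance Definition _ := GRing.isZmodMorphism.Build S Q quot_pi quot_pi_zmod.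
HB.instance Definition _ := GRing.isMonoidMorphism.Build S Q quot_pi quot_pi_monoid.
HB.instance Definition _ := GRing.isScalable.Build K S Q *:%R quot_pi quot_pi_scale.

Lemma quot_pi_surj q : exists x, quot_pi x = q.
Proof. by exists (repr q); rewrite /quot_pi reprK. Qed.

Lemma quot_pi_eq0 x : quot_pi x = 0 <-> x \in I.
Proof.
rewrite -(rmorph0 quot_pi) /quot_pi; split.
  by move/eqP; rewrite eqmodE /= Quotient.equivE subr0.
by move=> Ix; apply/eqP; rewrite eqmodE /= Quotient.equivE subr0.
Qed.
End PiMorphism.

Lemma quotient_exists (S : comAlgType K) (I : set S) : is_ideal I -> ~ I 1 ->
  exists (Q : comAlgType K) (p : {lrmorphism S -> Q}),
    (forall q, exists x, p x = q) /\ forall x, p x = 0 <-> I x.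
Proof.
move=> iI I1.
pose J : idealr S := HB.pack (set_ideal I) (isIdealr.Build S (set_ideal I) (set_idealr iI I1)).
exists {ideal_quot J}, (@quot_pi S J); split; first exact: quot_pi_surj.
move=> x; split; first by move/quot_pi_eq0 => /asboolP.
by move=> Ix; apply/quot_pi_eq0; exact/asboolP.
Qed.

Lemma factor_through (S Q B : comAlgType K) (p : {lrmorphism S -> Q}) (g : {lrmorphism S -> B}) :
  (forall q, exists x, p x = q) -> (forall x, p x = 0 -> g x = 0) ->
  exists g' : {lrmorphism Q -> B}, forall x, g' (p x) = g x.
Proof.
move=> /choice [s sP] gp.
pose g' q := g (s q).
have g'P x : g' (p x) = g x.
  by apply/subr0_eq; rewrite -rmorphB; apply: gp; rewrite rmorphB /= sP subrr.
have g'D : zmod_morphism g'.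
  by move=> a b; rewrite -{1}[a]sP -{1}[b]sP -rmorphB g'P rmorphB.
have g'M : monoid_morphism g'.
  split; first by rewrite -(rmorph1 p) g'P rmorph1.
  by move=> a b; rewrite -{1}[a]sP -{1}[b]sP -rmorphM g'P rmorphM.
have g'Z : scalable g'.
  by move=> c a; rewrite -{1}[a]sP -linearZ g'P linearZ.
exists (HB.pack_for {lrmorphism Q -> B} g' (GRing.isZmodMorphism.Build Q B g' g'D)
  (GRing.isMonoidMorphism.Build Q B g' g'M) (GRing.isScalable.Build K Q B *:%R g' g'Z)).
exact: g'P.
Qed.
End Quotients.

(** * Local algebras *)

(** A surjection from a finite type is enough for counting and asks for no further structure on the
    quotient algebras. *)
Definition finitely_many (T : Type) := exists (I : finType) (g : I -> T), forall t, exists i, g i = t.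

Section Residue.
Variables (F : fieldType) (A : comAlgType F) (res : {lrmorphism A -> F^o}).
Local Notation m := [set x | res x = 0].

Lemma res_ideal : is_ideal m.
Proof.
split=> [|x y /= x0 y0|a x /= x0] /=; first exact: rmorph0.
  by rewrite rmorphD /= x0 y0 addr0.
by rewrite rmorphM /= x0 mulr0.
Qed.

Lemma res_alg (a : F) : res a%:A = a.
Proof. by rewrite linearZ /= rmorph1 [LHS]mulr1. Qed.

Lemma res_split x : m (x - (res x : F)%:A).
Proof. by rewrite /= linearB /= res_alg subrr. Qed.

Lemma res_not1 : ~ m 1.
Proof. by rewrite /= rmorph1 => /eqP; rewrite oner_eq0. Qed.

Lemma res_maximal : maximal_ideal m.
Proof.
split; [exact: res_ideal | exact: res_not1 |] => J iJ mJ J1.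
apply/seteqP; split=> // x Jx; apply: contrapT => /eqP rx; apply: J1.
have : J ((res x : F)%:A).
  by rewrite -[_%:A](subKr x); apply: idealB => //; apply/mJ/res_split.
move/(idealM (((res x : F)^-1)%:A) iJ); rewrite mulr_algl scalerA mulVf ?scale1r //.
Qed.

(** The kernel of a morphism to F is maximal, hence the same for all. This makes every algebra
    morphism out of R compatible with the residue maps. *)
Lemma local_morph_unique (chi : {lrmorphism A -> F^o}) : local_alg res -> chi =1 res.
Proof.
move=> loc.
have chim : maximal_ideal [set x | chi x = 0].
  split=> [||J iJ mJ J1].
  - split=> [|x y /= x0 y0|a x /= x0] /=; first exact: rmorph0.
      by rewrite rmorphD /= x0 y0 addr0.
    by rewrite rmorphM /= x0 mulr0.
  - by rewrite /= rmorph1 => /eqP; rewrite oner_eq0.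
  apply/seteqP; split=> // x Jx; apply: contrapT => /eqP rx; apply: J1.
  have : J ((chi x : F)%:A).
    rewrite -[_%:A](subKr x); apply: idealB => //; apply/mJ => /=.
    by rewrite linearB /= linearZ /= rmorph1 [X in _ - X]mulr1 subrr.
  by move/(idealM (((chi x : F)^-1)%:A) iJ); rewrite mulr_algl scalerA mulVf ?scale1r.
have km := (loc _).1 chim; move=> x.
have : [set x | chi x = 0] (x - (res x : F)%:A) by rewrite km; exact: res_split.
by rewrite /= linearB /= linearZ /= rmorph1 [X in _ - X]mulr1 => /subr0_eq.
Qed.

Section Nilpotent.
Variable N : nat.
Hypothesis mN : ideal_pow m N = [set 0].

Lemma res_nilpotent x : m x -> x ^+ N = 0.
Proof. by move=> /(ideal_pow_exp N); rewrite mN. Qed.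

Lemma res_nilpotent_xprod h (x : 'I_h -> A) w : (forall i, m (x i)) -> size w = N -> xprod x w = 0.
Proof. by move=> mx /(ideal_pow_xprod mx); rewrite mN. Qed.

Lemma nilpotent_local : local_alg res.
Proof.
move=> I; split=> [[iI I1 maxI]|->]; last exact: res_maximal.
apply: esym; apply: maxI; [exact: res_ideal | | exact: res_not1] => x Ix.
apply: contrapT => /eqP rx; apply: I1.
(* x = c + y with c invertible and y nilpotent, so x divides c ^+ N. *)
pose c : A := (res x : F)%:A; pose y := c - x.
have my : m y by rewrite /y -opprB /= linearN /= [X in - X](res_split x) oppr0.
have cN : I (c ^+ N).
  rewrite -[c ^+ N]subr0 -(res_nilpotent my) subrXX.
  by rewrite /y subKr; exact: idealMr.
have := idealM ((((res x : F)^-1)%:A) ^+ N) iI cN.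
by rewrite -exprMn mulr_algl scalerA mulVf // scale1r expr1n.
Qed.

Hypothesis finA : finitely_many A.

Lemma finite_artinian : artinian A.
Proof.
have [I [g gP]] := finA => J iJ Jdecr.
pose c k := #|[set i | `[< J k (g i) >]]%SET|.
have Jle k l : (k <= l)%N -> J l `<=` J k.
  elim: l => [|l IH]; first by rewrite leqn0 => /eqP ->.
  by rewrite leq_eqVlt => /predU1P [-> //|/IH kl]; apply: subset_trans kl; exact: Jdecr.
have sub k l : (k <= l)%N -> [set i | `[< J l (g i) >]]%SET \subset [set i | `[< J k (g i) >]]%SET.
  by move=> /Jle kl; apply/fintype.subsetP => i; rewrite !finset.inE => /asboolW Ji; apply: asboolT; exact: kl.
have [n0 minN] : exists n0, forall k, (c n0 <= c k)%N.
  have ex : exists n, `[< exists k, c k = n >] by exists (c 0%N); apply/asboolP; exists 0%N.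
  case: (ex_minnP ex) => n /asboolP [n1 <-] minn; exists n1 => k.
  by apply: minn; apply/asboolP; exists k.
exists n0 => k nk; apply/seteqP; split; first exact: Jle.
move=> a; have [i <-] := gP a => Ja.
have /eqP e : ([set i | `[< J k (g i) >]] == [set i | `[< J n0 (g i) >]])%SET.
  by rewrite eqEcard sub //=; exact: minN.
have : i \in [set i | `[< J n0 (g i) >]]%SET by rewrite finset.inE; apply: asboolT.
by rewrite -e finset.inE => /asboolW.
Qed.

Lemma finite_local_artinian : local_artinian res.
Proof. by split; [exact: nilpotent_local | exact: finite_artinian]. Qed.

(** J / J' is the line spanned by the class of [v], killed by the maximal ideal, and [lam] is its
    coordinate. It is extended to all of A so as to apply to entries of matrices that are only known
    to be in J later. *)
Definition small_step (J J' : set A) (v : A) (lam : {linear A -> F^o}) :=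
  [/\ is_ideal J', J' `<=` J, forall a b, m a -> J b -> J' (a * b), J v &
    [/\ forall b, J' b -> lam b = 0, lam v = 1 &
        forall b, J b -> J' (b - (lam b : F) *: v)]].

Lemma small_step_exists J : is_ideal J -> J `<=` m -> J <> [set 0] ->
  exists J' v lam, small_step J J' v lam.
Proof.
move=> iJ Jm J0.
pose mJ : set A := ideal_gen [set x | exists a b, [/\ m a, J b & x = a * b]].
have imJ : is_ideal mJ by exact: ideal_gen_ideal.
have mJP a b : m a -> J b -> mJ (a * b).
  by move=> ma Jb; apply: sub_ideal_gen; exists a, b.
have mJJ : mJ `<=` J.
  by apply: ideal_gen_sub => // _ [a [b [_ Jb ->]]]; exact: idealM.
(* Nakayama: otherwise J would be contained in every power of the maximal ideal, one of which is
   0. *)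
have [v [Jv nv]] : exists v, J v /\ ~ mJ v.
  apply: contrapT => nex; apply: J0.
  have JmJ : J `<=` mJ by move=> v Jv; apply: contrapT => nv; apply: nex; exists v.
  have Jpow k : J `<=` ideal_pow m k.
    elim: k => [|k IH] x Jx; first exact: ideal_pow0.
    apply: (ideal_gen_sub _ _ (JmJ x Jx)); first exact: ideal_pow_ideal.
    by move=> _ [a [b [ma Jb ->]]]; apply: ideal_powS => //; exact: IH.
  apply/seteqP; split=> x /=; first by move=> /(Jpow N); rewrite mN.
  by move=> ->; exact: ideal0.
have subsp (I : set A) : is_ideal I -> subspace I.
  move=> iI; split=> [|a x y Ix Iy]; first exact: ideal0.
  by apply: idealD => //; rewrite -mulr_algl; exact: idealM.
have sU : subspace [set x | exists c : F, x = c *: v].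
  split=> [|a x y [c ->] [c' ->]]; first by exists 0; rewrite scale0r.
  by exists (a * c + c'); rewrite scalerDl scalerA.
have UmJ x : [set x | exists c : F, x = c *: v] x -> mJ x -> x = 0.
  move=> [c ->] mJx; have [->|c0] := eqVneq c 0; first by rewrite scale0r.
  case: nv; rewrite -[v]scale1r -(mulVf c0) -scalerA.
  exact: (subspaceZ _ (subsp _ imJ)).
(* A hyperplane B that contains mJ and misses [v]. Its trace on J is an ideal: modulo m,
   multiplication by [a] is multiplication by the scalar [res a]. *)
have [B [sB mJB UB UBV]] := complement_above sU (subsp _ imJ) UmJ.
have /choice [lam lamP] : forall x, exists c : F, B (x - c *: v).
  by move=> x; have [_ [c ->] Bx] := UBV x; exists c.
have lam_uniq x c : B (x - c *: v) -> lam x = c.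
  move=> Bx; apply/eqP; rewrite -subr_eq0; apply/eqP.
  have : (lam x - c) *: v = 0.
    apply: UB; first by exists (lam x - c).
    have -> : (lam x - c) *: v = (x - c *: v) - (x - lam x *: v) by rewrite scalerBl; abel.
    exact: subspaceB.
  move=> e; apply: contrapT => /eqP ne; apply: nv.
  by rewrite -[v]scale1r -(mulVf ne) -scalerA e scaler0; exact: ideal0.
have lamlin : linear (lam : A -> F^o).
  move=> a x y; apply: lam_uniq.
  have -> : a *: x + y - (a *: (lam x : F^o) + lam y : F) *: v = a *: (x - lam x *: v) + (y - lam y *: v).
    by rewrite scalerDl scalerBr !scalerA; abel.
  exact: sB.2.
pose lamL : {linear A -> F^o} := HB.pack_for {linear A -> F^o} (lam : A -> F^o)
  (GRing.isLinear.Build F A F^o *:%R (lam : A -> F^o) lamlin).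
have JB a : J a -> J (a - lam a *: v) /\ B (a - lam a *: v).
  by move=> Ja; split=> //; apply: idealB => //; rewrite -mulr_algl; exact: idealM.
exists (J `&` B), v, lamL; split=> //.
- split=> [|x y [Jx Bx] [Jy By]|a x [Jx Bx]].
  + by split; [exact: ideal0 | case: sB].
  + by split; [exact: idealD | exact: subspaceD].
  + split; first exact: idealM.
    have -> : a * x = (a - (res a : F)%:A) * x + (res a : F) *: x.
      by rewrite mulrBl mulr_algl subrK.
    apply: subspaceD => //; last exact: subspaceZ.
    by apply/mJB/mJP => //; exact: res_split.
- by move=> a b ma Jb; split; [exact: idealM | exact/mJB/mJP].
split.
- by move=> b [_ Bb]; apply: lam_uniq; rewrite scale0r subr0.
- by apply: lam_uniq; rewrite scale1r subrr; case: sB.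
- by move=> b /JB.
Qed.

(** Every step removes [v] from J, so the count of indices of the enumeration of A that fall in J
    decreases. *)
Lemma small_induction (P : set A -> Prop) : P m ->
  (forall J J' v lam, is_ideal J -> J `<=` m -> small_step J J' v lam -> P J -> P J') ->
  P [set 0].
Proof.
have [I [g gP]] := finA => Pm Pstep.
suff main k J : is_ideal J -> J `<=` m -> P J ->
    (#|[set i | `[< J (g i) >]]%SET| <= k)%N -> P [set 0].
  by apply: (main #|I| m) => //; [exact: res_ideal | exact: max_card].
elim: k J => [|k IH] J iJ Jm PJ.
  rewrite leqn0 cards_eq0 => /eqP J0; have [i gi] := gP 0.
  have : i \in [set i | `[< J (g i) >]]%SET by rewrite finset.inE; apply: asboolT; rewrite gi; exact: ideal0.
  by rewrite J0 finset.inE.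
move=> ck; have [<- //|/(small_step_exists iJ Jm) [J' [v [lam st]]]] := pselect (J = [set 0]).
have PJ' := Pstep _ _ _ _ iJ Jm st PJ.
case: st => iJ' JJ' _ Jv [lam0 lamv _].
apply: (IH J') => //; first exact: subset_trans Jm.
rewrite -ltnS (leq_trans _ ck) //; apply: proper_card; apply/properP; split.
  by apply/fintype.subsetP => i; rewrite !finset.inE => /asboolW Ji; apply: asboolT; exact: JJ'.
have [i gi] := gP v; exists i; first by rewrite finset.inE gi; apply: asboolT.
rewrite finset.inE gi; apply/negP => /asboolW /lam0; rewrite lamv => /eqP.
by rewrite oner_eq0.
Qed.

End Nilpotent.
End Residue.

(** * Maurer-Cartan lifts *)

Lemma splits_map (T U : Type) (M : zmodType) (k : T -> U) (psi : seq U -> seq U -> M) l :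
  splits psi (map k l) = splits (fun l1 l2 => psi (map k l1) (map k l2)) l.
Proof. by elim: l psi => //= a l IH psi; rewrite !splits_cons /= IH. Qed.

Lemma basis_coord (K : fieldType) (V : lmodType K) n (e : 'I_n -> V) : is_basis e ->
  exists c : 'I_n -> {linear V -> K^o}, forall x, x = \sum_i (c i x : K) *: e i.
Proof.
move=> be.
have /choice [c cP] : forall x, exists c : {ffun 'I_n -> K}, x = \sum_i c i *: e i.
  by move=> x; have [c [cx _]] := be x; exists c.
have c_uniq x (c' : {ffun 'I_n -> K}) : x = \sum_i c' i *: e i -> c x = c'.
  by have [c0 [_ c0P]] := be x => xc'; rewrite -(c0P _ (cP x)) -(c0P _ xc').
have clin i : linear (fun x => c x i : K^o).
  move=> a x y; rewrite (c_uniq _ [ffun i => a * c x i + c y i]) ?ffunE //.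
  rewrite {1}(cP x) {1}(cP y) scaler_sumr -big_split; apply: eq_bigr => k _.
  by rewrite ffunE scalerDl scalerA.
exists (fun i => HB.pack_for {linear V -> K^o} (fun x => c x i : K^o)
  (GRing.isLinear.Build K V K^o *:%R (fun x => c x i : K^o) (clin i))).
exact: cP.
Qed.

Lemma basis_free (K : fieldType) (V : lmodType K) n (e : 'I_n -> V) (c : 'I_n -> K) :
  is_basis e -> \sum_i c i *: e i = 0 -> forall i, c i = 0.
Proof.
move=> be c0 i; have [c1 [_ c1P]] := be 0.
have z : 0 = \sum_i ([ffun=> 0] : {ffun 'I_n -> K}) i *: e i.
  by rewrite big1 // => k _; rewrite ffunE scale0r.
have z' : 0 = \sum_i (finfun c) i *: e i.
  by rewrite -[LHS]c0; apply: eq_bigr => k _; rewrite ffunE.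
by have := congr1 (fun k : {ffun _ -> _} => k i) (etrans (esym (c1P _ z')) (c1P _ z)); rewrite !ffunE.
Qed.

Section MaurerCartan.
Variables (G : topGroupType) (F : fieldType) (d : nat) (rho : contRep G F d).
Local Notation C := (cochain G F d).
Local Notation Z := (cocycle (dC rho)).
Local Notation H := (coh (dC rho)).
Variables (m : gmap H H) (f : gmap H C).
Hypothesis mf : Ainf_model m f.
Variables (h : nat) (e : 'I_h -> H 1%N).
Local Notation b := (twist m).
Local Notation Phi := (twist f).

Definition degree1_word (w : seq 'I_h) : seq (gelt H) := [seq Tagged H (e i) | i <- w].
Local Notation ew := degree1_word.

Lemma gdeg_ew w : gdeg (ew w) = size w.
Proof. by elim: w => [|i w IH]; rewrite ?gdeg_nil // gdeg_cons IH. Qed.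

Lemma size_ew w : size (ew w) = size w. Proof. exact: size_map. Qed.

(** Degree 1 becomes even after suspension, so no Koszul sign is left on these words. *)
Lemma sgw_ew w : sgw (@ssgn F H) (ew w) = 1.
Proof. by rewrite sgE gdeg_ew size_ew addnn -signr_odd odd_double. Qed.

(** The origin of the sign [(-1) ^+ 'C(k, 2)] in [mc_lift]. *)
Lemma bar_exp_ew w : bar_exp (ew w) = 'C(size w, 2).
Proof. by elim: w => //= i w ->; rewrite mul1n size_ew binS bin1 addnC. Qed.

Lemma gval_ew k (B : nat -> lmodType F) (g : gmap H B) w : gval k g (ew w) = Tagged B (g k (ew w)).
Proof.
rewrite /gval gdeg_ew size_ew; have -> // : (size w + k - size w)%N = k by rewrite addKn.
Qed.

Lemma twist_f_lin : multilinear Phi.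
Proof. by case: mf => _ _ _ [[? _ _] _ _] _; exact: twist_lin. Qed.

Lemma morphism_bar k l : (0 < size l)%N ->
  coder (gval 2 b) (@ssgn F H) (Phi k) l =
  tproj k (Tagged C (dC rho _ (tagged (gval 1 Phi l)))) - quad (@cup G F d rho) Phi k l.
Proof.
move=> l0; have [[_ md _] _ _ [[fl fd fm] _ _] _] := mf.
have := fm k l l0; rewrite stasheff_twist; [|exact: fl|exact: md].
rewrite (composition_twist _ (@mu_linearl _ _ _ _) (@mu_linearr _ _ _ _)) //.
move/(congr1 (fun x => (-1) ^+ bar_exp l *: x)).
by rewrite !scalerA -expr2 sqrr_sign !scale1r.
Qed.

(* [emb] multiplies the value of a cochain at g by rho g. *)
Definition Yw (w : seq 'I_h) (g : G) : 'M[F]_d := emb rho (Phi 1%N (ew w)) [:: g].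

Lemma emb_at0 n l : emb rho (0 : C n) l = 0.
Proof. by rewrite linear0. Qed.

Lemma Yw_nil g : Yw [::] g = 0.
Proof. exact: emb_at0. Qed.

(** The morphism equation of f on a word of degree 1 classes, read at the list [[:: g; g']]: the
    Hochschild differential of a 1-cochain measures its failure to be a derivation along [rho]. *)
Lemma mc_identity w g g' :
  splits (fun w1 => splits (fun w2 w3 =>
    emb rho (Phi 2 (ew w1 ++ Tagged H (b 2 (ew w2)) :: ew w3)) [:: g; g'])) w =
  rho g *m Yw w g' - Yw w (g * g')%g + Yw w g *m rho g'
  - splits (fun w1 w2 => Yw w1 g *m Yw w2 g') w.
Proof.
have emb2 (x y : list_cochain F G d) : x [::] = 0 -> y [::] = 0 ->
    xcup x y [:: g; g'] = x [:: g] *m y [:: g'].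
  move=> x0 y0; rewrite !xcup_cons /xcup splits_nil x0 y0 mul0mx mulmx0 add0r addr0 //.
have emb0 (c : C 1%N) : emb rho c [::] = 0 by rewrite emb_size.
case: w => [|i w].
  rewrite !splits_nil !Yw_nil mulmx0 !mul0mx addr0 !subr0.
  by rewrite (slot_linear0 (g := Phi 2) [::] [::] _ (twist_f_lin 2)) emb_at0.
move: (i :: w) (isT : (0 < size (i :: w))%N) => {i}w w0.
have := @morphism_bar 2 (ew w); rewrite size_ew => /(_ w0).
move=> /(congr1 (fun c => emb rho c [:: g; g'])).
rewrite linearB /= => e1.
have {}e1 : emb rho (coder (gval 2 b) (@ssgn F H) (Phi 2) (ew w)) [:: g; g'] =
   emb rho (tproj 2 (Tagged C (dC rho _ (tagged (gval 1 Phi (ew w)))))) [:: g; g']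
   - emb rho (quad (@cup G F d rho) Phi 2 (ew w)) [:: g; g'] by exact: e1.
rewrite gval_ew /= tproj_tag emb_d in e1.
have app_splits (n : nat) (T : Type) (psi : seq T -> seq T -> C n) l :
    emb rho (splits psi l) [:: g; g'] = splits (fun l1 l2 => emb rho (psi l1 l2) [:: g; g']) l.
  rewrite (raddf_splits (emb rho (n := n))).
  by rewrite !splitsE fct_sumE.
have app_scale (n : nat) (a : F) (c : C n) : emb rho (a *: c) [:: g; g'] = a *: emb rho c [:: g; g'].
  by rewrite linearZ.
move: e1; rewrite /coder /quad !app_splits /degree1_word !splits_map => e1.
transitivity (xd rho (emb rho (Phi 1%N (ew w))) [:: g; g'] -
    splits (fun w1 w2 => Yw w1 g *m Yw w2 g') w).
  rewrite -[splits (fun w1 w2 => Yw w1 g *m Yw w2 g') w](_ : splits (fun l1 l2 => emb rho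
      (sgw (@ssgn F H) (ew l1) *: tproj 2 (Tagged C (cup rho (tagged (gval 1 Phi (ew l1)))
        (tagged (gval 1 Phi (ew l2)))))) [:: g; g']) w = _).
    rewrite -e1; apply: eq_splits => w1 w23 _.
    rewrite app_scale sgw_ew scale1r app_splits splits_map; apply: eq_splits => w2 w3 _.
    by rewrite gval_ew.
  apply: eq_splits => w1 w2 _.
  rewrite app_scale sgw_ew scale1r !gval_ew tproj_tag.
  have ec := congr1 (@^~ [:: g; g']) (emb_cup rho (Phi 1%N (ew w1)) (Phi 1%N (ew w2))).
  by apply: (etrans ec); rewrite emb2.
congr (_ - _); rewrite /xd xcup_rhol (xcup_rhor _ _ [:: g]).
rewrite xcontr_cons [xcontr _ [:: g']](_ : _ = 0) ?subr0; last first.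
  by rewrite xcontr_cons /xcontr /= !oppr0 addr0.
by rewrite /xsgn /= expr1 scaleN1r mulNmx opprK /Yw addrAC.
Qed.
Lemma class_f1 i (x : H i) : exists2 z : Z i, val z = Phi i [:: Tagged H x] & pr z = x.
Proof.
have [_ _ _ _ f1] := mf; have [z zE prz] := f1 i x; exists z => //.
by rewrite zE /twist /= muln0 expr0 scale1r.
Qed.

Lemma f1_coboundary i (x : H i) : coboundary (dC rho) (Phi i [:: Tagged H x]) -> x = 0.
Proof. by have [z <- <-] := class_f1 x; move/pr_eq0. Qed.

Lemma f1_linear i : linear (fun x : H i => Phi i [:: Tagged H x]).
Proof. by move=> a x y; exact: (twist_f_lin i [::] [::]). Qed.

Variables (n2 : nat) (eps : 'I_n2 -> H 2) (coord : 'I_n2 -> {linear H 2 -> F^o}).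
Hypothesis coordE : forall x, x = \sum_j (coord j x : F) *: eps j.

(** Up to sign, the coefficient of the word [w] in the j-th relation of the hull ([mdualE]). *)
Definition relw j (w : seq 'I_h) : F := coord j (b 2 (ew w)).

Definition Tw j w1 w3 (g g' : G) : 'M[F]_d :=
  emb rho (Phi 2 (ew w1 ++ Tagged H (eps j) :: ew w3)) [:: g; g'].

Lemma Tw_sum w1 w2 w3 g g' :
  emb rho (Phi 2 (ew w1 ++ Tagged H (b 2 (ew w2)) :: ew w3)) [:: g; g'] =
  \sum_j relw j w2 *: Tw j w1 w3 g g'.
Proof.
pose k : {linear H 2 -> C 2} := HB.pack_for {linear H 2 -> C 2}
  (fun x => Phi 2 (ew w1 ++ Tagged H x :: ew w3))
  (GRing.isLinear.Build F (H 2) (C 2) *:%R _ (slot_linear_slot (ew w1) (ew w3) (twist_f_lin 2))).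
rewrite [b 2 (ew w2)]coordE -/(relw _ w2).
rewrite -[Phi 2 _]/(k _) linear_sum linear_sum fct_sumE; apply: eq_bigr => j _.
by rewrite !linearZ.
Qed.

Section Points.
Variable A : comAlgType F.
Local Notation inA := (map_mx (in_alg A)).
Implicit Types (x : 'I_h -> A).

Definition mc_value x N g : 'M[A]_d := weval x N (fun w => inA (Yw w g)).
Definition mc_rep x N g : 'M[A]_d := inA (rho g) - mc_value x N g.
Definition mc_rel x N j : A := weval x N (fun w => (relw j w)%:A : A^o).
Definition mc_coef x N j g g' : 'M[A]_d :=
  weval x N (fun w1 => weval x N (fun w3 => inA (Tw j w1 w3 g g'))).

Lemma map_mx_splits (psi : seq 'I_h -> seq 'I_h -> 'M[F]_d) w :
  inA (splits psi w) = splits (fun w1 w2 => inA (psi w1 w2)) w.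
Proof. exact: (raddf_splits (map_mx (in_alg A) : {additive 'M[F]_d -> 'M[A]_d})). Qed.

Lemma weval_mulmx x N (P : 'M[A]_d) (phi : seq 'I_h -> 'M[A]_d) :
  P *m weval x N phi = weval x N (fun w => P *m phi w).
Proof.
apply: (weval_raddf (psi := idfun) (f := mulmx P)) => a v.
by rewrite /= scalemxAr.
Qed.

Lemma weval_mulmxr x N (P : 'M[A]_d) (phi : seq 'I_h -> 'M[A]_d) :
  weval x N phi *m P = weval x N (fun w => phi w *m P).
Proof.
apply: (weval_raddf (psi := idfun) (f := mulmxr P)) => a v.
by rewrite /= scalemxAl.
Qed.

(** [mc_identity] summed over all words. By [weval_splits] the cut into three factors becomes a
    product whose middle factor is the value of a relation. *)
Lemma mc_defect x N g g' : (forall w, size w = N -> xprod x w = 0) ->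
  mc_rep x N (g * g')%g - mc_rep x N g *m mc_rep x N g' =
  \sum_j mc_rel x N j *: mc_coef x N j g g'.
Proof.
move=> xN; have xN1 w : size w = N -> 1 * xprod x w = 0 by move=> /xN; rewrite mul1r.
transitivity (weval x N (fun w => inA (rho g *m Yw w g' - Yw w (g * g')%g + Yw w g *m rho g'
  - splits (fun w1 w2 => Yw w1 g *m Yw w2 g') w))).
  have E1 : weval x N (fun w => inA (splits (fun w1 w2 => Yw w1 g *m Yw w2 g') w)) =
      mc_value x N g *m mc_value x N g'.
    rewrite [RHS]weval_mulmxr -[LHS]scale1r.
    rewrite (@eq_weval _ _ _ x N _ (splits (fun w1 w2 => inA (Yw w1 g) *m inA (Yw w2 g')))).
      rewrite weval_splits // scale1r; apply: eq_weval => w1.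
      by rewrite weval_mulmx.
    by move=> w; rewrite map_mx_splits; apply: eq_splits => w1 w2 _; rewrite map_mxM.
  have -> : weval x N (fun w => inA (rho g *m Yw w g' - Yw w (g * g')%g + Yw w g *m rho g'
      - splits (fun w1 w2 => Yw w1 g *m Yw w2 g') w)) =
    inA (rho g) *m mc_value x N g' - mc_value x N (g * g')%g + mc_value x N g *m inA (rho g')
      - mc_value x N g *m mc_value x N g'.
    rewrite -E1 [inA (rho g) *m _]weval_mulmx [mc_value x N g *m _]weval_mulmxr.
    have wN phi : - weval x N phi = weval x N (fun w => - phi w) :> 'M[A]_d.
      by rewrite -scaleN1r -wevalZ; apply: eq_weval => w; rewrite scaleN1r.
    rewrite [mc_value x N (g * g')%g]/mc_value !wN -!wevalD; apply: eq_weval => w.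
    by rewrite map_mxB map_mxD map_mxB !map_mxM.
  rewrite /mc_rep repM map_mxM mulmxBl !mulmxBr.
  by abel.
rewrite (@eq_weval _ _ _ x N _ (splits (fun w1 => splits (fun w2 w3 =>
    \sum_j (relw j w2)%:A *: inA (Tw j w1 w3 g g'))))) => [|w]; last first.
  rewrite -mc_identity map_mx_splits; apply: eq_splits => w1 w23 _.
  rewrite map_mx_splits; apply: eq_splits => w2 w3 _.
  by rewrite Tw_sum raddf_sum; apply: eq_bigr => j _; rewrite /= map_mxZ.
rewrite -[LHS]scale1r weval_splits // scale1r.
rewrite (@eq_weval _ _ _ x N _ (fun w1 => \sum_j mc_rel x N j *:
   weval x N (fun w3 => inA (Tw j w1 w3 g g')))) => [|w1].
  by rewrite weval_sum; apply: eq_bigr => j _; rewrite wevalZ.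
rewrite -[LHS]scale1r weval_splits // scale1r.
rewrite (@eq_weval _ _ _ x N _ (fun w2 => \sum_j (relw j w2)%:A *:
   weval x N (fun w3 => inA (Tw j w1 w3 g g')))) => [|w2].
  by rewrite weval_sum; apply: eq_bigr => j _; rewrite weval_mul.
by rewrite weval_sum; apply: eq_bigr => j _; rewrite wevalZ.
Qed.

Lemma mc_liftE x N g : mc_lift f e x N g = mc_rep x N g.
Proof.
rewrite /mc_lift mulmxBl mul1mx /mc_rep; congr (_ - _).
rewrite /mc_value wevalE mulmx_suml; case: N => [|N]; first by rewrite !big_geq ?mul0mx.
rewrite [RHS]big_ltn // [X in _ = X + _]big1 ?add0r => [|w _]; last first.
  by rewrite (tuple0 w) Yw_nil map_mx0 scaler0.
apply: eq_big_nat => -[//|k] _; rewrite mulmx_suml; apply: eq_bigr => w _.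
rewrite -scalemxAl -map_mxM /Yw /emb /= big_seq1.
have -> : (fun i : 'I_1 => nth 1%g [:: g] i) = (fun=> g) by apply/funext => i; rewrite ord1.
rewrite -[[seq _ | i <- w]]/(ew w) /twist.
case: w => -[|i w] //= wk; rewrite -[Tagged H (e i) :: _]/(ew (i :: w)).
change (((-1) ^+ 'C(k.+1, 2) * xprod x (i :: w)) *: inA (f 1%N (ew (i :: w)) (fun=> g) *m rho g) =
  xprod x (i :: w) *: inA (((-1) ^+ bar_exp (ew (i :: w)) *: f 1%N (ew (i :: w)) (fun=> g)) *m rho g)).
rewrite bar_exp_ew /= (eqP wk) -scalemxAl map_mxZ /= scalerA mulrC; congr (_ *: _).
by congr (_ * _); rewrite -[RHS]/(in_alg A _) rmorphXn; congr (_ ^+ _); exact: (esym (rmorphN1 (in_alg A))).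
Qed.

End Points.
End MaurerCartan.

(** * First-order deformations *)

Section Schur.
Variables (G : topGroupType) (F : finFieldType) (d : nat) (rho : contRep G F d).

(* An eigenvalue of X, possibly in an extension L of F, has an eigenspace stable under
   rho, hence equal to L^d. *)
Lemma schur (X : 'M[F]_d) : absolutely_irreducible rho ->
  (forall g, X *m rho g = rho g *m X) -> exists c, X = c%:M.
Proof.
move=> irr comm.
have d0 : (0 < d)%N by have [] := irr F idfun.
case: d d0 rho X irr comm => // n _ r X irr comm.
have p0 : char_poly X != 0 by rewrite -size_poly_eq0 size_char_poly.
have [L [rs Lp _]] := FinSplittingFieldFor p0.
pose iota : {rmorphism F -> L} := in_alg L.
have [c rc] : exists c, root (map_poly iota (char_poly X)) c.
  have := eqp_size Lp; case: rs Lp => [|c rs] Lp _.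
    by have := eqp_size Lp; rewrite size_map_poly size_char_poly big_nil size_poly1.
  by exists c; rewrite (eqp_root Lp) big_cons rootM root_XsubC eqxx.
pose Y := map_mx iota X - c%:M.
have [v vX v0] : exists2 v : 'rV[L]_n.+1, v *m Y = 0 & v != 0.
  move: rc; rewrite map_char_poly -eigenvalue_root_char => /eigenvalueP [v vX v0].
  by exists v => //; rewrite mulmxBr vX mul_mx_scalar subrr.
have Ycomm g : map_mx iota (r g) *m Y = Y *m map_mx iota (r g).
  by rewrite mulmxBr mulmxBl -!map_mxM comm mul_mx_scalar mul_scalar_mx.
(* The stable subspace is the image of Y on column vectors; the row eigenvector [v] annihilates it,
   so it is proper. *)
pose W := limg (linfun (mulmx Y : 'cV[L]_n.+1 -> 'cV[L]_n.+1)).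
have inW u : Y *m u \in W by rewrite -[Y *m u](lfunE (mulmx Y)) memv_img ?memvf.
have [_ /(_ W)] := irr L iota; case.
- move=> g u /memv_imgP [u' _ ->]; rewrite lfunE /= mulmxA Ycomm -mulmxA; exact: inW.
- move=> W0; have Y0 u : Y *m u = 0 :> 'cV_ _ by have := inW u; rewrite W0 memv0 => /eqP.
  have /matrixP YE : Y = 0.
    apply/matrixP => i j; have := congr1 (fun w : 'cV_ _ => w i ord0) (Y0 (delta_mx j ord0)).
    by rewrite -colE !mxE.
  exists (X ord0 ord0); apply/matrixP => i j; apply: (fmorph_inj iota).
  have := YE i j; have := YE ord0 ord0; rewrite !mxE eqxx mulr1n => /subr0_eq e00.
  by move=> /subr0_eq ->; rewrite rmorphMn e00.
- move=> Wf; case/eqP: v0; apply/rowP => i; rewrite mxE.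
  have /memv_imgP [u _ uE] : (delta_mx i ord0 : 'cV[L]_n.+1) \in W by rewrite Wf memvf.
  have := congr1 (fun w => (v *m w) ord0 ord0) uE.
  by rewrite lfunE /= mulmxA vX mul0mx -colE !mxE.
Qed.
End Schur.

(** * Cocycles and coboundaries of degree 1 and 2 as matrix functions *)

Section FirstOrder.
Variables (G : topGroupType) (F : fieldType) (d : nat) (rho : contRep G F d).
Local Notation C := (cochain G F d).
Local Notation H := (coh (dC rho)).
Variables (m : gmap H H) (f : gmap H C).
Hypothesis mf : Ainf_model m f.
Variables (h : nat) (e : 'I_h -> H 1%N).
Hypothesis basis_e : is_basis e.
Variables (n2 : nat) (eps : 'I_n2 -> H 2).
Hypothesis basis_eps : is_basis eps.
Local Notation Phi := (twist f).
Local Notation Y1 i g := (Yw f e [:: i] g).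
Local Notation T1 j g g' := (Tw f e eps j [::] [::] g g').

Lemma xd1 (x : list_cochain F G d) g : xd rho x [:: g] = rho g *m x [::] - x [::] *m rho g.
Proof.
rewrite /xd xcup_rhol (xcup_rhor _ _ [::]) xcontr_cons /xcontr /= oppr0 !addr0.
by rewrite /xsgn expr0 scale1r.
Qed.

Lemma xd2 (x : list_cochain F G d) g g' :
  xd rho x [:: g; g'] = rho g *m x [:: g'] - x [:: g * g']%g + x [:: g] *m rho g'.
Proof.
rewrite /xd xcup_rhol (xcup_rhor _ _ [:: g]) xcontr_cons [xcontr _ [:: g']](_ : _ = 0) ?subr0.
  by rewrite /xsgn /= expr1 scaleN1r mulNmx opprK addrAC.
by rewrite xcontr_cons /xcontr /= !oppr0 addr0.
Qed.

Lemma emb_ext n (c c' : C n) : (forall l, size l = n -> emb rho c l = emb rho c' l) -> c = c'.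
Proof.
move=> cc; apply: (@emb_inj _ _ _ rho); apply/funext => l.
by have [/cc //|/eqP sl] := eqVneq (size l) n; rewrite !emb_size.
Qed.

Definition const_cochain (q : 'M[F]_d) : C 0 := mk_contmap (@dcont_cst _ _ q).

Lemma emb_const q : emb rho (const_cochain q) [::] = q.
Proof. by rewrite /emb /= big_nil rep1 mulmx1. Qed.

Lemma untwist_cont (delta : G -> 'M[F]_d) : dcont delta ->
  dcont (fun g : {ptws 'I_1 -> G} => delta (g ord0) *m rho (g ord0)^-1%g).
Proof.
move=> dc; apply: (dcont_comp2 (h := fun P Q : 'M[F]_d => P *m Q)).
  by apply: (dcont_pre _ dc); exact: coord_continuous.
apply: (dcont_pre (h := fun g : {ptws 'I_1 -> G} => (g ord0)^-1%g) _ (rep_cont (c := rho))).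
move=> x; apply: continuous_comp; [exact: coord_continuous | exact: invg_continuous].
Qed.

Definition untwist (delta : G -> 'M[F]_d) (dc : dcont delta) : C 1%N := mk_contmap (untwist_cont dc).

Lemma emb_untwist delta (dc : dcont delta) g : emb rho (untwist dc) [:: g] = delta g.
Proof.
by rewrite /emb /= big_seq1 -mulmxA rhoVl mulmx1.
Qed.

Lemma Phi_comb i n (v : 'I_n -> H i) (c : 'I_n -> F) :
  Phi i [:: Tagged H (\sum_k c k *: v k)] = \sum_k c k *: Phi i [:: Tagged H (v k)].
Proof.
pose k : {linear H i -> C i} := HB.pack_for {linear H i -> C i} (fun x => Phi i [:: Tagged H x])
  (GRing.isLinear.Build F (H i) (C i) *:%R _ (f1_linear mf (i := i))).
rewrite -[LHS]/(k _) linear_sum; apply: eq_bigr => j _.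
by rewrite linearZ.
Qed.

Lemma emb_comb i n (v : 'I_n -> H i) (c : 'I_n -> F) l :
  emb rho (Phi i [:: Tagged H (\sum_k c k *: v k)]) l =
  \sum_k c k *: emb rho (Phi i [:: Tagged H (v k)]) l.
Proof.
rewrite Phi_comb linear_sum fct_sumE; apply: eq_bigr => k _.
by rewrite linearZ.
Qed.

(** The right-hand side is the coboundary of the constant 0-cochain [q], and the class of f_1(x) is
    x. *)
Lemma comb_coboundary1 (c : 'I_h -> F) (q : 'M[F]_d) :
  (forall g, \sum_i c i *: Y1 i g = rho g *m q - q *m rho g) -> forall i, c i = 0.
Proof.
move=> cq; apply: basis_free basis_e _; apply: (f1_coboundary mf).
exists (const_cochain q); apply: emb_ext => -[|g [|g' l]] // _.
by rewrite emb_d xd1 emb_const -cq emb_comb.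
Qed.

(** Here continuity of [delta] is what makes the primitive an element of the cochain complex. *)
Lemma comb_coboundary2 (c : 'I_n2 -> F) (delta : G -> 'M[F]_d) : dcont delta ->
  (forall g g', \sum_j c j *: T1 j g g' = rho g *m delta g' - delta (g * g')%g + delta g *m rho g') ->
  forall j, c j = 0.
Proof.
move=> dc cd; apply: basis_free basis_eps _; apply: (f1_coboundary mf).
exists (untwist dc); apply: emb_ext => -[|g [|g' [|k l]]] // _.
by rewrite emb_d xd2 !emb_untwist -cd emb_comb.
Qed.

Lemma cocycle_decomposition (delta : G -> 'M[F]_d) : dcont delta ->
  (forall g g', rho g *m delta g' - delta (g * g')%g + delta g *m rho g' = 0) ->
  exists (c : 'I_h -> F) (q : 'M[F]_d),
    forall g, delta g = \sum_i c i *: Y1 i g + (rho g *m q - q *m rho g).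
Proof.
move=> dc cd.
have dz : dC rho 1%N (untwist dc) = 0.
  apply: emb_ext => -[|g [|g' [|k l]]] // _.
  by rewrite emb_d xd2 !emb_untwist cd emb_at0.
have [c [cE _]] := basis_e (pr (mk_cocycle dz)).
have [z zE prz] := class_f1 mf (pr (mk_cocycle dz)).
have : pr (mk_cocycle dz - z) = 0 by rewrite linearB /= prz subrr.
move/pr_eq0 => /= [q0 qE].
have qE' : untwist dc = Phi 1%N [:: Tagged H (pr (mk_cocycle dz))] + dC rho 0 q0.
  have -> : dC rho 0 q0 = val (mk_cocycle dz) - val z by rewrite -linearB; exact: esym qE.
  by rewrite zE addrC subrK.
exists c, (emb rho q0 [::]) => g.
have embD (a b : C 1%N) : emb rho (a + b) [:: g] = emb rho a [:: g] + emb rho b [:: g].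
  by rewrite linearD.
rewrite -(emb_untwist dc g) qE' embD; congr (_ + _); first by rewrite {1}cE emb_comb.
by have := congr1 (@^~ [:: g]) (emb_d rho q0); rewrite xd1.
Qed.

End FirstOrder.

(** * Versality of the Maurer-Cartan lifts *)

Section MatrixIdeals.
Variables (A : comNzRingType) (d : nat).
Implicit Types (I J : set A) (P Q : 'M[A]_d).

Definition mx_in J P := forall i j, J (P i j).

Lemma mx_in0 J : is_ideal J -> mx_in J 0.
Proof. by move=> iJ i j; rewrite mxE; exact: ideal0. Qed.
Lemma mx_inD J P Q : is_ideal J -> mx_in J P -> mx_in J Q -> mx_in J (P + Q).
Proof. by move=> iJ JP JQ i j; rewrite mxE; exact: idealD. Qed.
Lemma mx_inN J P : is_ideal J -> mx_in J P -> mx_in J (- P).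
Proof. by move=> iJ JP i j; rewrite mxE; exact: idealN. Qed.
Lemma mx_inB J P Q : is_ideal J -> mx_in J P -> mx_in J Q -> mx_in J (P - Q).
Proof. by move=> iJ JP JQ; apply: mx_inD => //; exact: mx_inN. Qed.
Lemma mx_in_sum J n (P : 'I_n -> 'M[A]_d) : is_ideal J ->
  (forall k, mx_in J (P k)) -> mx_in J (\sum_k P k).
Proof. by move=> iJ JP i j; rewrite summxE; apply: ideal_sum => // k _; exact: JP. Qed.
Lemma mx_inMr J P Q : is_ideal J -> mx_in J P -> mx_in J (P *m Q).
Proof. by move=> iJ JP i j; rewrite mxE; apply: ideal_sum => // k _; exact: idealMr. Qed.
Lemma mx_inMM I J J' P Q : is_ideal J' -> (forall a b, I a -> J b -> J' (a * b)) ->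
  mx_in I P -> mx_in J Q -> mx_in J' (P *m Q).
Proof. by move=> iJ' IJ IP JQ i j; rewrite mxE; apply: ideal_sum => // k _; exact: IJ. Qed.
Lemma mx_in_scale J a P : is_ideal J -> J a -> mx_in J (a *: P).
Proof. by move=> iJ Ja i j; rewrite mxE; exact: idealMr. Qed.
Lemma mx_inZZ I J J' a P : (forall a b, I a -> J b -> J' (a * b)) ->
  I a -> mx_in J P -> mx_in J' (a *: P).
Proof. by move=> IJ Ia JP i j; rewrite mxE; exact: IJ. Qed.
Lemma mx_in_sub J J' P : J `<=` J' -> mx_in J P -> mx_in J' P.
Proof. by move=> JJ JP i j; exact: JJ. Qed.
Lemma mx_in_mul J P : is_ideal J -> ideal_mul J P -> mx_in J P.
Proof.
move=> iJ [s [sJ ->]]; rewrite big_seq; elim/big_ind: _ => [||u /sJ Ju].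
- exact: mx_in0.
- by move=> *; exact: mx_inD.
- exact: mx_in_scale.
Qed.
Lemma mx_in_eq0 P : mx_in [set 0] P -> P = 0.
Proof. by move=> P0; apply/matrixP => i j; rewrite mxE; exact: P0. Qed.

Lemma ideal_mul_self J (a : A) : is_ideal J -> @ideal_mul A A^o J a -> J a.
Proof.
move=> iJ [s [sJ ->]]; rewrite big_seq; apply: ideal_sum => // u /sJ Ju.
exact: idealMr.
Qed.

Lemma mx_in_exp J P k : mx_in J P -> mx_in (ideal_pow J k) (P ^+ k).
Proof.
move=> JP; elim: k => [|k IH]; first by move=> i j; exact: ideal_pow0.
rewrite exprS; apply: (mx_inMM (J := ideal_pow J k)) JP IH => [|a b].
  exact: ideal_pow_ideal.
exact: ideal_powS.
Qed.

Lemma unipotent_inverse J P N : ideal_pow J N = [set 0] -> mx_in J P ->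
  exists Q, (1%:M + P) *m Q = 1%:M /\ Q *m (1%:M + P) = 1%:M.
Proof.
move=> JN JP; have PN : (- P) ^+ N = 0.
  by rewrite exprNn; have := mx_in_exp N JP; rewrite JN => /mx_in_eq0 ->; rewrite mulr0.
exists (\sum_(i < N) (- P) ^+ i); rewrite -[1%:M + P](_ : 1 - (- P) = _); last by rewrite opprK.
have := subrX1 (- P) N; rewrite PN sub0r => e.
have comm : GRing.comm (1 - - P) (\sum_(i < N) (- P) ^+ i).
  apply: GRing.commr_sum => i _; apply: GRing.commrX.
  by apply/GRing.commr_sym; apply: GRing.commrB; [exact: GRing.commr1 | exact: GRing.commr_refl].
have e1 : (1 - - P) * (\sum_(i < N) (- P) ^+ i) = 1.
  by rewrite -[1 - - P]opprB mulNr -e opprK.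
by split; [exact: e1 | rewrite -[RHS]e1; exact: esym comm].
Qed.

End MatrixIdeals.

Section LinearFunctionals.
Variables (F : fieldType) (A : comAlgType F) (d : nat) (lam : {linear A -> F^o}).
Local Notation inA := (map_mx (in_alg A)).
Definition mx_lam (P : 'M[A]_d) : 'M[F]_d := map_mx lam P.

Lemma mx_lamD P Q : mx_lam (P + Q) = mx_lam P + mx_lam Q.
Proof. by apply/matrixP => i j; rewrite !mxE linearD. Qed.
Lemma mx_lamN P : mx_lam (- P) = - mx_lam P.
Proof. by apply/matrixP => i j; rewrite !mxE linearN. Qed.
Lemma mx_lam_sum n (P : 'I_n -> 'M[A]_d) : mx_lam (\sum_k P k) = \sum_k mx_lam (P k).
Proof. by apply/matrixP => i j; rewrite !mxE !summxE linear_sum; apply: eq_bigr => k _; rewrite mxE. Qed.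
Lemma mx_lamMl (P : 'M[F]_d) (Q : 'M[A]_d) : mx_lam (inA P *m Q) = P *m mx_lam Q.
Proof.
apply/matrixP => i j; rewrite !mxE linear_sum; apply: eq_bigr => k _.
by rewrite !mxE mulr_algl linearZ.
Qed.
Lemma mx_lamMr (P : 'M[A]_d) (Q : 'M[F]_d) : mx_lam (P *m inA Q) = mx_lam P *m Q.
Proof.
apply/matrixP => i j; rewrite !mxE linear_sum; apply: eq_bigr => k _.
by rewrite !mxE mulrC mulr_algl linearZ mulrC.
Qed.
Lemma mx_lamZ (a : A) (Q : 'M[F]_d) : mx_lam (a *: inA Q) = (lam a : F) *: Q.
Proof. by apply/matrixP => i j; rewrite !mxE mulrC mulr_algl linearZ mulrC. Qed.
Lemma mx_lam0 J P : (forall a, J a -> lam a = 0) -> mx_in J P -> mx_lam P = 0.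
Proof. by move=> l0 JP; apply/matrixP => i j; rewrite !mxE l0. Qed.
Lemma mx_lam_split J J' v P : (forall a, J a -> J' (a - (lam a : F) *: v)) ->
  mx_in J P -> mx_in J' (P - v *: inA (mx_lam P)).
Proof.
move=> lJ JP i j; have := lJ _ (JP i j).
by rewrite !mxE mulrC mulr_algl.
Qed.
End LinearFunctionals.

Lemma strictly_equivalent_sym (G : topGroupType) (F : fieldType) (A : comAlgType F) d
    (res : {lrmorphism A -> F^o}) (r r' : G -> 'M[A]_d) :
  strictly_equivalent res r r' -> strictly_equivalent res r' r.
Proof.
move=> [P [Q [PQ QP resP rr]]]; exists Q, P; split=> // [|g].
  have := congr1 (map_mx res) QP; rewrite map_mxM resP mulmx1 => ->.
  exact: map_mx1.
by rewrite rr !mulmxA QP mul1mx -mulmxA QP mulmx1.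
Qed.

Lemma strictly_equivalent_trans (G : topGroupType) (F : fieldType) (A : comAlgType F) d
    (res : {lrmorphism A -> F^o}) (r1 r2 r3 : G -> 'M[A]_d) :
  strictly_equivalent res r1 r2 -> strictly_equivalent res r2 r3 -> strictly_equivalent res r1 r3.
Proof.
move=> [P [Q [PQ QP resP rr]]] [P' [Q' [PQ' QP' resP' rr']]].
exists (P' *m P), (Q *m Q'); split=> [|||g].
- by rewrite mulmxA -(mulmxA P') PQ mulmx1.
- by rewrite mulmxA -(mulmxA Q) QP' mulmx1.
- by rewrite map_mxM resP resP' mulmx1.
- by rewrite rr' rr !mulmxA.
Qed.

(** * Injectivity and surjectivity of x -> R_x over a finite local algebra *)

Section Deformation.
Variables (G : topGroupType) (F : finFieldType) (d : nat) (rho : contRep G F d).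
Local Notation C := (cochain G F d).
Local Notation H := (coh (dC rho)).
Variables (m : gmap H H) (f : gmap H C).
Hypothesis mf : Ainf_model m f.
Hypothesis irr : absolutely_irreducible rho.
Variables (h : nat) (e : 'I_h -> H 1%N).
Hypothesis basis_e : is_basis e.
Variables (n2 : nat) (eps : 'I_n2 -> H 2) (coord : 'I_n2 -> {linear H 2 -> F^o}).
Hypothesis basis_eps : is_basis eps.
Hypothesis coordE : forall x, x = \sum_j (coord j x : F) *: eps j.

Variables (A : comAlgType F) (res : {lrmorphism A -> F^o}) (N : nat).
Local Notation mA := [set x | res x = 0].
Hypothesis mN : ideal_pow mA N.+2 = [set 0].
Hypothesis finA : finitely_many A.
Local Notation inA := (map_mx (in_alg A)).
Local Notation Y := (Yw f e).
Local Notation R x := (mc_rep f e x N.+2).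
Local Notation mu x := (mc_rel m e coord x N.+2).
Implicit Types (x : 'I_h -> A).
Let imA : is_ideal mA := res_ideal res.

Lemma mc_value_diff J J' x x' g : is_ideal J -> is_ideal J' ->
  (forall a b, mA a -> J b -> J' (a * b)) ->
  (forall i, mA (x i)) -> (forall i, mA (x' i)) -> (forall i, J (x' i - x i)) ->
  mx_in J' (mc_value f e x' N.+2 g - mc_value f e x N.+2 g -
            \sum_i (x' i - x i) *: inA (Y [:: i] g)).
Proof. by move=> *; apply: mx_in_mul => //; exact: (weval_diff1 (m := mA) (J := J)). Qed.

(** As m_1 = 0 the relations have no linear term, so moving the point within J changes them only
    within J'. *)
Lemma mc_rel_diff J J' x x' j : is_ideal J -> is_ideal J' ->
  (forall a b, mA a -> J b -> J' (a * b)) ->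
  (forall i, mA (x i)) -> (forall i, mA (x' i)) -> (forall i, J (x' i - x i)) ->
  J' (mu x' j - mu x j).
Proof.
move=> iJ iJ' mJ mx mx' Jx; apply: ideal_mul_self => //.
have := weval_diff1 (M := A^o) iJ iJ' mJ mx mx' Jx N (fun w => (relw m e coord j w)%:A).
rewrite [X in _ - X]big1 ?subr0 // => i _.
have [_ m1 _ _ _] := mf.
have -> : relw m e coord j [:: i] = 0.
  rewrite /relw /= /twist /=; have := m1 _ (e i) 2; rewrite /op1 => ->.
  by rewrite scaler0 linear0.
by rewrite scale0r scaler0.
Qed.

Lemma mc_value_max x g : (forall i, mA (x i)) -> mx_in mA (mc_value f e x N.+2 g).
Proof.
move=> mx; apply: mx_in_mul => //.
have := weval_head (m := mA) mx N.+1 (fun w => inA (Y w g)).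
by rewrite Yw_nil map_mx0 subr0.
Qed.

Lemma mc_rel_max x j : (forall i, mA (x i)) -> mA (mu x j).
Proof.
move=> mx; apply: ideal_mul_self => //.
have := weval_head (M := A^o) (m := mA) mx N.+1 (fun w => (relw m e coord j w)%:A).
have -> : relw m e coord j [::] = 0 by rewrite /relw /= linear0.
by rewrite scale0r subr0.
Qed.

Lemma mc_coef_head x j g g' : (forall i, mA (x i)) ->
  mx_in mA (mc_coef f e eps x N.+2 j g g' - inA (Tw f e eps j [::] [::] g g')).
Proof.
move=> mx; pose k w1 := weval x N.+2 (fun w3 => inA (Tw f e eps j w1 w3 g g')).
have -> : mc_coef f e eps x N.+2 j g g' - inA (Tw f e eps j [::] [::] g g') =
   (weval x N.+2 k - k [::]) + (k [::] - inA (Tw f e eps j [::] [::] g g')).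
  by rewrite addrA subrK.
by apply: mx_inD => //; apply: mx_in_mul => //; exact: weval_head.
Qed.

Lemma mc_rep_max x g : (forall i, mA (x i)) -> mx_in mA (R x g - inA (rho g)).
Proof.
move=> mx; rewrite /mc_rep addrAC subrr add0r; apply: mx_inN => //; exact: mc_value_max.
Qed.

Lemma xprod_nil x w : (forall i, mA (x i)) -> size w = N.+2 -> xprod x w = 0.
Proof. exact: (res_nilpotent_xprod mN). Qed.

Lemma mx_in_resP (P Q : 'M[A]_d) : map_mx res P = map_mx res Q -> mx_in mA (P - Q).
Proof.
move=> PQ i j; have := congr1 (fun M : 'M_d => M i j) PQ; rewrite !mxE => e'.
by rewrite /= linearB /= e' subrr.
Qed.

Lemma resP_mx_in (P Q : 'M[A]_d) : mx_in mA (P - Q) -> map_mx res P = map_mx res Q.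
Proof.
move=> PQ; apply/matrixP => i j; rewrite !mxE; have := PQ i j.
have e2 : (P - Q) i j = P i j - Q i j by rewrite !mxE.
by move=> /(etrans (esym (congr1 res e2))); rewrite linearB /= => /subr0_eq.
Qed.

Lemma res_inA (P : 'M[F]_d) : map_mx res (inA P) = P.
Proof. by apply/matrixP => i j; rewrite !mxE; exact: res_alg. Qed.

(* Along a small step J' < J the conjugating matrix is a scalar modulo J, and its
   first-order part exhibits x' - x as a coboundary. *)
Theorem mc_injective x x' : (forall i, mA (x i)) -> (forall i, mA (x' i)) ->
  strictly_equivalent res (R x) (R x') -> x =1 x'.
Proof.
move=> mx mx' [P [Q [PQ QP resP rr]]].
have PR g : P *m R x g = R x' g *m P by rewrite rr -!mulmxA QP mulmx1.
(* The matrix P is known only up to scalars, hence the unit [a]; requiring [a] to be 1 modulo the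
   maximal ideal keeps [a - 1] harmless in products with J. *)
pose inv J := exists a, [/\ mA (a - 1), mx_in J (P - a%:M) & forall i, J (x' i - x i)].
suff [a [_ _ x0]] : inv [set 0] by move=> i; apply/esym/subr0_eq/x0.
apply: (small_induction mN finA) => [|J J' v lam iJ Jm [iJ' J'J mJ Jv [lam0 lamv lamJ]] [a [a1 qJ xJ]]].
  exists 1; split=> [||i]; first by rewrite subrr; exact: ideal0.
    by apply: mx_in_resP; rewrite resP map_mx1.
  exact: idealB.
pose q := P - a%:M.
have PE : P = a%:M + q by rewrite /q addrC subrK.
have qE : q = P - a%:M by [].
rewrite -/q in qJ; clearbody q.
have eqR g : a *: (R x' g - R x g) = q *m R x g - R x' g *m q.
  have := PR g; rewrite PE; move: (R x g) (R x' g) => U V.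
  rewrite mulmxDl mulmxDr mul_scalar_mx mul_mx_scalar => e0.
  have -> : q *m U = a *: V + V *m q - a *: U by rewrite -e0; abel.
  by rewrite scalerBr; abel.
have RE g : R x' g - R x g = - (mc_value f e x' N.+2 g - mc_value f e x N.+2 g).
  by rewrite /mc_rep !opprB addrC addrA subrK.
have vd g := mc_value_diff g iJ iJ' mJ mx mx' xJ.
(* Modulo J' the intertwining relation is linear in [q] and [x' - x]: what is dropped is the Taylor
   remainder and products of J with the maximal ideal. *)
have key g : mx_in J' (- (\sum_i (x' i - x i) *: inA (Y [:: i] g)) - (q *m inA (rho g) - inA (rho g) *m q)).
  have -> : - (\sum_i (x' i - x i) *: inA (Y [:: i] g)) - (q *m inA (rho g) - inA (rho g) *m q) =
    (mc_value f e x' N.+2 g - mc_value f e x N.+2 g - \sum_i (x' i - x i) *: inA (Y [:: i] g))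
    - (a - 1) *: (R x' g - R x g) + q *m (R x g - inA (rho g)) - (R x' g - inA (rho g)) *m q.
    move: (eqR g) (RE g); move: (R x g) (R x' g) (_ - mc_value _ _ _ _ _) => U V W eUV eV.
    rewrite mulmxBr mulmxBl scalerBl scale1r eUV eV; abel.
  have RJ : mx_in J (R x' g - R x g).
    rewrite RE; apply: mx_inN => //; apply: mx_in_mul => //.
    exact: (weval_diff iJ xJ).
  apply: mx_inB => //; last first.
    by apply: (mx_inMM (I := mA) (J := J)) => //; exact: mc_rep_max.
  apply: mx_inD => //; last first.
    apply: (mx_inMM (I := J) (J := mA)) => //; last exact: mc_rep_max.
    by move=> b c Jb mc; rewrite mulrC; exact: mJ.
  apply: mx_inB => //; exact: mx_inZZ mJ a1 RJ.
(* [lam] turns the congruence modulo J' into an equation over F, in which a combination of the basis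
   cocycles is a coboundary. *)
have keyF g : \sum_i (lam (x' i - x i) : F) *: Y [:: i] g = rho g *m mx_lam lam q - mx_lam lam q *m rho g.
  have := mx_lam0 lam0 (key g).
  rewrite !(mx_lamD, mx_lamN) mx_lamMl mx_lamMr mx_lam_sum.
  rewrite (eq_bigr (fun i => (lam (x' i - x i) : F) *: Y [:: i] g)) => [|i _]; last exact: mx_lamZ.
  by move=> /eqP; rewrite addr_eq0 eqr_oppLR => /eqP ->; rewrite opprK opprB; abel.
have lx := comb_coboundary1 mf basis_e keyF.
have x'J i : J' (x' i - x i).
  by have := lamJ _ (xJ i); rewrite lx scale0r subr0.
(* With x' - x pushed into J', the coordinate of [q] commutes with [rho] and is therefore scalar. *)
have [c qc] : exists c, mx_lam lam q = c%:M.
  apply: (schur irr) => g; apply/eqP; rewrite eq_sym -subr_eq0 -keyF.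
  by apply/eqP; rewrite big1 // => i _; rewrite lx scale0r.
exists (a + c *: v); split=> //.
  have -> : a + c *: v - 1 = (a - 1) + c *: v by rewrite addrAC.
  by apply: idealD => //; rewrite -mulr_algl; apply: idealM => //; exact: Jm.
have := mx_lam_split lamJ qJ; rewrite qc.
have -> : P - (a + c *: v)%:M = q - v *: inA (c%:M); last by [].
rewrite qE map_scalar_mx scale_scalar_mx raddfD /= opprD addrA; congr (_ - _).
by rewrite mulrC mulr_algl.
Qed.

Lemma Yw_cont w : dcont (Y w).
Proof.
have -> : Y w = fun g => twist f 1%N (degree1_word e w) (fun=> g) *m rho g.
  apply/funext => g; rewrite /Yw /emb /= big_seq1.
  rewrite (_ : (fun i : 'I_1 => nth 1%g [:: g] i) = (fun=> g)) //.
  by apply/funext => i; rewrite ord1.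
apply: (dcont_comp2 (h := fun P Q : 'M[F]_d => P *m Q)); last exact: rep_cont.
apply: (dcont_pre (h := fun g : G => (fun=> g) : {ptws 'I_1 -> G})); last exact: contmapP.
by apply: ptws_continuous => i x; exact: cvg_id.
Qed.

Lemma weval_cont x n (phi : seq 'I_h -> G -> 'M[A]_d) : (forall w, dcont (phi w)) ->
  dcont (fun g => weval x n (phi^~ g)).
Proof.
elim: n phi => [|n IH] phi pc /=; first exact: (@dcont_cst G _ (0 : 'M[A]_d)).
apply: (dcont_comp2 (h := fun P Q : 'M[A]_d => P + Q)); first exact: pc.
apply: dcont_sum => i; apply: (dcont_comp (h := fun P : 'M[A]_d => x i *: P)).
by apply: IH => w; exact: pc.
Qed.

Lemma mc_rep_cont x : dcont (R x).
Proof.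
apply: (dcont_comp2 (h := fun P Q : 'M[A]_d => P - Q)).
  by apply: (dcont_comp (h := fun P : 'M[F]_d => inA P)); exact: rep_cont.
apply: weval_cont => w.
by apply: (dcont_comp (h := fun P : 'M[F]_d => inA P)); exact: Yw_cont.
Qed.

Lemma mc_rep_mul x g g' : (forall i, mA (x i)) -> (forall j, mu x j = 0) ->
  R x (g * g')%g = R x g *m R x g'.
Proof.
move=> mx mu0; apply/subr0_eq.
rewrite (mc_defect mf e coordE) => [|w]; last exact: xprod_nil.
by rewrite big1 // => j _; rewrite mu0 scale0r.
Qed.

Lemma mc_rep_lift x : (forall i, mA (x i)) -> (forall j, mu x j = 0) ->
  exists2 r : contRep G A d, r =1 R x & is_lift rho res r.
Proof.
move=> mx mu0; have RM := mc_rep_mul _ _ mx mu0.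
(* 1 - R(1) is idempotent with entries in the nilpotent ideal mA. *)
have R1 : R x 1%g = 1%:M.
  apply/esym/subr0_eq; set E := _ - _.
  have EE : E *m E = E.
    by rewrite mulmxBl mulmxBr !mul1mx mulmxBr mulmx1 -RM mulg1 subrr subr0.
  have mE : mx_in mA E.
    have := mc_rep_max 1%g mx; rewrite rep1 map_mx1 => /(mx_inN imA).
    by rewrite opprB.
  apply: mx_in_eq0; rewrite -mN; have := mx_in_exp N.+2 mE.
  suff -> : E ^+ N.+2 = E by [].
  by elim: (N.+1) => [|n IH]; rewrite ?expr1 // exprS IH; exact: EE.
exists (@ContRep G A d (R x) R1 (fun g g' => RM g g') (@mc_rep_cont x)) => // g.
rewrite -(res_inA (rho g)); apply: resP_mx_in; exact: mc_rep_max.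
Qed.

(* Along a small step J' < J the obstruction is a class in H^2, read off by [mu], which
   must vanish; the remaining discrepancy is a 1-cocycle, absorbed by x and by the
   conjugating matrix. *)
Theorem mc_versal (r : contRep G A d) : is_lift rho res r ->
  exists x, [/\ forall i, mA (x i), forall j, mu x j = 0 & strictly_equivalent res r (R x)].
Proof.
move=> rl.
pose inv J := exists x P Q, [/\ forall i, mA (x i), P *m Q = 1%:M /\ Q *m P = 1%:M,
  map_mx res P = 1%:M, forall j, J (mu x j) & forall g, mx_in J (P *m r g *m Q - R x g)].
suff [x [P [Q [mx [PQ QP] resP mu0 rR]]]] : inv [set 0].
  exists x; split=> //; exists P, Q; split=> // g.
  by apply/esym/subr0_eq/mx_in_eq0.
apply: (small_induction mN finA) => [|J J' v lam iJ Jm [iJ' J'J mJ Jv [lam0 lamv lamJ]]].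
  exists (fun=> 0), 1%:M, 1%:M.
  have m0 (i : 'I_h) : mA 0 by exact: ideal0.
  split=> // [|||g].
  - by rewrite mulmx1.
  - exact: map_mx1.
  - by move=> j; exact: mc_rel_max.
  - rewrite mul1mx mulmx1; have -> : r g - R (fun=> 0) g = (r g - inA (rho g)) - (R (fun=> 0) g - inA (rho g)).
      by move: (R _ _) => U; abel.
    apply: mx_inB => //; last exact: mc_rep_max.
    by apply: mx_in_resP; rewrite res_inA; exact: rl.
move=> [x [P [Q [mx [PQ QP] resP muJ rJ]]]].
pose r1 g := P *m r g *m Q; pose delta g := r1 g - R x g.
have r1M g g' : r1 (g * g')%g = r1 g *m r1 g'.
  by rewrite /r1 repM !mulmxA -(mulmxA (P *m r g) Q P) QP mulmx1.
have r1E g : r1 g = R x g + delta g by rewrite /delta addrC subrK.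
have dJ g : mx_in J (delta g) := rJ g.
have d_cont : dcont (fun g => mx_lam lam (delta g)).
  apply: (dcont_comp (h := mx_lam lam)).
  apply: (dcont_comp2 (h := fun U V : 'M[A]_d => U - V)); last exact: mc_rep_cont.
  by apply: (dcont_comp (h := fun U : 'M[A]_d => P *m U *m Q)); exact: rep_cont.
clearbody delta.
pose T j g g' := Tw f e eps j [::] [::] g g'.
(* The coefficient of the j-th relation may be replaced by its value at the empty words, since
   [mu x j] lies in J and the difference in the maximal ideal. *)
have key g g' : mx_in J' (\sum_j mu x j *: inA (T j g g') -
    (inA (rho g) *m delta g' - delta (g * g')%g + delta g *m inA (rho g'))).
  have := mc_defect mf e coordE g g' (fun w => @xprod_nil x w mx).
  set K := fun j => mc_coef f e eps x N.+2 j g g'; rewrite -/(K _) => def.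
  have e1 : \sum_j mu x j *: K j = R x g *m delta g' + delta g *m R x g' + delta g *m delta g' - delta (g * g')%g.
    rewrite -def; have := r1M g g'; rewrite !r1E.
    move: (R x g) (R x g') (R x (g * g')%g) (delta g) (delta g') (delta _) => U V W a b c.
    rewrite mulmxDl !mulmxDr => /eqP; rewrite -subr_eq => /eqP e0.
    have -> : W = U *m V + U *m b + (a *m V + a *m b) - c by rewrite -e0; abel.
    abel.
  have -> : \sum_j mu x j *: inA (T j g g') -
     (inA (rho g) *m delta g' - delta (g * g')%g + delta g *m inA (rho g')) =
     (R x g - inA (rho g)) *m delta g' + delta g *m (R x g' - inA (rho g')) + delta g *m delta g'
     - \sum_j mu x j *: (K j - inA (T j g g')).
    rewrite (eq_bigr (fun j => mu x j *: K j - mu x j *: inA (T j g g')) (fun j _ => scalerBr _ _ _)).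
    rewrite sumrB e1; move: (R x g) (R x g') => U V.
    rewrite mulmxBl mulmxBr; abel.
  have Jm' a c : J a -> mA c -> J' (a * c) by move=> Ja mc; rewrite mulrC; exact: mJ.
  apply: mx_inB => //; last first.
    apply: mx_in_sum => // j; apply: mx_inZZ Jm' (muJ j) _; exact: mc_coef_head.
  apply: mx_inD => //; last by apply: (mx_inMM iJ' Jm') => //; apply: mx_in_sub (dJ g').
  apply: mx_inD => //.
    by apply: (mx_inMM iJ' mJ) => //; exact: mc_rep_max.
  by apply: (mx_inMM iJ' Jm') => //; exact: mc_rep_max.
pose dl g := mx_lam lam (delta g).
have keyF g g' : \sum_j (lam (mu x j) : F) *: T j g g' = rho g *m dl g' - dl (g * g')%g + dl g *m rho g'.
  have := mx_lam0 lam0 (key g g').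
  rewrite !(mx_lamD, mx_lamN) mx_lamMl mx_lamMr mx_lam_sum.
  rewrite (eq_bigr (fun j => (lam (mu x j) : F) *: T j g g')) => [|i _]; last exact: mx_lamZ.
  by move=> /subr0_eq.
have lmu := comb_coboundary2 mf basis_eps d_cont keyF.
have muJ' j : J' (mu x j) by have := lamJ _ (muJ j); rewrite lmu scale0r subr0.
have [c [q dlE]] : exists (c : 'I_h -> F) (q : 'M[F]_d),
    forall g, dl g = \sum_i c i *: Y [:: i] g + (rho g *m q - q *m rho g).
  apply: (cocycle_decomposition mf basis_e d_cont) => g g'.
  by rewrite -keyF big1 // => j _; rewrite lmu scale0r.
(* The minus sign compensates the one in [mc_rep]: moving x by [- c v] adds [\sum_i c i *: Y [:: i]]
   times [v] to R_x, modulo J'. *)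
pose x' i := x i - c i *: v.
have cv i : J (c i *: v) by rewrite -mulr_algl; exact: idealM.
have mx' i : mA (x' i) by apply: idealB => //; exact: Jm.
have xJ i : J (x' i - x i) by rewrite /x' addrAC subrr add0r; exact: idealN.
pose p := v *: inA q.
have pJ : mx_in J p by exact: mx_in_scale.
(* Conjugation by [1 + v q] absorbs the coboundary part of the discrepancy. *)
have [V [UV VU]] := unipotent_inverse mN (mx_in_sub Jm pJ).
pose U := 1%:M + p.
exists x', (U *m P), (Q *m V); split=> [|||j|g].
- exact: mx'.
- split; first by rewrite mulmxA -(mulmxA U) PQ mulmx1.
  by rewrite mulmxA -(mulmxA Q) VU mulmx1.
- rewrite map_mxM resP mulmx1 -(map_mx1 res); apply: resP_mx_in.
  by rewrite /U addrC addKr; exact: mx_in_sub Jm pJ.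
- rewrite -[mu x' j](subrK (mu x j)); apply: idealD => //.
  exact: mc_rel_diff iJ iJ' mJ mx mx' xJ.
have -> : U *m P *m r g *m (Q *m V) - R x' g = (U *m r1 g - R x' g *m U) *m V.
  by rewrite mulmxBl -(mulmxA (R x' g)) UV mulmx1 /r1 !mulmxA.
apply: mx_inMr => //.
have vd := mc_value_diff g iJ iJ' mJ mx mx' xJ.
have RE : R x g - R x' g = mc_value f e x' N.+2 g - mc_value f e x N.+2 g by rewrite /mc_rep opprB addrC addrA subrK.
have xE : \sum_i (x' i - x i) *: inA (Y [:: i] g) = - (v *: inA (\sum_i c i *: Y [:: i] g)).
  rewrite raddf_sum scaler_sumr -sumrN; apply: eq_bigr => i _.
  by rewrite /x' addrAC subrr add0r scaleNr /= map_mxZ scalerA mulrC mulr_algl.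
(* Each of the four terms is in J': the remainder of [delta] after [lam], the Taylor remainder, and
   two products of J with the maximal ideal. *)
have -> : U *m r1 g - R x' g *m U =
    (delta g - v *: inA (dl g)) +
    (mc_value f e x' N.+2 g - mc_value f e x N.+2 g - \sum_i (x' i - x i) *: inA (Y [:: i] g)) +
    p *m (r1 g - inA (rho g)) - (R x' g - inA (rho g)) *m p.
  rewrite xE -RE dlE r1E; move: (R x g) (R x' g) (delta g) => a b dg.
  have -> : v *: inA (\sum_i c i *: Y [:: i] g + (rho g *m q - q *m rho g)) =
     v *: inA (\sum_i c i *: Y [:: i] g) + (inA (rho g) *m p - p *m inA (rho g)).
    by rewrite map_mxD map_mxB !map_mxM scalerDr scalerBr -scalemxAr -scalemxAl.
  clearbody p; rewrite /U mulmxDl mul1mx mulmxBr mulmxBl (mulmxDr b) mulmx1; abel.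
apply: mx_inB => //; last by apply: (mx_inMM iJ' mJ) => //; exact: mc_rep_max.
apply: mx_inD => //; last first.
  apply: (mx_inMM (I := J) (J := mA)) => // [a c' Ja mc|]; first by rewrite mulrC; exact: mJ.
  rewrite r1E; have -> : R x g + delta g - inA (rho g) = (R x g - inA (rho g)) + delta g by rewrite addrAC.
  by apply: mx_inD => //; [exact: mc_rep_max | apply: mx_in_sub (dJ g)].
apply: mx_inD => //.
exact: mx_lam_split lamJ (dJ g).
Qed.

End Deformation.

(** * Power series *)

Section Monomials.
Variable h : nat.
Implicit Types (a b c : mon h) (w : seq 'I_h).

Definition mdeg a : nat := (\sum_i a i)%N.
Definition mdelta (i : 'I_h) : mon h := [ffun j => (j == i) : nat].
(** Truncation by a box of exponents instead of the total degree: the box is the list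
    [mdivs (mtop N)], and a monomial outside it has degree above N. *)
Definition mtop N : mon h := [ffun=> N].
Definition wtype w : mon h := [ffun i => count_mem i w].

Lemma mdegD a b : mdeg (madd a b) = (mdeg a + mdeg b)%N.
Proof. by rewrite /mdeg -big_split; apply: eq_bigr => i _; rewrite ffunE. Qed.

Lemma mdeg_delta i : mdeg (mdelta i) = 1%N.
Proof.
rewrite /mdeg (bigD1 i) //= ffunE eqxx big1 // => j ji.
by rewrite ffunE (negbTE ji).
Qed.

Lemma mdeg_eq0 a : (mdeg a == 0)%N = (a == mone h).
Proof.
rewrite sum_nat_eq0; apply/forallP/eqP => [a0|-> i]; last by rewrite ffunE.
by apply/ffunP => i; rewrite ffunE; apply/eqP; exact: a0.
Qed.

Lemma mle_delta i a : mle (mdelta i) a = (0 < a i)%N.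
Proof.
apply/mleP/idP => [/(_ i)|ai j]; first by rewrite ffunE eqxx.
by rewrite ffunE; case: eqP => [->|].
Qed.

Lemma msubKC a b : mle b a -> madd b (msub a b) = a.
Proof. by move/mleP => ba; apply/ffunP => i; rewrite !ffunE subnKC. Qed.

Lemma maddK a b : msub (madd b a) b = a.
Proof. by apply/ffunP => i; rewrite !ffunE addKn. Qed.

Lemma mle_add a b : mle b (madd b a).
Proof. by apply/mleP => i; rewrite ffunE leq_addr. Qed.

Lemma mdeg_le_top a N : (mdeg a <= N)%N -> mle a (mtop N).
Proof.
move=> aN; apply/mleP => i; rewrite ffunE; apply: leq_trans aN.
by rewrite /mdeg (bigD1 i) //= leq_addr.
Qed.

Lemma mdeg_not_top a N : ~~ mle a (mtop N) -> (N < mdeg a)%N.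
Proof. by apply: contraR; rewrite -leqNgt; exact: mdeg_le_top. Qed.

Lemma mdeg_wtype w : mdeg (wtype w) = size w.
Proof.
rewrite /mdeg; elim: w => [|k w IH].
  by rewrite big1 // => i _; rewrite ffunE.
rewrite (eq_bigr (fun i => (k == i) + wtype w i)%N) => [|i _]; last by rewrite !ffunE.
rewrite big_split /= IH (bigD1 k) //= eqxx big1 ?addn0 // => i ik.
by rewrite eq_sym (negbTE ik).
Qed.

Section Values.
Variables (A : comNzRingType) (x : 'I_h -> A).

Definition xmon a : A := \prod_i x i ^+ a i.

Lemma xmonD a b : xmon (madd a b) = xmon a * xmon b.
Proof. by rewrite /xmon -big_split; apply: eq_bigr => i _; rewrite ffunE exprD. Qed.

Lemma xmon1 : xmon (mone h) = 1.
Proof. by rewrite /xmon big1 // => i _; rewrite ffunE. Qed.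

Lemma xmon_delta i : xmon (mdelta i) = x i.
Proof.
rewrite /xmon (bigD1 i) //= ffunE eqxx expr1 big1 ?mulr1 // => j ji.
by rewrite ffunE (negbTE ji).
Qed.

Lemma xmon_wtype w : xmon (wtype w) = xprod x w.
Proof.
elim: w => [|k w IH].
  by rewrite /xprod big_nil /xmon big1 // => i _; rewrite ffunE.
rewrite xprod_cons -IH -(xmon_delta k) -xmonD; congr xmon; apply/ffunP => i.
by rewrite !ffunE /= eq_sym.
Qed.

Lemma xmon_pow (m : set A) a N : is_ideal m -> (forall i, m (x i)) -> (N <= mdeg a)%N ->
  ideal_pow m N (xmon a).
Proof.
move=> im mx Na; apply: (ideal_pow_le im Na).
have [n] := ubnP (mdeg a); elim: n a {Na} => // n IH a; rewrite ltnS => an.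
have [a0|] := posnP (mdeg a); first by rewrite a0; exact: ideal_pow0.
rewrite lt0n sum_nat_eq0 negb_forall => /existsP [i ai].
have da : mle (mdelta i) a by rewrite mle_delta lt0n.
rewrite -(msubKC da) mdegD mdeg_delta add1n xmonD xmon_delta.
apply: ideal_powS => //; apply: IH; move: an; rewrite -{1}(msubKC da) mdegD mdeg_delta.
by rewrite add1n.
Qed.
End Values.
End Monomials.

(** * Filtration by degree and evaluation of power series *)

Section PowerSeries.
Variables (K : fieldType) (h : nat).
Local Notation S := (pseries K h).
Local Notation X := (psX K).
Implicit Types (s t : S) (a b c : mon h).

Definition deg_ge N : set S := [set s | forall a, (mdeg a < N)%N -> s a = 0].

Lemma ps_mulE s t a : (s * t) a = \sum_(b <- mdivs a) s b * t (msub a b).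
Proof. by []. Qed.

Lemma ps_sumE (T : Type) (r : seq T) (F : T -> S) a : (\sum_(i <- r) F i) a = \sum_(i <- r) F i a.
Proof.
elim: r => [|i r IH]; first by rewrite !big_nil.
by rewrite !big_cons -IH.
Qed.

Lemma psX_mul i s a : (X i * s) a = if (0 < a i)%N then s (msub a (mdelta i)) else 0.
Proof.
rewrite ps_mulE; have Xd b : X i b = (b == mdelta i)%:R by [].
case: ifP => ai.
  rewrite (bigD1_seq (mdelta i)) ?mdivs_uniq ?mem_mdivs ?mle_delta //= Xd eqxx mul1r.
  by rewrite big1 ?addr0 // => b /negbTE bi; rewrite Xd bi mul0r.
rewrite big_seq big1 // => b; rewrite mem_mdivs Xd; case: eqP => [->|_]; last by rewrite mul0r.
by rewrite mle_delta ai.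
Qed.

Lemma deg_ge_ideal N : is_ideal (deg_ge N).
Proof.
split=> [a _ //|s t sN tN a aN|s t tN a aN].
  by change (s a + t a = 0); rewrite sN ?tN ?addr0.
rewrite ps_mulE big_seq big1 // => b; rewrite mem_mdivs => ba; rewrite tN ?mulr0 //.
by apply: leq_ltn_trans aN; rewrite -{2}(msubKC ba) mdegD leq_addl.
Qed.

Lemma deg_geM M N s t : deg_ge M s -> deg_ge N t -> deg_ge (M + N) (s * t).
Proof.
move=> sM tN a aMN; rewrite ps_mulE big_seq big1 // => b; rewrite mem_mdivs => ba.
have := mdegD b (msub a b); rewrite msubKC // => ab.
have [bM|Mb] := ltnP (mdeg b) M; first by rewrite sM ?mul0r.
by rewrite tN ?mulr0 //; lia.
Qed.

Lemma deg_ge_split N s : deg_ge N.+1 s ->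
  exists F : 'I_h -> S, (forall i, deg_ge N (F i)) /\ s = \sum_i X i * F i.
Proof.
move=> sN.
(* F i collects the monomials whose first variable is X_i. *)
pose first (i : 'I_h) a := (0 < a i)%N && [forall j : 'I_h, (j < i)%N ==> (a j == 0%N)].
pose F i : S := fun a => if first i (madd (mdelta i) a) then s (madd (mdelta i) a) else 0.
exists F; split=> [i a aN|].
  by rewrite /F; case: ifP => // _; rewrite sN // mdegD mdeg_delta add1n ltnS.
have term i a : (X i * F i) a = if first i a then s a else 0.
  rewrite psX_mul /F; case: ifP => ai; last by rewrite /first ai.
  by rewrite msubKC // mle_delta.
apply/funext => a; rewrite ps_sumE.
have [a0|] := posnP (mdeg a).
  rewrite sN ?a0 // big1 // => i _; rewrite term /first.
  by move/eqP: a0; rewrite mdeg_eq0 => /eqP ->; rewrite ffunE.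
rewrite lt0n sum_nat_eq0 negb_forall => /existsP [i0 ai0].
have [i ai imin] := @arg_minnP _ i0 (fun i => a i != 0)%N (fun i : 'I_h => i : nat) ai0.
have fi : first i a.
  rewrite /first lt0n ai; apply/forallP => j; apply/implyP => ji.
  by apply: contraTT ji => aj; rewrite -leqNgt; exact: imin.
rewrite (bigD1 i) //= term fi big1 ?addr0 // => j ji; rewrite term; case: ifP => // fj.
case/eqP: ji; apply/val_inj/eqP; rewrite eqn_leq.
case/andP: fj => aj /forallP fj; case/andP: fi => _ /forallP fi.
have fj' k : a k != 0%N -> (j <= k)%N.
  by rewrite leqNgt; apply: contraNN => kj; exact: (implyP (fj k)).
by rewrite fj' //= imin // -lt0n.
Qed.

(** Continuity is automatic: splitting off one variable at a time expresses a series of high order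
    through products of the X_i. *)
Lemma deg_ge_hom (A : comAlgType K) (m : set A) (chi : {lrmorphism S -> A}) N s : is_ideal m ->
  (forall i, m (chi (X i))) -> deg_ge N s -> ideal_pow m N (chi s).
Proof.
move=> im mX; elim: N s => [|N IH] s sN; first exact: ideal_pow0.
have [F [FN ->]] := deg_ge_split sN; rewrite rmorph_sum.
apply: ideal_sum => [|i _]; first exact: ideal_pow_ideal.
by rewrite rmorphM; apply: ideal_powS; [exact: mX | exact: IH (FN i)].
Qed.

Section Evaluation.
Variables (A : comAlgType K) (x : 'I_h -> A).

Definition pev N s : A := \sum_(b <- mdivs (mtop h N)) s b *: xmon x b.

Lemma pev_linear N : linear (pev N).
Proof.
move=> k s t; rewrite /pev scaler_sumr -big_split; apply: eq_bigr => b _.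
by change ((k * s b + t b) *: xmon x b = k *: (s b *: xmon x b) + t b *: xmon x b);
  rewrite scalerDl scalerA.
Qed.

Lemma pev1 N : pev N 1 = 1.
Proof.
rewrite /pev (bigD1_seq (mone h)) ?mdivs_uniq ?mem_mdivs ?mle0 //= xmon1.
rewrite [(1 : S) _](_ : _ = 1) ?scale1r; last by change (1 *+ (mone h == mone h) = 1 :> K); rewrite eqxx.
rewrite big1 ?addr0 // => b /negbTE b0; rewrite [(1 : S) _](_ : _ = 0) ?scale0r //.
by change (1 *+ (b == mone h) = 0 :> K); rewrite b0.
Qed.

Lemma pevX N i : (0 < N)%N -> pev N (X i) = x i.
Proof.
move=> N0; rewrite /pev (bigD1_seq (mdelta i)) ?mdivs_uniq //=; last first.
  by rewrite mem_mdivs mdeg_le_top // mdeg_delta.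
have Xd b : X i b = (b == mdelta i)%:R by [].
rewrite Xd eqxx scale1r xmon_delta big1 ?addr0 // => b /negbTE b0.
by rewrite Xd b0 scale0r.
Qed.

Variable m : set A.
Hypotheses (im : is_ideal m) (mx : forall i, m (x i)).

Lemma pevM N s t : ideal_pow m N (pev N s * pev N t - pev N (s * t)).
Proof.
have iP := ideal_pow_ideal m N.
have -> : pev N (s * t) = \sum_(b <- mdivs (mtop h N))
    \sum_(c <- mdivs (mtop h N) | mle (madd b c) (mtop h N)) (s b * t c) *: xmon x (madd b c).
  rewrite /pev (eq_big_seq (fun a => \sum_(b <- mdivs (mtop h N) | mle b a)
      (s b * t (msub a b)) *: xmon x a)) => [|a]; last first.
    rewrite mem_mdivs => aN; rewrite ps_mulE scaler_suml -[RHS]big_filter.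
    apply: perm_big; apply: uniq_perm; rewrite ?filter_uniq ?mdivs_uniq // => b.
    by rewrite mem_filter !mem_mdivs; case ba: (mle b a); rewrite //= (mle_trans ba aN).
  rewrite (exchange_big_dep predT) //=; apply: eq_bigr => b _.
  rewrite -[LHS]big_filter -[RHS]big_filter.
  rewrite (perm_big [seq madd b c | c <- [seq c <- mdivs (mtop h N) | mle (madd b c) (mtop h N)]]) /=.
    by rewrite big_map; apply: eq_bigr => c _; rewrite maddK.
  apply: uniq_perm; rewrite ?filter_uniq ?mdivs_uniq //.
    rewrite map_inj_uniq ?filter_uniq ?mdivs_uniq //.
    by apply: (can_inj (g := fun y => msub y b)) => c; rewrite maddK.
  move=> a; rewrite mem_filter mem_mdivs; apply/andP/mapP => [[ba aN]|[c]].
    exists (msub a b); last by rewrite msubKC.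
    by rewrite mem_filter mem_mdivs msubKC // aN (mle_trans (msub_le a b) aN).
  by rewrite mem_filter => /andP [bcN _] ->; rewrite mle_add.
rewrite /pev mulr_suml -sumrB; apply: ideal_sum => // b _.
rewrite mulr_sumr (bigID (fun c => mle (madd b c) (mtop h N))) /= addrAC.
rewrite -sumrB big1 ?add0r => [|c _]; last first.
  by rewrite -scalerAl -scalerAr scalerA xmonD subrr.
apply: ideal_sum => // c bc; rewrite -scalerAl -scalerAr scalerA -xmonD -mulr_algl.
by apply: idealM => //; apply: xmon_pow => //; apply: ltnW; exact: mdeg_not_top.
Qed.

Lemma pev_le N N' s : (N <= N')%N -> ideal_pow m N (pev N' s - pev N s).
Proof.
move=> NN'; have iP := ideal_pow_ideal m N.
rewrite /pev (bigID (fun b => mle b (mtop h N))) /= addrAC.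
rewrite -[X in X - _]big_filter (perm_big (mdivs (mtop h N))) /=; last first.
  apply: uniq_perm; rewrite ?filter_uniq ?mdivs_uniq // => b.
  rewrite mem_filter !mem_mdivs; case bN: (mle b _) => //=.
  by rewrite (mle_trans bN) //; apply/mleP => i; rewrite !ffunE.
rewrite subrr add0r; apply: ideal_sum => // b bN; rewrite -mulr_algl.
by apply: idealM => //; apply: xmon_pow => //; apply: ltnW; exact: mdeg_not_top.
Qed.

(** Words are grouped by their exponent vectors. This links the relations of the hull with the sums
    over words that occur in [mc_defect]. *)
Lemma pev_abelianize N (t : tseries K h) :
  ideal_pow m N (pev N (abelianize t) - weval x N (fun w => (t w)%:A : A^o)).
Proof.
have iP := ideal_pow_ideal m N.
pose g k a : A := \sum_(w : k.-tuple 'I_h | wtype w == a) t w *: xprod x w.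
have abE a : abelianize t a *: xmon x a = g (mdeg a) a.
  rewrite /abelianize scaler_suml; apply: eq_big => [w|w /forallP wa].
    apply/forallP/eqP => [wa|/ffunP wa i]; last by have := wa i; rewrite ffunE => ->.
    by apply/ffunP => i; rewrite ffunE; exact/eqP.
  congr (_ *: _); rewrite -xmon_wtype; congr xmon; apply/ffunP => i.
  by rewrite ffunE; apply/esym/eqP.
have -> : weval x N (fun w => (t w)%:A : A^o) =
    \sum_(b <- mdivs (mtop h N)) \sum_(0 <= k < N) g k b.
  rewrite wevalE exchange_big; apply: eq_big_nat => k /andP [_ kN].
  rewrite /g (exchange_big_dep predT) //=; apply: eq_bigr => w _.
  rewrite -big_filter (perm_big [:: wtype w]) /=.
    by rewrite big_seq1 -[LHS]/(xprod x w * (t w)%:A) mulrC mulr_algl.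
  apply: uniq_perm; rewrite ?filter_uniq ?mdivs_uniq // => b.
  rewrite mem_filter mem_mdivs inE eq_sym; case: eqP => [->|//].
  by rewrite mdeg_le_top // mdeg_wtype size_tuple ltnW.
rewrite /pev -sumrB; apply: ideal_sum => // b _; rewrite abE.
have g0 k : k != mdeg b -> g k b = 0.
  move=> kb; apply: big1 => w /eqP wb; case/eqP: kb.
  by rewrite -wb mdeg_wtype size_tuple.
have [bN|Nb] := ltnP (mdeg b) N.
  rewrite (bigD1_seq (mdeg b)) ?mem_index_iota ?iota_uniq //= big1 => [|k kb].
    by rewrite addr0 subrr; exact: ideal0.
  exact: g0.
rewrite big_nat big1 ?subr0 => [|k /andP [_ kN]]; last by rewrite g0 // neq_ltn (leq_trans kN Nb).
apply: ideal_sum => // w _; rewrite -mulr_algl; apply: idealM => //.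
by rewrite -xmon_wtype; apply: xmon_pow => //; rewrite mdeg_wtype size_tuple.
Qed.
End Evaluation.

Lemma xmon_psX b a : xmon (@psX K h) b a = (a == b)%:R.
Proof.
have [n] := ubnP (mdeg b); elim: n a b => // n IH a b; rewrite ltnS => bn.
have [b0|] := posnP (mdeg b).
  move/eqP: b0; rewrite mdeg_eq0 => /eqP ->; rewrite xmon1.
  by change (1 *+ (a == mone h) = (a == mone h)%:R :> K).
rewrite lt0n sum_nat_eq0 negb_forall => /existsP [i bi].
have db : mle (mdelta i) b by rewrite mle_delta lt0n.
have bE := msubKC db; rewrite -{1}bE xmonD xmon_delta psX_mul.
case: ifP => ai; last by case: eqP => // ab; move: bi; rewrite -ab -lt0n ai.
rewrite IH; last by move: bn; rewrite -{1}bE mdegD mdeg_delta.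
have da : mle (mdelta i) a by rewrite mle_delta.
congr (nat_of_bool _)%:R; apply/eqP/eqP => [e|-> //].
by rewrite -(msubKC da) e bE.
Qed.

Lemma pev_psX N s : deg_ge N (s - pev (@psX K h) N s).
Proof.
move=> a aN; change (s a - pev (@psX K h) N s a = 0).
rewrite /pev ps_sumE (bigD1_seq a) ?mdivs_uniq //=; last first.
  by rewrite mem_mdivs mdeg_le_top // ltnW.
have Z k t c : (k *: (t : S)) c = k * t c by [].
rewrite Z xmon_psX eqxx mulr1 big1 ?addr0 ?subrr // => b ba.
by rewrite Z xmon_psX eq_sym (negbTE ba) mulr0.
Qed.

Lemma hom_pev (A : comAlgType K) (m : set A) (chi : {lrmorphism S -> A}) N s : is_ideal m ->
  (forall i, m (chi (X i))) -> ideal_pow m N (chi s - pev (fun i => chi (X i)) N s).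
Proof.
move=> im mX; have := deg_ge_hom im mX (@pev_psX N s).
rewrite linearB /=; congr (ideal_pow _ _ (_ - _)).
rewrite /pev raddf_sum; apply: eq_bigr => b _; rewrite /= linearZ; congr (_ *: _).
by rewrite /xmon rmorph_prod; apply: eq_bigr => i _; rewrite rmorphXn.
Qed.

(* X_i - c is invertible for c != 0. *)
Lemma residue_psX (chi : {lrmorphism S -> K^o}) i : chi (X i) = 0.
Proof.
apply/eqP; apply: contraT => c0; pose c : K := chi (X i).
pose v : S := fun a => if [forall j, (j != i) ==> (a j == 0%N)] then c ^- (a i).+1 else 0.
have e : (c%:A - X i) * v = 1.
  apply/funext => a; rewrite mulrBl mulr_algl.
  change (c * v a - (X i * v) a = 1 *+ (a == mone h)); rewrite psX_mul.
  have vE b : b i = (msub b (mdelta i) i).+1 ->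
      v (msub b (mdelta i)) = c * v b.
    move=> bi; rewrite /v.
    have -> : [forall j, (j != i) ==> (msub b (mdelta i) j == 0%N)] = [forall j, (j != i) ==> (b j == 0%N)].
      by apply: eq_forallb => j; rewrite !ffunE; case: (j =P i) => [->|_] //=; rewrite subn0.
    case: ifP => _; last by rewrite mulr0.
    by rewrite bi [in RHS]exprS invfM mulrA mulfV // mul1r.
  case: ifP => ai.
    rewrite vE; last by rewrite !ffunE eqxx subn1 prednK.
    rewrite subrr; case: eqP => // a0; move: ai; by rewrite a0 ffunE.
  rewrite subr0; move/negbT: ai; rewrite -eqn0Ngt => /eqP ai.
  rewrite /v ai expr1; case: ifP => [/forallP aj|aj].
    rewrite mulfV // (_ : a == mone h) //; apply/eqP/ffunP => j; rewrite ffunE.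
    by have [->//|ji] := eqVneq j i; apply/eqP; exact: (implyP (aj j)).
  rewrite mulr0; case: eqP => // a0; move/negP: aj; case.
  by apply/forallP => j; rewrite a0 ffunE eqxx implybT.
have e1 : chi (c%:A - X i) = 0.
  rewrite linearB /= linearZ /= rmorph1.
  by change (c * 1 - c = 0); rewrite mulr1 subrr.
have := congr1 chi e; rewrite rmorphM /= e1 mul0r rmorph1 => /eqP.
by rewrite eq_sym oner_eq0.
Qed.

End PowerSeries.

(* Coefficients take finitely many values: they converge along an ultrafilter on nat. *)
Lemma ultralimit (K : finFieldType) h (I : finType) (u : nat -> I -> pseries K h) :
  exists s : I -> pseries K h, forall N, exists2 n, (N <= n)%N & forall i, deg_ge N (s i - u n i).
Proof.
have [U [uU oU]] := ultraFilterLemma (F := (\oo : set_system nat)) _.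
have lim_ex i a : exists k : K, U [set n | u n i a = k].
  apply: contrapT => nex.
  have nk k : U [set n | u n i a <> k].
    have [Uk|//] := in_ultra_setVsetC [set n | u n i a = k] uU.
    by case: nex; exists k.
  have : U [set n | forall k, u n i a <> k] by apply: filter_forall.
  by move=> /filter_ex [n /(_ (u n i a))].
have /choice [s sP] : forall p : I * mon h, exists k : K, U [set n | u n p.1 p.2 = k].
  by move=> p; exact: lim_ex.
exists (fun i a => s (i, a)) => N.
(* Degree less than N forces all exponents below N, so agreement up to degree N is a finite number
   of conditions, met together on a set of the ultrafilter. *)
pose box := {ffun 'I_h -> 'I_N}.
have Ubox : U [set n | forall p : I * box, u n p.1 [ffun j => val (p.2 j)] = s (p.1, [ffun j => val (p.2 j)])].
  by apply: filter_forall => p; exact: (sP (p.1, [ffun j => val (p.2 j)])).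
have UN : U [set n | (N <= n)%N] by apply: oU; exact: nbhs_infty_ge.
have [n [nbox nN]] := filter_ex (filterI Ubox UN).
exists n => // i a aN.
change (s (i, a) - u n i a = 0).
case: N aN @box Ubox UN nbox nN => [//|N] aN box _ _ nbox _.
have := nbox (i, [ffun j => inord (a j)]) => /=.
have -> : [ffun j => val ([ffun j0 => inord (a j0)] j : 'I_N.+1)] = a.
  apply/ffunP => j; rewrite !ffunE /= inordK //; apply: leq_ltn_trans aN.
  by rewrite /mdeg (bigD1 j) //= leq_addr.
by move=> ->; rewrite subrr.
Qed.

(** * Finite quotients of the hull *)

Section BaseChange.
Variables (G : topGroupType) (F : fieldType) (d : nat) (rho : contRep G F d).
Local Notation C := (cochain G F d).
Local Notation H := (coh (dC rho)).
Variables (m : gmap H H) (f : gmap H C) (h : nat) (e : 'I_h -> H 1%N).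
Variables (n2 : nat) (coord : 'I_n2 -> {linear H 2 -> F^o}).
Variables (A B : comAlgType F) (psi : {lrmorphism A -> B}).

Lemma mc_rep_map (x : 'I_h -> A) N g :
  map_mx psi (mc_rep f e x N g) = mc_rep f e (fun i => psi (x i)) N g.
Proof.
have inAB (P : 'M[F]_d) : map_mx psi (map_mx (in_alg A) P) = map_mx (in_alg B) P.
  by apply/matrixP => i j; rewrite !mxE linearZ /= rmorph1.
rewrite /mc_rep map_mxB inAB; congr (_ - _); rewrite /mc_value.
rewrite (weval_raddf (psi := psi) (f := map_mx psi)); last first.
  by move=> a v; apply/matrixP => i j; rewrite !mxE; exact: rmorphM.
by apply: eq_weval => w; exact: inAB.
Qed.

Lemma mc_rel_map (x : 'I_h -> A) N j :
  psi (mc_rel m e coord x N j) = mc_rel m e coord (fun i => psi (x i)) N j.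
Proof.
rewrite /mc_rel; move: (relw m e coord j) => r.
elim: N r => [|N IH] r /=; first exact: rmorph0.
rewrite rmorphD rmorph_sum /= linearZ /= rmorph1; congr (_ + _).
by apply: eq_bigr => i _; rewrite rmorphM /=; congr (_ * _); exact: (IH (fun w => r (i :: w))).
Qed.

Lemma mc_rep_stable (x : 'I_h -> A) N N' g : (N <= N')%N ->
  (forall w, size w = N -> xprod x w = 0) -> mc_rep f e x N' g = mc_rep f e x N g.
Proof.
move=> NN' xN; congr (_ - _); rewrite /mc_value -[LHS]scale1r -[RHS]scale1r.
by apply: weval_stable => // w /xN ->; rewrite mulr0.
Qed.

Lemma strictly_equivalent_map (resA : {lrmorphism A -> F^o}) (resB : {lrmorphism B -> F^o})
    (r r' : G -> 'M[A]_d) : resB \o psi =1 resA -> strictly_equivalent resA r r' ->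
  strictly_equivalent resB (fun g => map_mx psi (r g)) (fun g => map_mx psi (r' g)).
Proof.
move=> resAB [P [Q [PQ QP resP rr]]]; exists (map_mx psi P), (map_mx psi Q); split=> [|||g].
- by rewrite -map_mxM PQ map_mx1.
- by rewrite -map_mxM QP map_mx1.
- by rewrite -map_mx_comp -resP; apply/matrixP => i j; rewrite !mxE; exact: resAB.
- by rewrite rr !map_mxM.
Qed.

Lemma eq_strictly_equivalent (res : {lrmorphism A -> F^o}) (r1 r2 r1' r2' : G -> 'M[A]_d) :
  r1 =1 r1' -> r2 =1 r2' -> strictly_equivalent res r1 r2 -> strictly_equivalent res r1' r2'.
Proof. by move=> /funext <- /funext <-. Qed.
End BaseChange.

(** * Generators of the ideal of relations and the truncated hull *)

Section HullRelations.
Variables (G : topGroupType) (F : finFieldType) (d : nat) (rho : contRep G F d).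
Local Notation C := (cochain G F d).
Local Notation H := (coh (dC rho)).
Variables (m : gmap H H) (f : gmap H C).
Hypothesis mf : Ainf_model m f.
Variables (h : nat) (e : 'I_h -> H 1%N).
Variables (n2 : nat) (eps : 'I_n2 -> H 2) (coord : 'I_n2 -> {linear H 2 -> F^o}).
Hypothesis coordE : forall x, x = \sum_j (coord j x : F) *: eps j.
Local Notation S := (pseries F h).
Local Notation X := (psX F).

Lemma mdualE (phi : {linear H 2 -> F^o}) w :
  mdual m e phi w = - (phi (twist m 2 (degree1_word e w)) : F).
Proof.
rewrite /mdual; case: ifP => w2.
  rewrite -[[seq _ | i <- w]]/(degree1_word e w) /bar linearN; congr (- phi _).
  by rewrite bar_expE /twist; case: w w2.
have -> : twist m 2 (degree1_word e w) = 0; last by rewrite linear0 oppr0.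
case: w w2 => [|i [|//]] //= _; rewrite /twist /=.
by have [_ m1 _ _ _] := mf; have := m1 _ (e i) 2; rewrite /op1 => ->; rewrite scaler0.
Qed.

Definition relation j : S := abelianize (mdual m e (coord j)).

Lemma abelianize_mdual phi : abelianize (mdual m e phi) = \sum_j (phi (eps j) : F) *: relation j.
Proof.
have phiE x : phi x = \sum_j (phi (eps j) : F) * (coord j x : F).
  rewrite {1}[x]coordE linear_sum; apply: eq_bigr => j _.
  by rewrite linearZ mulrC.
apply/funext => a; rewrite ps_sumE.
have Z (k : F) (t : S) c : (k *: t) c = k * t c by [].
rewrite /abelianize (eq_bigr (fun w : (\sum_i a i)%N.-tuple 'I_h =>
   \sum_j (phi (eps j) : F) * mdual m e (coord j) w)) => [|w _].
  rewrite exchange_big; apply: eq_bigr => j _; rewrite Z mulr_sumr.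
  by apply: eq_bigr.
rewrite mdualE phiE -sumrN; apply: eq_bigr => j _.
by rewrite mdualE mulrN.
Qed.

Lemma relation_mem j : relation j \in mdual_ideal m e.
Proof. by apply/asboolP/sub_ideal_gen; exists (coord j). Qed.

(** A fixed finite number of generators, indexed by a basis of H^2, so that membership amounts to
    finding [n2] series; those are what a compactness argument can converge. *)
Lemma mdual_idealP s :
  s \in mdual_ideal m e <-> exists c : 'I_n2 -> S, s = \sum_j c j * relation j.
Proof.
split=> [/asboolP|[c ->]]; last first.
  apply/asboolP; apply: ideal_sum => [|j _]; first exact: ideal_gen_ideal.
  by apply: idealM; [exact: ideal_gen_ideal | exact/asboolP/relation_mem].
apply: (ideal_gen_sub (J := [set s | exists c : 'I_n2 -> S, s = \sum_j c j * relation j])) => [|_ [phi _ <-]].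
  split=> [|x y [c ->] [c' ->]|a x [c ->]].
  - by exists (fun=> 0); rewrite big1 // => j _; rewrite mul0r.
  - by exists (fun j => c j + c' j); rewrite -big_split; apply: eq_bigr => j _; rewrite mulrDl.
  - by exists (fun j => a * c j); rewrite mulr_sumr; apply: eq_bigr => j _; rewrite mulrA.
exists (fun j => (phi (eps j) : F)%:A); rewrite abelianize_mdual.
by apply: eq_bigr => j _; rewrite mulr_algl.
Qed.

Lemma mc_rel1 (A : comAlgType F) (x : 'I_h -> A) j : mc_rel m e coord x 1 j = 0.
Proof.
rewrite /mc_rel /= /relw /= linear0 scale0r add0r big1 // => i _.
exact: scaler0.
Qed.

Section OneAlgebra.
Variables (A : comAlgType F) (x : 'I_h -> A) (I : set A) (N : nat).
Hypotheses (iI : is_ideal I) (Ix : forall i, I (x i)).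

Lemma pev_relation j : ideal_pow I N (pev x N (relation j) + mc_rel m e coord x N j).
Proof.
have := pev_abelianize iI Ix N (mdual m e (coord j)).
congr (ideal_pow _ _ (_ + _)); have -> : mdual m e (coord j) = fun w => - relw m e coord j w by apply/funext => w; exact: mdualE.
rewrite /mc_rel; move: (relw m e coord j) => r.
elim: N r => [|n IH] r /=; first by rewrite oppr0.
rewrite opprD scaleNr opprK -sumrN; congr (_ + _); apply: eq_bigr => i _.
by apply: (etrans (esym (mulrN _ _))); congr (_ * _); exact: (IH (fun w => r (i :: w))).
Qed.
End OneAlgebra.

Lemma hom_relation (A : comAlgType F) (I : set A) N (chi : {lrmorphism S -> A}) j :
  is_ideal I -> ideal_pow I N = [set 0] -> (forall i, I (chi (X i))) ->
  chi (relation j) = - mc_rel m e coord (fun i => chi (X i)) N j.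
Proof.
move=> iI IN IX; apply/eqP; rewrite -addr_eq0; apply/eqP.
have := idealD (ideal_pow_ideal I N) (hom_pev N (relation j) iI IX) (pev_relation N iI IX j).
by rewrite IN /= addrA subrK.
Qed.

Definition trunc_ideal N : set S := [set s | exists2 r, r \in mdual_ideal m e & deg_ge N (s - r)].

Lemma hull_quotient N : exists (B : comAlgType F) (p : {lrmorphism S -> B}) (resB : {lrmorphism B -> F^o}),
  [/\ (forall b, exists s, p s = b), forall s, p s = 0 <-> trunc_ideal N.+1 s,
      forall i, resB (p (X i)) = 0, finitely_many B &
      ideal_pow [set b | resB b = 0] N.+1 = [set 0]].
Proof.
pose c0 (s : S) : F^o := s (mone h).
have c0B : zmod_morphism c0 by [].
have c0M : monoid_morphism c0.
  split=> [|s t]; first by rewrite /c0 [LHS](_ : _ = 1 *+ (mone h == mone h)) // eqxx.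
  rewrite /c0 ps_mulE (bigD1_seq (mone h)) ?mdivs_uniq ?mem_mdivs ?mle_refl //= msub0.
  rewrite big_seq_cond big1 ?addr0 // => b /andP []; rewrite mem_mdivs => /mleP b0 /eqP []; apply/ffunP => i.
  by have := b0 i; rewrite !ffunE leqn0 => /eqP.
have c0Z : scalable c0 by [].
pose c0L : {lrmorphism S -> F^o} := HB.pack_for {lrmorphism S -> F^o} c0
  (GRing.isZmodMorphism.Build S F^o c0 c0B) (GRing.isMonoidMorphism.Build S F^o c0 c0M)
  (GRing.isScalable.Build F S F^o *:%R c0 c0Z).
have c0X i : c0L (X i) = 0 by exact: residue_psX.
have c0I s : s \in mdual_ideal m e -> c0L s = 0.
  have ker0 : is_ideal [set 0 : F^o] by split=> [//|x y /= -> ->|a x /= ->]; rewrite ?addr0 ?mulr0.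
  (* Evaluation in the residue field with truncation 1 sees the empty word only: a relation has no
     constant term. *)
  have rel0 j : c0L (relation j) = 0.
    rewrite (@hom_relation F^o [set 0] 1 c0L j) //; last first.
      apply/seteqP; split=> x /=; first exact: ideal_pow1.
      by move=> ->; exact: (ideal0 (ideal_pow_ideal _ _)).
    by rewrite mc_rel1 oppr0.
  move=> /mdual_idealP [c ->]; rewrite rmorph_sum big1 // => j _.
  apply: (etrans (rmorphM c0L _ _)); apply: (etrans (congr1 ( *%R _) (rel0 j))).
  exact: mulr0.
have iT : is_ideal (trunc_ideal N.+1).
  have iI := ideal_gen_ideal (range (fun phi => abelianize (mdual m e phi))).
  have iD := deg_ge_ideal F h N.+1.
  split=> [|s t [r rI sr] [r' rI' tr]|a s [r rI sr]].
  - by exists 0; [apply/asboolP; exact: (ideal0 iI) | rewrite subrr; exact: (ideal0 iD)].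
  - exists (r + r'); first by apply/asboolP; apply: (idealD iI); exact/asboolP.
    by rewrite opprD addrACA; exact: (idealD iD).
  - exists (a * r); first by apply/asboolP; apply: (idealM _ iI); exact/asboolP.
    by rewrite -mulrBr; exact: (idealM _ iD).
have c0T s : trunc_ideal N.+1 s -> c0L s = 0.
  move=> [r /c0I r0 /(_ (mone h))]; rewrite [mdeg _](_ : _ = 0)%N; last by apply/eqP; rewrite mdeg_eq0.
  move=> /(_ isT) => sr; have : c0L (s - r) = 0 := sr.
  by rewrite rmorphB /= -[c0 r]/(c0L r) r0 subr0.
have T1 : ~ trunc_ideal N.+1 1.
  by move=> /c0T; rewrite rmorph1 => /eqP; rewrite oner_eq0.
have [B [p [psurj pker]]] := quotient_exists iT T1.
have [resB resBp] := factor_through psurj (fun s ps => c0T s ((pker s).1 ps)).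
exists B, p, resB; split=> //.
- by move=> i; rewrite resBp c0X.
- pose box := {ffun 'I_h -> 'I_N.+1}.
  exists {ffun box -> F}, (fun c : {ffun box -> F} => p (fun a => c ([ffun i => inord (a i)] : box))).
  move=> b; have [s <-] := psurj b; exists [ffun k : box => s [ffun i => val (k i)]].
  apply/subr0_eq; rewrite -rmorphB; apply/pker; exists 0; first by apply/asboolP; exact: (ideal0 (ideal_gen_ideal _)).
  rewrite subr0 => a aN; apply/eqP; rewrite -[_ a]/(_ a - s a) subr_eq0 ffunE; apply/eqP; congr (s _).
  apply/ffunP => i; rewrite !ffunE /= inordK //; apply: leq_ltn_trans aN.
  by rewrite /mdeg (bigD1 i) //= leq_addr.
- apply/seteqP; split=> b; last by move=> /= ->; exact: (ideal0 (ideal_pow_ideal _ _)).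
  (* The k-th power of the maximal ideal lifts to series of order at least k, so the power N+1 dies
     in the truncation. *)
  have pow k : ideal_pow [set b | resB b = 0] k `<=` [set b | exists2 s, deg_ge k s & b = p s].
    elim: k => [|k IH]; first by move=> b' _; have [s <-] := psurj b'; exists s.
    apply: ideal_pow_min => [|b1 b2 r0 /IH [t tk ->]].
      split=> [|b1 b2 [s sk ->] [t tk ->]|b1 b2 [t tk ->]].
      + by exists 0; [exact: (ideal0 (deg_ge_ideal _ _ _)) | rewrite rmorph0].
      + by exists (s + t); [exact: (idealD (deg_ge_ideal _ _ _)) | rewrite rmorphD].
      + have [s <-] := psurj b1; exists (s * t); last by rewrite rmorphM.
        exact: (idealM _ (deg_ge_ideal _ _ _)).
    move: r0; have [s <-] := psurj b1; rewrite /= resBp => s0.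
    exists (s * t); last by rewrite rmorphM.
    rewrite -add1n; apply: deg_geM => // a; rewrite ltnS leqn0 mdeg_eq0 => /eqP ->; exact: s0.
  move=> /pow [s sN ->] /=; apply/pker; exists 0; last by rewrite subr0.
  by apply/asboolP; exact: (ideal0 (ideal_gen_ideal _)).
Qed.

End HullRelations.

(** * Complete Noetherian algebras *)

Section CompleteRing.
Variables (F : finFieldType) (R : comAlgType F) (res : {lrmorphism R -> F^o}).
Hypothesis compR : complete_local_noetherian res.
Local Notation mR := [set y | res y = 0].
Let iR : is_ideal mR := res_ideal res.
Let iRn n : is_ideal (ideal_pow mR n) := ideal_pow_ideal _ _.

Lemma adic_separated y : (forall n, ideal_pow mR n y) -> y = 0.
Proof.
move=> yn; have [_ _ /(_ (fun=> 0)) [|z [_ zu]]] := compR.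
  by move=> k; rewrite subrr; exact: ideal0.
transitivity z; first by apply/esym/zu => k; rewrite subr0.
by apply: zu => k; rewrite subr0; exact: ideal0.
Qed.

Lemma adic_limit (u : nat -> R) : (forall k, ideal_pow mR k (u k.+1 - u k)) ->
  exists x, forall k, ideal_pow mR k (x - u k).
Proof. by have [_ _ complete] := compR; move=> /complete [x [xu _]]; exists x. Qed.

(** Modulo the next power, m^n is spanned over F by finitely many ideal generators, and F is finite;
    hence all R / m^n are finite. *)
Lemma adic_residues n : exists (I : finType) (g : I -> R),
  forall y, exists i, ideal_pow mR n (y - g i).
Proof.
elim: n => [|n [I [g gP]]].
  by exists unit, (fun=> 0) => y; exists tt; exact: ideal_pow0.
have [_ noeth _] := compR; have [s sE] := noeth _ (iRn n).
pose comb (c : {ffun 'I_(size s) -> F}) := \sum_i c i *: s`_i.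
exists (I * {ffun 'I_(size s) -> F})%type, (fun u => g u.1 + comb u.2) => y.
have [i yi] := gP y.
suff [c yc] : exists c, ideal_pow mR n.+1 (y - g i - comb c).
  by exists (i, c); rewrite opprD addrA.
(* The elements of m^n that are F-combinations of the generators modulo m^(n+1) form an ideal, since
   a scalar of R acts there through its residue. *)
pose J := [set z | ideal_pow mR n z /\ exists c, ideal_pow mR n.+1 (z - comb c)].
have iJ : is_ideal J.
  split=> [|u v [un [c uc]] [vn [c' vc]]|a u [un [c uc]]].
  - split; [exact: ideal0 | exists [ffun=> 0]].
    rewrite /comb big1 ?subrr => [|k _]; last by rewrite ffunE scale0r.
    exact: ideal0.
  - split; [exact: idealD | exists [ffun k => c k + c' k]].
    have -> : comb [ffun k => c k + c' k] = comb c + comb c'.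
      by rewrite -big_split; apply: eq_bigr => k _; rewrite ffunE scalerDl.
    by rewrite opprD addrACA; exact: idealD.
  - split; [exact: idealM | exists [ffun k => (res a : F) * c k]].
    have -> : comb [ffun k => (res a : F) * c k] = (res a : F)%:A * comb c.
      by rewrite mulr_sumr; apply: eq_bigr => k _; rewrite ffunE mulr_algl scalerA.
    have -> : a * u - (res a : F)%:A * comb c =
        (a - (res a : F)%:A) * u + (res a : F)%:A * (u - comb c).
      by rewrite mulrBl mulrBr; abel.
    apply: idealD => //; last exact: idealM.
    by apply: ideal_powS => //; exact: res_split.
have sJ : [set` s] `<=` J.
  move=> z /= zs; split; first by rewrite sE; exact: sub_ideal_gen.
  have zk : (index z s < size s)%N by rewrite index_mem.
  exists [ffun k => (k == Ordinal zk)%:R].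
  rewrite /comb (bigD1 (Ordinal zk)) //= ffunE eqxx scale1r nth_index // big1 ?addr0 ?subrr.
    exact: ideal0.
  by move=> k /negbTE kz; rewrite ffunE kz scale0r.
by move: yi; rewrite {1}sE => /(ideal_gen_sub iJ sJ) [].
Qed.

Lemma adic_quotient n : exists (Q : comAlgType F) (p : {lrmorphism R -> Q}) (resQ : {lrmorphism Q -> F^o}),
  [/\ forall q, exists y, p y = q, forall y, p y = 0 <-> ideal_pow mR n.+1 y,
      forall y, resQ (p y) = res y, finitely_many Q &
      ideal_pow [set q | resQ q = 0] n.+1 = [set 0]].
Proof.
have resn y : ideal_pow mR n.+1 y -> res y = 0.
  by move=> yn; exact: (ideal_pow1 iR (ideal_pow_le iR (ltn0Sn n) yn)).
have [|Q [p [psurj pker]]] := quotient_exists (iRn n.+1).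
  by move/resn; rewrite rmorph1 => /eqP; rewrite oner_eq0.
have [resQ resQp] := factor_through psurj (fun y py => resn y ((pker y).1 py)).
exists Q, p, resQ; split=> //.
- have [I [g gP]] := adic_residues n.+1; exists I, (p \o g) => q.
  have [y <-] := psurj q; have [i yi] := gP y; exists i => /=.
  by apply/esym/subr0_eq; rewrite -rmorphB; exact/pker.
apply/seteqP; split=> q; last by move=> /= ->; exact: (ideal0 (ideal_pow_ideal _ _)).
have pow k : ideal_pow [set q | resQ q = 0] k `<=` [set q | exists2 y, ideal_pow mR k y & q = p y].
  elim: k => [|k IH]; first by move=> q' _; have [y <-] := psurj q'; exists y; [exact: ideal_pow0|].
  apply: ideal_pow_min => [|q1 q2 r0 /IH [y yk ->]].
    split=> [|q1 q2 [y yk ->] [z zk ->]|q1 q2 [z zk ->]].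
    + by exists 0; [exact: ideal0 | rewrite rmorph0].
    + by exists (y + z); [exact: idealD | rewrite rmorphD].
    + have [y <-] := psurj q1; exists (y * z); last by rewrite rmorphM.
      exact: idealM.
  move: r0; have [z <-] := psurj q1; rewrite /= resQp => z0.
  by exists (z * y); [exact: ideal_powS | rewrite rmorphM].
by move=> /pow [y yn ->] /=; apply/pker.
Qed.

Section PowerSeriesValues.
Variables (h : nat) (x : 'I_h -> R).
Hypothesis mx : forall i, mR (x i).
Local Notation S := (pseries F h).

(** The value is the limit of the truncated evaluations, which it characterises; the algebra laws
    are checked modulo each power of the maximal ideal. *)
Lemma series_morphism : exists phi : {lrmorphism S -> R},
  forall N s, ideal_pow mR N (phi s - pev x N s).
Proof.
have /choice [phi phiP] : forall s, exists y, forall N, ideal_pow mR N (y - pev x N s).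
  by move=> s; apply: adic_limit => k; exact: pev_le.
have phi_uniq s y : (forall N, ideal_pow mR N (y - pev x N s)) -> phi s = y.
  move=> yP; apply/subr0_eq/adic_separated => N.
  have -> : phi s - y = (phi s - pev x N s) - (y - pev x N s) by abel.
  exact: idealB.
have pevL N : linear (pev x N : S -> R) by exact: pev_linear.
have phiL : linear phi.
  move=> a s t; apply: phi_uniq => N; rewrite pev_linear opprD addrACA -scalerBr.
  by apply: idealD => //; rewrite -mulr_algl; exact: idealM.
have phiB : zmod_morphism phi.
  by move=> s t; rewrite addrC -scaleN1r phiL scaleN1r addrC.
have phiZ : scalable phi.
  have phi0 : phi 0 = 0 by rewrite -[X in phi X](subrr 0) phiB subrr.
  by move=> a s; rewrite -[X in phi X]addr0 phiL phi0 addr0.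
have phiM : monoid_morphism phi.
  split=> [|s t]; apply: phi_uniq => N.
    by rewrite pev1 subrr; exact: ideal0.
  have -> : phi s * phi t - pev x N (s * t) = (phi s - pev x N s) * phi t
     + pev x N s * (phi t - pev x N t) + (pev x N s * pev x N t - pev x N (s * t)).
    by rewrite mulrBl mulrBr; abel.
  apply: idealD; [exact: iRn | apply: idealD; first exact: iRn | exact: pevM].
    exact: idealMr.
  exact: idealM.
by exists (HB.pack_for {lrmorphism S -> R} phi (GRing.isZmodMorphism.Build S R phi phiB)
  (GRing.isMonoidMorphism.Build S R phi phiM) (GRing.isScalable.Build F S R *:%R phi phiZ)).
Qed.
End PowerSeriesValues.

Lemma series_morphism_unique h (phi psi : {lrmorphism pseries F h -> R}) :
  (forall i, mR (phi (psX F i))) -> (forall i, phi (psX F i) = psi (psX F i)) -> phi =1 psi.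
Proof.
move=> mphi e s; apply/subr0_eq/adic_separated => N.
have mpsi i : mR (psi (psX F i)) by rewrite -e.
have := idealB (iRn N) (hom_pev N s iR mphi) (hom_pev N s iR mpsi).
have -> : (fun i => phi (psX F i)) = (fun i => psi (psX F i)) by apply/funext.
by rewrite opprB addrA subrK.
Qed.
End CompleteRing.

(** * The universal point *)

Section UniversalDeformation.
Variables (G : topGroupType) (F : finFieldType) (d : nat) (rho : contRep G F d).
Local Notation C := (cochain G F d).
Local Notation H := (coh (dC rho)).
Variables (m : gmap H H) (f : gmap H C).
Hypothesis mf : Ainf_model m f.
Hypothesis irr : absolutely_irreducible rho.
Variables (h : nat) (e : 'I_h -> H 1%N).
Hypothesis basis_e : is_basis e.
Variables (n2 : nat) (eps : 'I_n2 -> H 2) (coord : 'I_n2 -> {linear H 2 -> F^o}).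
Hypothesis basis_eps : is_basis eps.
Hypothesis coordE : forall x, x = \sum_j (coord j x : F) *: eps j.
Variables (R : comAlgType F) (res : {lrmorphism R -> F^o}) (eta : prorepresentation G d R).
Hypothesis compR : complete_local_noetherian res.
Hypothesis pro : prorepresents rho eta.
Local Notation mR := [set y | res y = 0].
Local Notation S := (pseries F h).
Local Notation X := (psX F).
Let iR : is_ideal mR := res_ideal res.
Let iRn n : is_ideal (ideal_pow mR n) := ideal_pow_ideal _ _.

Lemma res_morph (A : comAlgType F) (resA : {lrmorphism A -> F^o}) (psi : {lrmorphism R -> A}) y :
  resA (psi y) = res y.
Proof.
by have [loc _ _] := compR; exact: (local_morph_unique (resA \o psi : {lrmorphism R -> F^o}) loc).
Qed.

(* The point x of the hull induces the universal deformation modulo m^(n+2). *)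
Definition classifies_upto n (x : 'I_h -> R) :=
  forall (A : comAlgType F) (resA : {lrmorphism A -> F^o}), local_artinian resA ->
    ideal_pow [set a | resA a = 0] n.+2 = [set 0] ->
    forall psi : {lrmorphism R -> A},
      strictly_equivalent resA (eta resA psi) (mc_rep f e (fun i => psi (x i)) n.+2).

(** [mc_injective] over the finite quotient R / m^(n+2), where both points describe the deformation
    of the projection. *)
Lemma classifies_upto_unique n x x' : (forall i, mR (x i)) -> (forall i, mR (x' i)) ->
  classifies_upto n x -> classifies_upto n x' -> forall i, ideal_pow mR n.+2 (x' i - x i).
Proof.
move=> mx mx' cx cx' i; have [Q [p [resQ [psurj pker resp finQ mQ]]]] := adic_quotient compR n.+1.
have art := finite_local_artinian mQ finQ.
apply/pker; rewrite rmorphB; apply/eqP; rewrite subr_eq0; apply/eqP/esym.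
apply: (mc_injective mf irr basis_e mQ finQ (x := p \o x) (x' := p \o x')) => [j|j|] /=.
- by rewrite resp; exact: mx.
- by rewrite resp; exact: mx'.
exact: strictly_equivalent_trans (strictly_equivalent_sym (cx _ _ art mQ p)) (cx' _ _ art mQ p).
Qed.

Lemma classifies_le n k x : (forall i, mR (x i)) -> (n <= k)%N ->
  classifies_upto k x -> classifies_upto n x.
Proof.
move=> mx nk cx A resA art mA psi.
have mA0 l : (n.+2 <= l)%N -> ideal_pow [set a | resA a = 0] l `<=` [set 0].
  by rewrite -mA; exact: ideal_pow_le (res_ideal resA).
have mAk : ideal_pow [set a | resA a = 0] k.+2 = [set 0].
  apply/seteqP; split=> [|a /= ->]; first exact: mA0.
  exact: (ideal0 (ideal_pow_ideal _ _)).
apply: eq_strictly_equivalent (cx A resA art mAk psi) => // g.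
apply: mc_rep_stable => // w wn; apply: (res_nilpotent_xprod mA _ wn) => i /=.
by rewrite res_morph; exact: mx.
Qed.

Lemma classifies_congr n x x' : (forall i, ideal_pow mR n.+2 (x' i - x i)) ->
  classifies_upto n x -> classifies_upto n x'.
Proof.
move=> xx' cx A resA art mA psi; have := cx A resA art mA psi.
have -> // : (fun i => psi (x i)) = (fun i => psi (x' i)).
apply/funext => i; apply/esym/subr0_eq; rewrite -rmorphB.
have : ideal_pow [set a | resA a = 0] n.+2 (psi (x' i - x i)).
  by apply: ideal_pow_morph (xx' i) => y /=; rewrite res_morph.
by rewrite mA.
Qed.

(** [mc_versal] is applied to the universal lift over R / m^(n+2). Any morphism to an algebra with
    m_A^(n+2) = 0 factors through that quotient, and naturality carries the result over. *)
Lemma classifying_point n : exists x : 'I_h -> R,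
  [/\ forall i, mR (x i), forall j, ideal_pow mR n.+2 (mc_rel m e coord x n.+2 j) &
      classifies_upto n x].
Proof.
have [Q [p [resQ [psurj pker resp finQ mQ]]]] := adic_quotient compR n.+1.
have art := finite_local_artinian mQ finQ.
have [lift _ _] := pro.1 Q resQ art.
have [xQ [mxQ relQ repQ]] := mc_versal mf basis_e basis_eps coordE mQ finQ (lift p).
have /choice [x xE] : forall i, exists y, p y = xQ i by move=> i; exact: psurj.
have xQE : xQ = fun i => p (x i) by apply/funext => i; rewrite xE.
exists x; split=> [i|j|A resA artA mA psi].
- by rewrite /= -(resp (x i)) xE; exact: mxQ.
- by apply/pker; rewrite mc_rel_map -xQE; exact: relQ.
have [y yn|psi' psi'E] := factor_through psurj (g := psi).
  have : ideal_pow [set a | resA a = 0] n.+2 (psi y).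
    by apply: ideal_pow_morph ((pker y).1 yn) => z /=; rewrite res_morph.
  by rewrite mA.
have resQA : resA \o psi' =1 resQ.
  by move=> q; have [y <-] := psurj q; rewrite /= psi'E resp res_morph.
have nat := pro.2 _ _ _ _ art artA psi' p psi (fun y => esym (psi'E y)).
have := strictly_equivalent_map resQA repQ.
move/(strictly_equivalent_trans (strictly_equivalent_sym nat)).
apply: eq_strictly_equivalent => // g; rewrite mc_rep_map xQE.
by have -> : (fun i => psi' (p (x i))) = (fun i => psi (x i)) by apply/funext => i.
Qed.

Lemma universal_point : exists x : 'I_h -> R,
  [/\ forall i, mR (x i), forall N j, ideal_pow mR N.+2 (mc_rel m e coord x N.+2 j) &
      forall n, classifies_upto n x].
Proof.
have /choice [u uP] := classifying_point.
have uS k l i : (k <= l)%N -> ideal_pow mR k.+2 (u l i - u k i).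
  move=> kl; have [mk _ ck] := uP k; have [ml _ cl] := uP l.
  exact: (classifies_upto_unique mk ml ck (classifies_le ml kl cl)).
have /choice [x xu] : forall i, exists y, forall k, ideal_pow mR k (y - u k i).
  move=> i; apply: (adic_limit compR) => k.
  by apply: (ideal_pow_le iR _ (uS k k.+1 i (leqnSn k))); rewrite -addn2 leq_addr.
(* The limit is controlled modulo m^k only; comparing with [u k.+2] first recovers the two lost
   orders. *)
have xuS k i : ideal_pow mR k.+2 (x i - u k i).
  have -> : x i - u k i = (x i - u k.+2 i) + (u k.+2 i - u k i) by abel.
  by apply: idealD => //; apply: uS; rewrite -addn2 leq_addr.
have mx i : mR (x i).
  have [m0 _ _] := uP 0%N; rewrite -[x i](subrK (u 0%N i)).
  by apply: idealD => //; apply: (ideal_pow1 iR); exact: (ideal_pow_le iR _ (xuS 0%N i)).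
exists x; split=> [//|n j|n]; last first.
  by have [_ _ cn] := uP n; apply: classifies_congr cn => i; exact: xuS.
have [Q [p [resQ [psurj pker resp finQ mQ]]]] := adic_quotient compR n.+1.
apply/pker; rewrite mc_rel_map; have [_ rn _] := uP n.
have -> : (fun i => p (x i)) = (fun i => p (u n i)).
  by apply/funext => i; apply/subr0_eq; rewrite -rmorphB; apply/pker; exact: xuS.
by rewrite -mc_rel_map; apply/pker; exact: rn.
Qed.

(** * The map from power series to R, compared at the finite levels *)

Section Comparison.
Variable x : 'I_h -> R.
Hypothesis mx : forall i, mR (x i).
Hypothesis relx : forall N j, ideal_pow mR N.+2 (mc_rel m e coord x N.+2 j).
Hypothesis classx : forall n, classifies_upto n x.
Variable phi : {lrmorphism S -> R}.
Hypothesis phiE : forall N s, ideal_pow mR N (phi s - pev x N s).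

Lemma phi_psX i : phi (X i) = x i.
Proof.
apply/subr0_eq/(adic_separated compR) => -[|N]; first exact: ideal_pow0.
by have := phiE N.+1 (X i); rewrite pevX.
Qed.

Lemma phi_relation j : phi (relation m e coord j) = 0.
Proof.
apply: (adic_separated compR) => N; have NN2 : (N <= N.+2)%N by rewrite -addn2 leq_addr.
apply: (ideal_pow_le iR NN2).
set r := relation _ _ _ _; pose mu := mc_rel m e coord x N.+2 j.
have -> : phi r = (phi r - pev x N.+2 r) + (pev x N.+2 r + mu) - mu by rewrite addrA subrK addrK.
apply: (idealB (iRn _)); last exact: relx.
exact: (idealD (iRn _) (phiE _ _) (pev_relation mf e coord N.+2 iR mx j)).
Qed.

Lemma phi_mdual_ideal s : s \in mdual_ideal m e -> phi s = 0.
Proof.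
move/(mdual_idealP mf e coordE) => [c ->]; rewrite rmorph_sum big1 // => j _.
by rewrite rmorphM /= phi_relation mulr0.
Qed.

(** The point X of the truncated hull B satisfies the relations, so it defines a lift, hence a
    morphism [psi] from R to B. Both [psi x] and X describe that lift, so [mc_injective] identifies
    them and [psi \o phi] is the projection. *)
Lemma hull_level N : exists (B : comAlgType F) (p : {lrmorphism S -> B})
    (psi : {lrmorphism R -> B}),
  [/\ forall b, exists s, p s = b, forall s, p s = 0 <-> trunc_ideal m e N.+2 s &
      forall s, psi (phi s) = p s].
Proof.
have [B [p [resB [psurj pker resX finB mB]]]] := hull_quotient mf e coordE N.+1.
have art := finite_local_artinian mB finB.
pose pX i := p (X i).
have relp j : mc_rel m e coord pX N.+2 j = 0.
  apply/eqP; rewrite -oppr_eq0 -(hom_relation mf e coord _ (res_ideal resB) mB) //; apply/eqP/pker.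
  exists (relation m e coord j); first exact: relation_mem.
  by rewrite subrr; exact: (ideal0 (deg_ge_ideal _ _ _)).
have [r rE rlift] := mc_rep_lift mf coordE mB resX relp.
have [_ _ /(_ r rlift) [psi eta_r]] := pro.1 B resB art.
have psix : (fun i => psi (x i)) =1 pX.
  apply: (mc_injective mf irr basis_e mB finB) => [i|//|]; first by rewrite /= res_morph; exact: mx.
  apply: strictly_equivalent_trans (strictly_equivalent_sym (classx art mB psi)) _.
  exact: eq_strictly_equivalent eta_r.
exists B, p, psi; split=> // s; apply/subr0_eq.
have e1 := hom_pev (chi := psi \o phi : {lrmorphism S -> B}) N.+2 s (res_ideal resB).
have e2 := hom_pev N.+2 s (res_ideal resB) resX.
have pp : (fun i => (psi \o phi) (X i)) = pX by apply/funext => i; rewrite /= phi_psX psix.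
have := idealB (ideal_pow_ideal _ _) (e1 _) e2; rewrite pp opprB addrA subrK mB; apply => i.
by rewrite /= -[psi _]/((psi \o phi) (X i)) (congr1 (@^~ i) pp); exact: resX.
Qed.

(** The finite levels give membership in the ideal only up to series of order N, with coefficients
    depending on N; a limit of these coefficients gives true membership. *)
Lemma phi_kernel s : phi s = 0 -> s \in mdual_ideal m e.
Proof.
move=> phis; have trunc N : trunc_ideal m e N s.
  have [B [p [psi [_ pker psiE]]]] := hull_level N.
  have /pker [r rI sr] : p s = 0 by rewrite -psiE phis rmorph0.
  by exists r => // a aN; apply: sr; rewrite (leq_trans aN) // -addn2 leq_addr.
have /choice [c cP] : forall N, exists c : 'I_n2 -> S,
    deg_ge N (s - \sum_j c j * relation m e coord j).
  by move=> N; have [r /(mdual_idealP mf e coordE) [c ->] sr] := trunc N; exists c.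
have [c0 c0P] := ultralimit c.
apply/(mdual_idealP mf e coordE); exists c0.
apply/subr0_eq; set t := s - _; suff tN N : deg_ge N t.
  by apply/funext => a; exact: (tN (mdeg a).+1).
have [n Nn cn] := c0P N; have iD := deg_ge_ideal F h N.
have -> : t = (s - \sum_j c n j * relation m e coord j)
    - \sum_j (c0 j - c n j) * relation m e coord j.
  have -> : \sum_j (c0 j - c n j) * relation m e coord j =
      \sum_j c0 j * relation m e coord j - \sum_j c n j * relation m e coord j.
    by rewrite -sumrB; apply: eq_bigr => j _; rewrite mulrBl.
  by rewrite opprB addrA subrK.
apply: (idealB iD).
  by move=> a aN; apply: cP; exact: leq_trans Nn.
by apply: ideal_sum => [//|j _]; exact: (idealMr _ iD (cn j)).
Qed.

Lemma phi_surjective y : exists s, phi s = y.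
Proof.
have mphi i : mR (phi (X i)) by rewrite phi_psX.
have approx N : exists s, ideal_pow mR N (y - phi s).
  have [Q [q [resQ [qsurj qker resq finQ mQ]]]] := adic_quotient compR N.+1.
  have art := finite_local_artinian mQ finQ.
  have [B [p [psi [psurj pker psiE]]]] := hull_level N.
  (* The truncated hull is mapped back to R / m^(N+2), because [phi] kills the relations and raises
     no series of order N+2 below m^(N+2). *)
  have [s|kappa kappaE] := factor_through psurj (g := q \o phi : {lrmorphism S -> Q}).
    move=> /pker [r /phi_mdual_ideal phir sr]; apply/qker.
    rewrite -[s](subrK r) rmorphD /= phir addr0.
    exact: deg_ge_hom iR mphi sr.
  (* The universal property is used for uniqueness here: both morphisms send x to the same point, so
     they give equivalent lifts. Thus y agrees modulo m^(N+2) with [phi] of a lift of [psi y]. *)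
  have kq : kappa \o psi =1 q.
    have [_ inj _] := pro.1 Q resQ art; apply: (inj (kappa \o psi : {lrmorphism R -> Q})).
    apply: strictly_equivalent_trans (classx art mQ _) (strictly_equivalent_sym _).
    have := classx art mQ q; have -> // : (fun i => q (x i)) = fun i => (kappa \o psi) (x i).
    by apply/funext => i; rewrite -phi_psX /= psiE kappaE.
  have [s ps] := psurj (psi y); exists s.
  apply: (ideal_pow_le iR (l := N.+2)); first by rewrite -addn2 leq_addr.
  apply/qker; have := kq y; rewrite /= -ps kappaE /= => qy.
  have e0 : q y - q (phi s) = 0 by rewrite -qy subrr.
  exact: (etrans (rmorphB q _ _) e0).
have /choice [u uP] := approx.
have [s sP] := ultralimit (fun n (_ : unit) => u n); exists (s tt).
apply/esym/subr0_eq/(adic_separated compR) => N; have [n Nn sn] := sP N.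
have -> : y - phi (s tt) = (y - phi (u n)) - phi (s tt - u n) by rewrite rmorphB; abel.
apply: idealB => //; first exact: (ideal_pow_le iR Nn).
exact: deg_ge_hom iR mphi (sn tt).
Qed.

End Comparison.
End UniversalDeformation.

(** * The isomorphism *)

Section HullIsomorphism.
Variables (G : topGroupType) (F : finFieldType) (d : nat) (rho : contRep G F d).
Local Notation C := (cochain G F d).
Local Notation H := (coh (dC rho)).
Variables (m : gmap H H) (f : gmap H C).
Hypothesis mf : Ainf_model m f.
Hypothesis irr : absolutely_irreducible rho.
Variables (h : nat) (e : 'I_h -> H 1%N).
Hypothesis basis_e : is_basis e.
Variables (R : comAlgType F) (res : {lrmorphism R -> F^o}) (eta : prorepresentation G d R).
Hypothesis compR : complete_local_noetherian res.
Hypothesis pro : prorepresents rho eta.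
Hypothesis H2fin : finite_dimensional (coh (dC rho) 2).
Local Notation mR := [set y | res y = 0].
Local Notation S := (pseries F h).
Local Notation X := (psX F).
Let iR : is_ideal mR := res_ideal res.

Let proj : {lrmorphism S -> abelian_hull m e} := @quot_pi F S (mdual_ideal m e).

Lemma classified_by_upto (phi : {lrmorphism abelian_hull m e -> R}) x :
  (forall i, mR (x i)) -> (forall n, classifies_upto f e eta n x) ->
  (forall i, phi (proj (X i)) = x i) -> classified_by f eta phi.
Proof.
move=> mx cx phix A resA art N mN psi.
have NN2 : (N <= N.+2)%N by rewrite -addn2 leq_addr.
have mN2 : ideal_pow [set a | resA a = 0] N.+2 = [set 0].
  apply/seteqP; split=> [|a /= ->]; last exact: (ideal0 (ideal_pow_ideal _ _)).
  by rewrite -mN; exact: ideal_pow_le (res_ideal resA) NN2.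
apply: eq_strictly_equivalent (cx N A resA art mN2 psi) => // g.
rewrite mc_liftE.
have -> : (fun i => psi (phi (hull_proj m e (X i)))) = (fun i => psi (x i)).
  by apply/funext => i; rewrite -phix.
apply: mc_rep_stable => // w wN; apply: (res_nilpotent_xprod mN _ wN) => i /=.
by rewrite (res_morph compR); exact: mx.
Qed.

Lemma classified_by_values (phi : {lrmorphism abelian_hull m e -> R}) x :
  (forall i, mR (x i)) -> (forall n, classifies_upto f e eta n x) ->
  classified_by f eta phi -> forall i, phi (proj (X i)) = x i.
Proof.
move=> mx cx cphi i.
(* An arbitrary algebra morphism from the hull is automatically local, by [residue_psX]. *)
have mphi j : mR (phi (proj (X j))).
  exact: (residue_psX (res \o (phi \o proj) : {lrmorphism S -> F^o}) j).
apply/subr0_eq/(adic_separated compR) => n.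
apply: (ideal_pow_le iR (l := n.+2)); first by rewrite -addn2 leq_addr.
apply: (classifies_upto_unique mf irr basis_e compR mx mphi (cx n)) => A resA art mA psi.
apply: eq_strictly_equivalent (cphi A resA art _ mA psi) => // g.
exact: mc_liftE.
Qed.

Lemma hull_isomorphism : exists phi : {lrmorphism abelian_hull m e -> R},
  [/\ bijective phi, classified_by f eta phi &
      forall phi' : {lrmorphism abelian_hull m e -> R},
        bijective phi' -> classified_by f eta phi' -> phi' =1 phi].
Proof.
have [n2 [eps basis_eps]] := H2fin; have [coord coordE] := basis_coord basis_eps.
have [x [mx relx cx]] := universal_point mf irr basis_e basis_eps coordE compR pro.
have [phi0 phi0E] := series_morphism compR mx.
have projS q : exists s, proj s = q by exact: quot_pi_surj.
have phi0I s : proj s = 0 -> phi0 s = 0.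
  by move=> /quot_pi_eq0; exact: (phi_mdual_ideal mf coordE compR mx relx phi0E).
have [phi phiE] := factor_through projS phi0I.
have phix i : phi (proj (X i)) = x i by rewrite phiE; exact: (phi_psX compR phi0E).
exists phi; split; last 2 first.
- exact: classified_by_upto mx cx phix.
- move=> phi' _ cphi' q; have [s <-] := projS q.
  have := series_morphism_unique compR (phi := phi' \o proj : {lrmorphism S -> R})
    (psi := phi \o proj : {lrmorphism S -> R}).
  have phix' := classified_by_values mx cx cphi'.
  by apply=> i; [rewrite /= phix'; exact: mx | rewrite /= phix' phix].
have phi_surj y : exists q, phi q = y.
  have [s <-] := phi_surjective mf irr basis_e coordE compR pro mx relx cx phi0E y.
  by exists (proj s).
have [g gK] := choice phi_surj; exists g => // q; apply/subr0_eq.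
have [s sE] := projS (g (phi q) - q); rewrite -sE; apply/quot_pi_eq0.
apply: (phi_kernel mf irr basis_e coordE compR pro mx cx phi0E).
rewrite -phiE sE; apply: (etrans (rmorphB phi _ _)); apply/eqP.
by rewrite subr_eq0; exact/eqP/gK.
Qed.
End HullIsomorphism.

Theorem theorem3p1 (G : topGroupType) (F : finFieldType) (p d : nat)
    (rho : contRep G F d) :
  profinite G -> p \in [pchar F] -> absolutely_irreducible rho ->
  (forall i, finite_dimensional (coh (dC rho) i)) ->
  (exists (m : gmap (coh (dC rho)) (coh (dC rho)))
          (f : gmap (coh (dC rho)) (cochain G F d)),
      Ainf_model m f)
  /\
  (forall (m : gmap (coh (dC rho)) (coh (dC rho)))
          (f : gmap (coh (dC rho)) (cochain G F d)),
      Ainf_model m f ->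
    forall (h : nat) (e : 'I_h -> coh (dC rho) 1%N), is_basis e ->
    forall (R : comAlgType F) (res : {lrmorphism R -> F^o})
           (eta : prorepresentation G d R),
      complete_local_noetherian res -> prorepresents rho eta ->
    exists phi : {lrmorphism abelian_hull m e -> R},
      [/\ bijective phi, classified_by f eta phi &
          forall phi' : {lrmorphism abelian_hull m e -> R},
            bijective phi' -> classified_by f eta phi' -> phi' =1 phi]).
Proof.
move=> _ _ irr fin; split; first exact: Ainf_model_exists.
move=> m f mf h e basis_e R res eta compR pro.
exact: hull_isomorphism compR pro (fin 2).
Qed.
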